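(* Let $c=(1\,2\cdots n)\in\mathfrak{S}_n$. Let $\boldsymbol\beta_K\in\mathbf{B}_n$ be a braid whose closure is a knot $K$, and let $\beta_K$ be the image of $\boldsymbol\beta_K$ in $\mathfrak{S}_n$. Choose $g\in\mathfrak{S}_n$ such that $g\beta_Kg^{-1}=c$, and choose a braid lift $\mathbf{g}\in\mathbf{B}_n$ of $g$. Factor the pure braid $\boldsymbol\rho_K:=\mathbf{g}\boldsymbol\beta_K\mathbf{g}^{-1}\mathbf{B}(c)^{-1}$ as $$\boldsymbol\rho_K=\mathbb{P}_c(t_1)^{\epsilon_1}\cdots\mathbb{P}_c(t_M)^{\epsilon_M}$$ for some $\vec t=(t_1,\ldots,t_M)\in T^M$ and $\vec\epsilon=(\epsilon_1,\ldots,\epsilon_M)\in\{\pm1\}^M$. Then $$(-1)^{n-1}\,\mathrm{sub}_T^{\vec\epsilon}(\vec t,c^{-1})=[a^{-\mathrm{wr}(\boldsymbol\beta_K)-n+1}]\,\mathrm{HOMFLYPT}(K;a,z)\Big|_{z=0}.$$ More generally, $$\mathrm{HOMFLYPT}(K;a,z)\Big|_{z=0}=\sum_{k=0}^{n-1}(-1)^{n-1+k}\sum_{u\in\mathfrak{S}_{n,k}}\mathrm{sub}_T^{(1^{\ell(u)},\vec\epsilon)}\big(\mathrm{rev}(\mathrm{inv}_c(u))\,\vec t,\;c^{-1}\big)\,a^{-\mathrm{wr}(\boldsymbol\beta_K)-n+1+2k}.$$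
   Context: Symmetric group: $\mathfrak{S}_n$ is the symmetric group on $\{1,\ldots,n\}$ with simple reflections $s_i=(i\;i+1)$, $1\le i\le n-1$, so $c=s_1s_2\cdots s_{n-1}$; $\ell$ is Coxeter length (number of inversions); $T$ is the set of transpositions; $\ell_T(w)$ is the least number of transpositions with product $w$; $w_\circ$ is the longest element. $\mathrm{Des}(u)=\{s_i:\ell(us_i)<\ell(u)\}$ and $\mathfrak{S}_{n,k}=\{u\in\mathfrak{S}_n:\mathrm{Des}(u)=\{s_1,\ldots,s_k\}\}$. Braid group: $\mathbf{B}_n$ is the $n$-strand braid group with Artin generators $\mathbf{s}_1,\ldots,\mathbf{s}_{n-1}$; $\mathbf{s}_i\mapsto s_i$ defines the surjection to $\mathfrak{S}_n$, whose kernel is the pure braid group, and a lift of $w$ is a preimage of $w$. If $(s_{i_1},\ldots,s_{i_k})$ is a reduced word for $w$, then $\mathbf{B}(w)=\mathbf{s}_{i_1}\cdots\mathbf{s}_{i_k}$. $\mathrm{wr}(\boldsymbol\beta)$ (writhe) is the sum of the exponents in any expression of $\boldsymbol\beta$ as a product of Artin generators and inverses. For $i<j$, the $c$-dual lift of $(i\,j)$ is $\mathbf{t}_{(ij)}=\mathbf{s}_i\cdots\mathbf{s}_{j-2}\mathbf{s}_{j-1}\mathbf{s}_{j-2}^{-1}\cdots\mathbf{s}_i^{-1}$, and $\mathbb{P}_c((i\,j))=\mathbf{t}_{(ij)}^2$. HOMFLYPT: $\mathrm{HOMFLYPT}(L;a,z)\in\mathbb{Z}[a^{\pm1},z^{\pm1}]$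 is the invariant of oriented links with value $1$ on the unknot and satisfying $a\,\mathrm{HOMFLYPT}(L_+)-a^{-1}\,\mathrm{HOMFLYPT}(L_-)=z\,\mathrm{HOMFLYPT}(L_0)$, where $L_+,L_-,L_0$ differ only inside a small disk as a positive crossing, a negative crossing, and the oriented smoothing. In a braid closure, $\mathbf{s}_i$ gives a positive crossing. $[a^m]$ denotes the coefficient of $a^m$. Inversions: the inversion sequence of a word $(r_1,\ldots,r_k)$ in simple reflections is $(t_1,\ldots,t_k)$ with $t_i=r_1\cdots r_{i-1}r_ir_{i-1}\cdots r_1$. The $c$-sorting word of $w_\circ$ is the lexicographically first subword of $\mathsf{c}\mathsf{c}\mathsf{c}\cdots$, $\mathsf{c}=(s_1,\ldots,s_{n-1})$, that is a reduced word for $w_\circ$; its inversion sequence lists every transposition once. For $u\in\mathfrak{S}_n$, $\mathrm{Inv}(u)=\{t\in T:\ell(tu)<\ell(u)\}$, and $\mathrm{inv}_c(u)$ is the restriction of that inversion sequence to $\mathrm{Inv}(u)$ (a sequence of length $\ell(u)$). $\mathrm{rev}$ reverses a sequence; juxtaposition of sequences is concatenation. $(1^k,\vec\epsilon)=(1,\ldots,1,\epsilon_1,\ldots,\epsilon_M)$ with $k$ ones. Signed subword count: for $\vec a=(a_1,\ldots,a_M)\in T^M$, $\vec\eta\in\{\pm1\}^M$, $\pi\in\mathfrak{S}_n$, and $k=\ell_T(\pi)$, $$\mathrm{sub}_T^{\vec\eta}(\vec a,\pi)=\sum_{\substack{1\le i_1<\cdots<i_k\le M\\ a_{i_1}\cdots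 a_{i_k}=\pi}}\ \prod_{j=1}^{k}\eta_{i_j}.$$ *)

(* Defs.v *)
(* Throughout, n = m.+1, points and generators are numbered from 0, and a sign
   in {1, -1} is a boolean, true standing for 1. *)
From Stdlib Require Import Relation_Operators.
From mathcomp Require Import all_boot all_order all_fingroup all_algebra.
From mathcomp Require Import finmap monalg.

Set Implicit Arguments.
Unset Strict Implicit.
Unset Printing Implicit Defensive.

Import Order.TTheory GRing.Theory Num.Theory.

Definition sgn (b : bool) : int := if b then 1%R else (-1)%R.

(** * The symmetric group *)

(* Permutations are multiplied as functions, (u v)(x) = u (v x), so that
   s_1 s_2 ... s_(n-1) is the cycle (1 2 ... n); the product of [perm] is the
   opposite one. *)
Definition permmul m (u v : 'S_m.+1) : 'S_m.+1 := (v * u)%g.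

Lemma permmulE m (u v : 'S_m.+1) x : permmul u v x = u (v x).
Proof. by rewrite /permmul permM. Qed.

Definition permprod m (s : seq 'S_m.+1) : 'S_m.+1 := foldr (@permmul m) 1%g s.

(* Meaningful for i < m. *)
Definition simple m (i : nat) : 'S_m.+1 := tperm (inord i) (inord i.+1).

Definition ell m (u : 'S_m.+1) : nat :=
  #|[set p : 'I_m.+1 * 'I_m.+1 | (p.1 < p.2) && (u p.2 < u p.1)]|.

Definition cox m : 'S_m.+1 := perm (@ordS_inj m.+1).

Lemma coxE m : cox m = permprod [seq simple m i | i <- iota 0 m].
Proof.
suff step k : k <= m -> forall x : 'I_m.+1,
    permprod [seq simple m i | i <- iota 0 k] x =
      (if x < k then x.+1 else if x == k :> nat then 0 else x) :> nat.
  apply/permP => x; apply: ord_inj; rewrite permE step //=.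
  have := ltn_ord x; rewrite ltnS leq_eqVlt => /orP[/eqP->|lt_xm].
    by rewrite modnn ltnn eqxx.
  by rewrite lt_xm modn_small.
elim: k => [_ x|k IHk lt_km x].
  by rewrite /= perm1; case: eqP => // ->.
have -> : iota 0 k.+1 = iota 0 k ++ [:: k] by rewrite -addn1 iotaD.
rewrite map_cat /permprod foldr_cat /=.
have catE (s : seq 'S_m.+1) u : foldr (@permmul m) u s = permmul (permprod s) u.
  elim: s => [|v s IHs] /=; first by rewrite /permmul mulg1.
  by rewrite IHs /permmul mulgA.
rewrite catE permmulE permmulE perm1 (IHk (ltnW lt_km)).
have vk : (inord k : 'I_m.+1) = k :> nat by rewrite inordK // ltnS ltnW.
have vk1 : (inord k.+1 : 'I_m.+1) = k.+1 :> nat by rewrite inordK.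
rewrite /simple; case: tpermP => [->|->|nk nk1].
- by rewrite vk vk1 ltnSn ltnNge leqnSn eqn_leq ltnn.
- by rewrite vk vk1 !ltnn !eqxx.
have {}nk : (x == k :> nat) = false.
  by apply/eqP => xk; apply: nk; apply: ord_inj; rewrite vk.
have {}nk1 : (x == k.+1 :> nat) = false.
  by apply/eqP => xk; apply: nk1; apply: ord_inj; rewrite vk1.
by rewrite nk nk1 ltnS (leq_eqVlt x k) nk.
Qed.

Definition wlong m : 'S_m.+1 := perm (@rev_ord_inj m.+1).

Lemma wlong_longest m (u : 'S_m.+1) : ell u <= ell (wlong m).
Proof.
apply/subset_leq_card/subsetP => -[x y]; rewrite !inE !permE /= => /andP[xy _].
by rewrite xy /= ltn_sub2l // ltnS (leq_trans xy) // -ltnS.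
Qed.

(* The transposition (i j) is represented by the pair (i, j), i < j. *)
Definition transp m : Type := {p : 'I_m.+1 * 'I_m.+1 | p.1 < p.2}.

Definition tperm_of m (t : transp m) : 'S_m.+1 := tperm (val t).1 (val t).2.

Definition transps m : {set 'S_m.+1} :=
  [set tperm p.1 p.2 | p : 'I_m.+1 * 'I_m.+1 & p.1 < p.2].

Definition ellT_le m (w : 'S_m.+1) : pred nat := fun k =>
  [exists s : k.-tuple 'S_m.+1, all [in transps m] s && (permprod s == w)].

Lemma ellT_ex m (w : 'S_m.+1) : exists k, ellT_le w k.
Proof.
have [ts -> dts] := prod_tpermP w.
suff [s sT <-] : exists2 s, all [in transps m] s &
    permprod s = (\prod_(t <- ts) tperm t.1 t.2)%g.
  exists (size s); apply/existsP; exists (in_tuple s); by rewrite sT eqxx.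
elim/last_ind: ts dts => [|ts t IHts]; first by exists [::]; rewrite ?big_nil.
rewrite all_rcons => /andP[dt /IHts[s sT sE]]; exists (tperm t.1 t.2 :: s) => /=.
  rewrite sT andbT; apply/imsetP; move: dt; rewrite /dpair /=.
  case: (ltngtP t.1 t.2) => [lt12 _|lt21 _|/val_inj->]; last by rewrite eqxx.
    by exists t; rewrite ?inE.
  by exists (t.2, t.1); rewrite ?inE //= tpermC.
by rewrite sE -cats1 big_cat big_seq1.
Qed.

Definition ellT m (w : 'S_m.+1) : nat := ex_minn (ellT_ex w).

Definition Des m (u : 'S_m.+1) : {set 'I_m} :=
  [set i : 'I_m | ell (permmul u (simple m i)) < ell u].

Definition Snk m (k : nat) : {set 'S_m.+1} :=
  [set u : 'S_m.+1 | Des u == [set i : 'I_m | i < k]].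

Definition Invs m (u : 'S_m.+1) : {set 'S_m.+1} :=
  [set t in transps m | ell (permmul t u) < ell u].

(* Words in the simple reflections are sequences of indices i < m. *)
Definition wprod m (w : seq nat) : 'S_m.+1 := permprod [seq simple m i | i <- w].

Definition reduced_word m (w : seq nat) (u : 'S_m.+1) : bool :=
  [&& all (fun i => i < m) w, size w == ell u & wprod m w == u].

(* t_i = r_1 ... r_(i-1) r_i r_(i-1) ... r_1. *)
Definition inv_seq m (w : seq nat) : seq 'S_m.+1 :=
  [seq wprod m (take i.+1 w ++ rev (take i w)) | i <- iota 0 (size w)].

(* The letter in position k of the infinite word ccc... is k %% m; a subword is
   given by its increasing sequence of positions, and subwords are compared by
   comparing these sequences lexicographically. *)
Definition subword_at m (p : seq nat) : seq nat := [seq k %% m | k <- p].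

Definition wlong_positions m (p : seq nat) : bool :=
  sorted ltn p && reduced_word (subword_at m p) (wlong m).

Definition c_sorting_word m (w : seq nat) : Prop :=
  exists p : seq nat,
    [/\ w = subword_at m p, wlong_positions m p
      & forall q, wlong_positions m q -> (p <= q :> seqlexi nat)%O].

(* [w] is meant to be the c-sorting word of the longest element. *)
Definition inv_c m (w : seq nat) (u : 'S_m.+1) : seq 'S_m.+1 :=
  [seq t <- inv_seq m w | t \in Invs u].

(* The indices i_1 < ... < i_k form a set I, and [enum I] is increasing. *)
Definition sub_T m (eta : seq bool) (a : seq 'S_m.+1) (w : 'S_m.+1) : int :=
  (\sum_(I : {set 'I_(size a)} |
         (#|I| == ellT w) && (permprod [seq nth 1%g a (val i) | i <- enum I] == w))
     \prod_(i in I) sgn (nth true eta i))%R.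

(** * The braid group *)

(* Braids are words in the Artin generators and their inverses, considered up
   to [braid_eq]; the letter (i, b) is the generator of index i with exponent
   [sgn b]. *)
Definition braid m : Type := seq ('I_m * bool).

Inductive braid_rel m : braid m -> braid m -> Prop :=
| braid_cancel i b : braid_rel [:: (i, b); (i, ~~ b)] [::]
| braid_far (i j : 'I_m) : i.+1 < j ->
    braid_rel [:: (i, true); (j, true)] [:: (j, true); (i, true)]
| braid_near (i j : 'I_m) : j = i.+1 :> nat ->
    braid_rel [:: (i, true); (j, true); (i, true)]
              [:: (j, true); (i, true); (j, true)].

Inductive braid_step m : braid m -> braid m -> Prop :=
| BraidStep u v l r : braid_rel l r -> braid_step (u ++ l ++ v) (u ++ r ++ v).

Definition braid_eq m : braid m -> braid m -> Prop :=
  clos_refl_sym_trans _ (@braid_step m).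

Definition braid_inv m (b : braid m) : braid m :=
  [seq (x.1, ~~ x.2) | x <- rev b].

Definition braid_perm m (b : braid m) : 'S_m.+1 :=
  permprod [seq simple m (val x.1) | x <- b].

Definition writhe m (b : braid m) : int := (\sum_(x <- b) sgn x.2)%R.

Definition posbraid m (w : seq 'I_m) : braid m := [seq (i, true) | i <- w].

(* B(c), for the reduced word s_1 ... s_(n-1) of c. *)
Definition braid_cox m : braid m := posbraid (enum 'I_m).

(* For points i < j: s_i ... s_(j-2) s_(j-1) s_(j-2)^-1 ... s_i^-1. *)
Definition dual_lift m (t : transp m) : braid m :=
  let: (i, j) := val t in
  let x := posbraid [seq k : 'I_m <- enum 'I_m | (i <= k) && (k.+1 < j)] in
  x ++ posbraid [seq k : 'I_m <- enum 'I_m | k.+1 == j :> nat] ++ braid_inv x.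

Definition pure_PP m (t : transp m) (e : bool) : braid m :=
  let b := dual_lift t ++ dual_lift t in if e then b else braid_inv b.

(** * Oriented link diagrams and isotopy *)

(* An oriented link diagram in general position with respect to the height
   function is cut into horizontal slices, listed from bottom to top, each
   containing one cup (minimum), cap (maximum) or crossing. The nat is the
   number of vertical strands to the left of it.
   [Cup d] : the left leg points up iff [d];
   [Cross b] : the strand going from bottom left to top right is the
   overstrand iff [b]. *)
Inductive event := Cup of bool | Cap | Cross of bool.

Definition slice : Type := (event * nat)%type.

Definition arity_in (e : event) := if e is Cup _ then 0 else 2.
Definition arity_out (e : event) := if e is Cap then 0 else 2.

(* A level is the sequence of the orientations of the strands, from left to
   right, true meaning upwards. *)
Definition run_slice (s : slice) (st : seq bool) : option (seq bool) :=
  let: (e, i) := s in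
  match e, drop i st with
  | Cup d, st' =>
      if i <= size st then Some (take i st ++ [:: d, ~~ d & st']) else None
  | Cap, [:: x, y & st'] => if x != y then Some (take i st ++ st') else None
  | Cross _, [:: x, y & st'] => Some (take i st ++ [:: y, x & st'])
  | _, _ => None
  end.

Fixpoint run (D : seq slice) (st : seq bool) : option (seq bool) :=
  if D is s :: D' then obind (run D') (run_slice s st) else Some st.

Definition link_diagram (D : seq slice) : bool := run D [::] == Some [::].

(* Planar isotopy (first five rules) and Reidemeister moves (the others). *)
Inductive local_move : seq slice -> seq slice -> Prop :=
| move_far e e' i j : i + arity_in e <= j ->
    local_move [:: (e', j); (e, i)]
               [:: (e, i); (e', j - arity_in e + arity_out e)]
| move_snake_r d i : local_move [:: (Cup d, i.+1); (Cap, i)] [::]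
| move_snake_l d i : local_move [:: (Cup d, i); (Cap, i.+1)] [::]
| move_slide_cap b i :
    local_move [:: (Cross b, i.+1); (Cap, i)]
               [:: (Cross (~~ b), i); (Cap, i.+1)]
| move_slide_cup d b i :
    local_move [:: (Cup d, i); (Cross b, i.+1)]
               [:: (Cup d, i.+1); (Cross (~~ b), i)]
| move_R1_cap b i : local_move [:: (Cross b, i); (Cap, i)] [:: (Cap, i)]
| move_R1_cup d b i :
    local_move [:: (Cup d, i); (Cross b, i)] [:: (Cup (~~ d), i)]
| move_R2 b i : local_move [:: (Cross b, i); (Cross (~~ b), i)] [::]
| move_R3 b i :
    local_move [:: (Cross b, i); (Cross b, i.+1); (Cross b, i)]
               [:: (Cross b, i.+1); (Cross b, i); (Cross b, i.+1)].

Inductive isotopy_step : seq slice -> seq slice -> Prop :=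
| IsotopyStep u v l r : local_move l r ->
    link_diagram (u ++ l ++ v) -> link_diagram (u ++ r ++ v) ->
    isotopy_step (u ++ l ++ v) (u ++ r ++ v).

Definition isotopic : seq slice -> seq slice -> Prop :=
  clos_refl_sym_trans _ isotopy_step.

(* The point (h, p) is the p-th strand at the level above the first h slices;
   a diagram is a knot when its points form one nonempty connected component. *)
Definition point (D : seq slice) (x : nat * nat) : bool :=
  (x.1 <= size D) &&
  (if run (take x.1 D) [::] is Some st then x.2 < size st else false).

Inductive adjacent (D : seq slice) : nat * nat -> nat * nat -> Prop :=
| adj_left h e i p : onth D h = Some (e, i) -> p < i ->
    adjacent D (h, p) (h.+1, p)
| adj_right h e i p : onth D h = Some (e, i) -> i + arity_in e <= p ->
    adjacent D (h, p) (h.+1, p - arity_in e + arity_out e)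
| adj_cup h d i : onth D h = Some (Cup d, i) ->
    adjacent D (h.+1, i) (h.+1, i.+1)
| adj_cap h i : onth D h = Some (Cap, i) -> adjacent D (h, i) (h, i.+1)
| adj_cross h b i : onth D h = Some (Cross b, i) ->
    adjacent D (h, i) (h.+1, i.+1)
| adj_cross' h b i : onth D h = Some (Cross b, i) ->
    adjacent D (h, i.+1) (h.+1, i).

Definition is_knot (D : seq slice) : Prop :=
  [/\ link_diagram D, exists x, point D x
    & forall x y, point D x -> point D y ->
        clos_refl_sym_trans _ (adjacent D) x y].

(* The strands of the braid are oriented upwards, so that [Cross true] is the
   positive crossing; they are closed by nested arcs on their right. *)
Definition braid_closure m (b : braid m) : seq slice :=
  [seq (Cup true, k) | k <- iota 0 m.+1]
  ++ [seq (Cross x.2, val x.1) | x <- b]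
  ++ [seq (Cap, k) | k <- rev (iota 0 m.+1)].

(** * The HOMFLYPT polynomial *)

(* The additive group Z[a^+-1, z^+-1]; the coefficient of a^i z^j in P is
   P@_(i, j). *)
Notation laurent_az := {malg int[(int * int)%type]}.

(* Z[a^+-1] *)
Notation laurent_a := {malg int[int]}.

Local Open Scope ring_scope.

(* The product a^i z^j P. *)
Definition mulaz (i j : int) (P : laurent_az) : laurent_az :=
  \sum_(k <- msupp P) << P@_k *g (i + k.1, j + k.2) >>.

(* The values of a link invariant on sequences of slices that are not link
   diagrams are irrelevant. In the skein relation the crossing is placed with
   both strands pointing upwards. *)
Record is_HOMFLYPT (H : seq slice -> laurent_az) : Prop := IsHOMFLYPT {
  HOMFLYPT_isotopic : forall D E, isotopic D E -> H D = H E;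
  HOMFLYPT_unknot : H [:: (Cup true, 0%N); (Cap, 0%N)] = << 1 *g (0, 0) >>;
  HOMFLYPT_skein : forall u v i st,
    link_diagram (u ++ v) -> run u [::] = Some st -> (i.+1 < size st)%N ->
    nth false st i -> nth false st i.+1 ->
    mulaz 1 0 (H (u ++ (Cross true, i) :: v))
      - mulaz (-1) 0 (H (u ++ (Cross false, i) :: v))
    = mulaz 0 1 (H (u ++ v)) }.

(* The evaluation at z = 0 makes sense when no negative power of z occurs. *)
Definition regular_at_z0 (P : laurent_az) : Prop :=
  forall i j : int, j < 0 -> P@_(i, j) = 0.

Definition at_z0 (P : laurent_az) : laurent_a :=
  \sum_(k <- msupp P | k.2 == 0) << P@_k *g k.1 >>.

(* Main.v *)
(* Let L be the closure of a braid b and r its number of components. Then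
   z^(r-1) HOMFLYPT(L) is regular at z = 0; let Q(b) be its value there times
   a^(wr b). The skein relation degenerates: Q is unchanged when two components
   cross each other, and changing a self-crossing of a component from negative
   to positive adds Q of the smoothing. Hence replacing a factor t^(2e) by 1
   subtracts e Q(... t^-1 ...) if multiplication by t splits a cycle, and
   nothing otherwise. Applied to rho B(c), this writes Q(beta) as a signed sum
   over the subwords t_I such that w = t_I c has |I| + 1 cycles. By the dual
   braid relations, what remains of the braid is the product of the dual lifts
   of the arcs (x, w x), x < w x, of the noncrossing permutation w. Their upper
   ends are distinct, so that Markov moves evaluate Q to
   a^(n-1-k) (a - a^-1)^k, where k = |I|.

   On the other side, u in S_(n,k) amounts to a k-subset A of {2, ..., n}, the
   order of inv_c is lexicographic, and Inv(u) consists of the (i j) with i < j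
   and j in A. The arcs of w form its only lexicographic factorization, so that
   the coefficient of t_I is a sum over the A containing their upper ends, which
   is the binomial expansion of a^(n-1-k) (a - a^-1)^k. *)
From HB Require Import structures.
From Stdlib Require Import Relation_Operators.
Require Import Defs.
From mathcomp Require Import all_boot all_order all_fingroup all_algebra.
From mathcomp Require Import finmap monalg.
From mathcomp Require Import zify boolp generic_quotient.

Set Implicit Arguments.
Unset Strict Implicit.
Unset Printing Implicit Defensive.

Import Order.TTheory GRing.Theory Num.Theory.

(** The polynomial is given only by its axioms on diagrams, so two things come before Q: Markov
    invariance of closures, and a bound on the poles in z. The bound rests on an induction on
    strands and length: by the skein relation, signs matter only modulo shorter words, and a
    positive word can be brought to contain a square or to contain its last generator at most once.
    The pure factors are removed from the last to the first because the last one stands next to the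
    lift of the noncrossing permutation w, at the start c with its lift B(c). When t splits a cycle
    of w, the dual braid relations give t lift(t w) = lift(w), so the t^-1 left by the skein
    relation is absorbed and the shape of the braid is kept. The reversal in the statement comes
    from inverses: for a list J of transpositions, t_rev(J) t_I = c^-1 exactly when t_J = t_I c = w.
    The size condition |J| + |I| = n - 1 then makes J a factorization of w of minimal length. *)

Lemma run_cat D E st : run (D ++ E) st = obind (run E) (run D st).
Proof.
elim: D st => [|s D IHD] st //=.
by case: (run_slice s st) => //= st'; rewrite IHD.
Qed.

Lemma run_cross b (p q : seq bool) x y :
  run_slice (Cross b, size p) (p ++ [:: x, y & q]) = Some (p ++ [:: y, x & q]).
Proof. by rewrite /= drop_size_cat // take_size_cat. Qed.

Lemma run_cap (p q : seq bool) x y : x != y ->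
  run_slice (Cap, size p) (p ++ [:: x, y & q]) = Some (p ++ q).
Proof. by move=> xy; rewrite /= drop_size_cat // take_size_cat // xy. Qed.

Lemma run_cup d (p q : seq bool) :
  run_slice (Cup d, size p) (p ++ q) = Some (p ++ [:: d, ~~ d & q]).
Proof.
by rewrite /= drop_size_cat // take_size_cat // size_cat leq_addr.
Qed.

(** Isotopy steps are defined between closed link diagrams only, so pieces of diagrams are compared
    inside every closing context [u], [v]. Fixing the two boundary levels makes the relation
    compatible with stacking. *)
Definition iso_between (st st' : seq bool) (D E : seq slice) : Prop :=
  [/\ run D st = Some st', run E st = Some st'
    & forall u v, run u [::] = Some st -> run v st' = Some [::] ->
        isotopic (u ++ D ++ v) (u ++ E ++ v)].

Lemma iso_refl st st' D : run D st = Some st' -> iso_between st st' D D.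
Proof. by move=> rD; split=> // u v _ _; apply: rst_refl. Qed.

Lemma iso_sym st st' D E : iso_between st st' D E -> iso_between st st' E D.
Proof. by case=> rD rE iso; split=> // u v ru rv; apply/rst_sym/iso. Qed.

Lemma iso_trans E st st' D F :
  iso_between st st' D E -> iso_between st st' E F -> iso_between st st' D F.
Proof.
case=> rD _ isoDE [_ rF isoEF]; split=> // u v ru rv.
by apply: rst_trans (isoDE u v ru rv) (isoEF u v ru rv).
Qed.

Lemma iso_cat st1 st st2 D E D' E' :
  iso_between st1 st D E -> iso_between st st2 D' E' ->
  iso_between st1 st2 (D ++ D') (E ++ E').
Proof.
case=> rD rE isoDE [rD' rE' isoDE']; split; rewrite ?run_cat ?rD ?rE //=.
move=> u v ru rv; apply: (@rst_trans _ _ _ (u ++ (E ++ D') ++ v)).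
  by rewrite -!catA; apply: isoDE => //; rewrite run_cat rD'.
by rewrite -!catA !(catA u); apply: isoDE' => //; rewrite run_cat ru.
Qed.

Lemma iso_catl st1 st st2 D D' E' : run D st1 = Some st ->
  iso_between st st2 D' E' -> iso_between st1 st2 (D ++ D') (D ++ E').
Proof. by move=> rD; apply/iso_cat/iso_refl. Qed.

Lemma iso_catr st1 st st2 D E D' : run D' st = Some st2 ->
  iso_between st1 st D E -> iso_between st1 st2 (D ++ D') (E ++ D').
Proof. by move=> rD iso; apply: (iso_cat iso (iso_refl rD)). Qed.

Lemma iso_move st st' l r : local_move l r ->
  run l st = Some st' -> run r st = Some st' -> iso_between st st' l r.
Proof.
move=> lr rl rr; split=> // u v ru rv; apply/rst_step/IsotopyStep => //.
  by rewrite /link_diagram run_cat ru /= run_cat rl /= rv.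
by rewrite /link_diagram run_cat ru /= run_cat rr /= rv.
Qed.

(** * Closures of braid words *)

(* Words in which the generators are numbered by natural numbers, so that a
   braid word on few strands is also one on more strands. *)
Definition nbraid : Type := seq (nat * bool).

Definition below (k : nat) (b : nbraid) : bool := all (fun x => x.1 < k) b.

Definition crossings (b : nbraid) : seq slice :=
  [seq (Cross x.2, x.1) | x <- b].

Definition cups (n : nat) : seq slice := [seq (Cup true, k) | k <- iota 0 n].

Definition caps (n : nat) : seq slice := [seq (Cap, k) | k <- rev (iota 0 n)].

Definition nclosure (k : nat) (b : nbraid) : seq slice :=
  cups k.+1 ++ crossings b ++ caps k.+1.

(** The level inside a closure: [n] upward braid strands, then [n] downward return strands. The
    nested arcs join strand i to strand 2n - 1 - i. *)
Definition strands (n : nat) : seq bool := nseq n true ++ nseq n false.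

Lemma cupsS n : cups n.+1 = cups n ++ [:: (Cup true, n)].
Proof. by rewrite /cups -addn1 iotaD map_cat. Qed.

Lemma capsS n : caps n.+1 = (Cap, n) :: caps n.
Proof. by rewrite /caps -addn1 iotaD rev_cat. Qed.

Lemma nseqS_r (x : bool) n : nseq n.+1 x = nseq n x ++ [:: x].
Proof. by rewrite -addn1 nseqD. Qed.

Lemma strandsS n :
  strands n.+1 = nseq n true ++ [:: true, false & nseq n false].
Proof. by rewrite /strands nseqS_r -catA. Qed.

Lemma run_cons s D st : run (s :: D) st = obind (run D) (run_slice s st).
Proof. by []. Qed.

Lemma run_cup_strands n :
  run_slice (Cup true, n) (strands n) = Some (strands n.+1).
Proof.
by rewrite strandsS -[n in (_, n)](size_nseq n true) /strands run_cup.
Qed.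

Lemma run_cap_strands n :
  run_slice (Cap, n) (strands n.+1) = Some (strands n).
Proof. by rewrite strandsS -[n in (_, n)](size_nseq n true) run_cap. Qed.

Lemma run_cups n : run (cups n) [::] = Some (strands n).
Proof.
elim: n => [|n IHn] //; rewrite cupsS run_cat IHn [obind _ _]run_cons.
by rewrite run_cup_strands.
Qed.

Lemma run_caps n : run (caps n) (strands n) = Some [::].
Proof. by elim: n => [|n IHn] //; rewrite capsS run_cons run_cap_strands. Qed.

Lemma nseq_split4 (x : bool) n i : i.+1 < n ->
  nseq n x = nseq i x ++ [:: x, x & nseq (n - i.+2) x].
Proof. by move=> lt_in; rewrite -[in LHS](subnKC lt_in) -addn2 -addnA nseqD.
  Qed.

Lemma run_cross_up b n i : i.+1 < n ->
  run_slice (Cross b, i) (strands n) = Some (strands n).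
Proof.
move=> lt_in; rewrite /strands (nseq_split4 true lt_in) -catA.
by rewrite -[i in (_, i)](size_nseq i true) run_cross.
Qed.

Lemma run_cross_down b n i : n <= i -> i.+1 < n + n ->
  run_slice (Cross b, i) (strands n) = Some (strands n).
Proof.
move=> le_ni lt_in; have lt' : (i - n).+1 < n by lia.
rewrite /strands (nseq_split4 false lt') catA.
have sz : size (nseq n true ++ nseq (i - n) false) = i.
  by rewrite size_cat !size_nseq subnKC.
by rewrite -[in (_, i)]sz run_cross.
Qed.

Lemma run_crossings k b : below k b ->
  run (crossings b) (strands k.+1) = Some (strands k.+1).
Proof.
elim: b => [|[i e] b IHb] // /andP[lt_ik /IHb IH].
by rewrite [crossings _]/= run_cons run_cross_up.
Qed.

Lemma crossings_cat a b : crossings (a ++ b) = crossings a ++ crossings b.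
Proof. exact: map_cat. Qed.

Lemma below_cat k a b : below k (a ++ b) = below k a && below k b.
Proof. exact: all_cat. Qed.

Lemma below_widen k l b : k <= l -> below k b -> below l b.
Proof. by move=> kl; apply: sub_all => x /leq_trans; apply. Qed.

Lemma isotopic_crossings k a a' :
  iso_between (strands k.+1) (strands k.+1) (crossings a) (crossings a') ->
  forall u v, below k u -> below k v ->
  isotopic (nclosure k (u ++ a ++ v)) (nclosure k (u ++ a' ++ v)).
Proof.
case=> _ _ iso u v uk vk; rewrite /nclosure !crossings_cat -!catA.
rewrite (catA _ (crossings u)) [X in isotopic _ X]catA.
apply: iso; first by rewrite run_cat run_cups /= run_crossings.
by rewrite run_cat run_crossings //= run_caps.
Qed.

Lemma iso_cancel k i e : i < k ->
  iso_between (strands k.+1) (strands k.+1)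
    (crossings [:: (i, e); (i, ~~ e)]) (crossings [::]).
Proof.
move=> lt_ik; apply: iso_move => //; first exact: move_R2.
by apply: run_crossings; rewrite /= lt_ik.
Qed.

Lemma iso_far k i j e f : i.+1 < j -> j < k ->
  iso_between (strands k.+1) (strands k.+1)
    (crossings [:: (i, e); (j, f)]) (crossings [:: (j, f); (i, e)]).
Proof.
move=> lt_ij lt_jk; have lt_ik : i < k by lia.
apply/iso_sym/iso_move; rewrite ?run_crossings //= ?lt_ik ?lt_jk //.
have := @move_far (Cross e) (Cross f) i j; rewrite /= subnK; last by lia.
by apply; lia.
Qed.

Lemma iso_near k i e : i.+1 < k ->
  iso_between (strands k.+1) (strands k.+1)
    (crossings [:: (i, e); (i.+1, e); (i, e)])
    (crossings [:: (i.+1, e); (i, e); (i.+1, e)]).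
Proof.
move=> lt_ik; have lt' : i < k by lia.
apply: iso_move; rewrite ?run_crossings //= ?lt_ik ?lt' //.
exact: move_R3.
Qed.

Lemma iso_far_cross_cap k b i : i < k ->
  iso_between (strands k.+2) (strands k.+1)
    [:: (Cross b, i); (Cap, k.+1)] [:: (Cap, k.+1); (Cross b, i)].
Proof.
move=> lt_ik; apply/iso_sym/iso_move.
- have := @move_far (Cross b) Cap i k.+1; rewrite /= subnK; last by lia.
  by apply; lia.
- by rewrite run_cons run_cap_strands [obind _ _]run_cons run_cross_up.
- by rewrite run_cons run_cross_up ?[obind _ _]run_cons ?run_cap_strands //;
    lia.
Qed.

Lemma iso_far_cap_cross k b j : k < j -> j.+1 < k.+1.*2 ->
  iso_between (strands k.+2) (strands k.+1)
    [:: (Cap, k.+1); (Cross b, j)] [:: (Cross b, j.+2); (Cap, k.+1)].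
Proof.
move=> lt_kj lt_jk; apply/iso_sym/iso_move.
- have := @move_far Cap (Cross b) k.+1 j.+2; rewrite /= subn2 addn0 /=.
  by apply; lia.
- by rewrite run_cons run_cross_down ?[obind _ _]run_cons ?run_cap_strands //;
    lia.
- by rewrite run_cons run_cap_strands [obind _ _]run_cons run_cross_down //;
    lia.
Qed.

Lemma iso_far_cup_cross k b i : i < k ->
  iso_between (strands k.+1) (strands k.+2)
    [:: (Cup true, k.+1); (Cross b, i)] [:: (Cross b, i); (Cup true, k.+1)].
Proof.
move=> lt_ik; apply: iso_move.
- have := @move_far (Cross b) (Cup true) i k.+1; rewrite /= subnK; last by lia.
  by apply; lia.
- by rewrite run_cons run_cup_strands [obind _ _]run_cons run_cross_up //; lia.
- by rewrite run_cons run_cross_up // [obind _ _]run_cons run_cup_strands.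
Qed.

Lemma iso_far_cross_cup k b j : k < j -> j.+1 < k.+1.*2 ->
  iso_between (strands k.+1) (strands k.+2)
    [:: (Cross b, j); (Cup true, k.+1)] [:: (Cup true, k.+1); (Cross b, j.+2)].
Proof.
move=> lt_kj lt_jk; apply: iso_move.
- have := @move_far (Cup true) (Cross b) k.+1 j; rewrite /= subn0 addn2.
  by apply; lia.
- by rewrite run_cons run_cross_down ?[obind _ _]run_cons ?run_cup_strands //;
    lia.
- by rewrite run_cons run_cup_strands [obind _ _]run_cons run_cross_down //;
    lia.
Qed.

(** * Sliding crossings along the closing arcs *)

Definition shift (i : nat) (D : seq slice) : seq slice :=
  [seq (s.1, s.2 + i) | s <- D].

Lemma run_slice_frame s (p q x y : seq bool) : run_slice s x = Some y ->
  run_slice (s.1, s.2 + size p) (p ++ x ++ q) = Some (p ++ y ++ q).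
Proof.
case: s => [e i] rs; have le_ix : i <= size x.
  move: rs; case: e => [d||b] /=; first by case: leqP.
  - by case: leqP => // /ltnW lt_xi; rewrite drop_oversize.
  - by case: leqP => // /ltnW lt_xi; rewrite drop_oversize.
have dE : drop (i + size p) (p ++ x ++ q) = drop i x ++ q.
  rewrite -drop_drop drop_size_cat // drop_cat; case: ltnP => // le_xi.
  have/eqP -> : i == size x by rewrite eqn_leq le_ix.
  by rewrite subnn drop0 drop_size.
have tE : take (i + size p) (p ++ x ++ q) = p ++ take i x.
  by rewrite addnC take_cat ltnNge leq_addr addKn takel_cat.
case: e rs => [d||b] /=; rewrite dE tE.
- rewrite le_ix !size_cat addnC leq_add2l (leq_trans le_ix (leq_addr _ _)).
  by case=> <-; rewrite -!catA.
- by case: (drop i x) => [|a [|b z]] //=; case: (a != b) => // -[<-];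
    rewrite -!catA.
- by case: (drop i x) => [|a [|c z]] //= -[<-]; rewrite -!catA.
Qed.

Lemma run_frame D (p q x y : seq bool) : run D x = Some y ->
  run (shift (size p) D) (p ++ x ++ q) = Some (p ++ y ++ q).
Proof.
elim: D x => [|s D IHD] x; first by case=> ->.
rewrite run_cons; case rs: (run_slice s x) => [x'|] // rD.
rewrite [shift _ _]map_cons run_cons (run_slice_frame p q rs).
exact: (IHD x').
Qed.

Lemma run_frame_nseq D i x y : run D x = Some y -> forall a q,
  run (shift i D) (nseq i a ++ x ++ q) = Some (nseq i a ++ y ++ q).
Proof.
by move=> rD a q; rewrite -[i in shift i](size_nseq i a); apply: run_frame.
Qed.

(** The [i] strands on the left and those of [q] on the right are spectators, so admissibility of a
    move is decided by computation on the few concrete strands of [x]. *)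
Lemma iso_frame D E i x y a q : local_move (shift i D) (shift i E) ->
  run D x = Some y -> run E x = Some y ->
  iso_between (nseq i a ++ x ++ q) (nseq i a ++ y ++ q) (shift i D) (shift i E).
Proof. by move=> mv rD rE; apply: iso_move mv _ _; apply: run_frame_nseq. Qed.

(** The crossing passes the inner cap and arrives between two caps lying side by side; these
    exchange heights, and it then passes the other one. Each passage reverses the flag [b], so two
    passages restore it. *)
Lemma iso_slide_caps_inner b i :
  iso_between (strands i.+2) (strands i)
    [:: (Cross b, i); (Cap, i.+1); (Cap, i)]
    [:: (Cross b, i.+2); (Cap, i.+1); (Cap, i)].
Proof.
have -> : strands i.+2 =
    nseq i true ++ [:: true; true; false; false] ++ nseq i false.
  by rewrite /strands (@nseq_split4 true i.+2 i) // subnn -catA.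
rewrite -[strands i]/(nseq i true ++ [::] ++ nseq i false).
apply: (@iso_trans (shift i [:: (Cross (~~ b), 1); (Cap, 0); (Cap, 0)])).
  apply: (@iso_cat _ (nseq i true ++ [:: true; false] ++ nseq i false) _
    (shift i [:: (Cross b, 0); (Cap, 1)]) (shift i [:: (Cross (~~ b), 1);
      (Cap, 0)])
    (shift i [:: (Cap, 0)])); last first.
    exact/iso_refl/run_frame_nseq.
  apply: iso_sym; apply: iso_frame => //.
  by rewrite -{2}[b]negbK; apply: move_slide_cap.
apply: (@iso_trans (shift i [:: (Cross (~~ b), 1); (Cap, 2); (Cap, 0)])).
  apply: (@iso_catl _ (nseq i true ++ [:: true; false; true;
    false] ++ nseq i false)
    _ (shift i [:: (Cross (~~ b), 1)]) (shift i [:: (Cap, 0); (Cap, 0)])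
    (shift i [:: (Cap, 2); (Cap, 0)])); first exact: run_frame_nseq.
  apply: iso_sym; apply: iso_frame => //.
  have := @move_far Cap Cap i i.+2; rewrite /= subn2 addn0 addn2.
  by apply.
apply: (@iso_cat _ (nseq i true ++ [:: true; false] ++ nseq i false) _
    (shift i [:: (Cross (~~ b), 1); (Cap, 2)]) (shift i [:: (Cross b, 2);
      (Cap, 1)])
    (shift i [:: (Cap, 0)])); last first.
  exact/iso_refl/run_frame_nseq.
apply: iso_sym; apply: iso_frame => //.
exact: (move_slide_cap b i.+1).
Qed.

Lemma iso_slide_cups_inner b i :
  iso_between (strands i) (strands i.+2)
    [:: (Cup true, i); (Cup true, i.+1); (Cross b, i)]
    [:: (Cup true, i); (Cup true, i.+1); (Cross b, i.+2)].
Proof.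
have -> : strands i.+2 =
    nseq i true ++ [:: true; true; false; false] ++ nseq i false.
  by rewrite /strands (@nseq_split4 true i.+2 i) // subnn -catA.
rewrite -[strands i]/(nseq i true ++ [::] ++ nseq i false).
apply: (@iso_trans
    (shift i [:: (Cup true, 0); (Cup true, 0); (Cross (~~ b), 1)])).
  apply: (@iso_catl _ (nseq i true ++ [:: true; false] ++ nseq i false) _
    (shift i [:: (Cup true, 0)]) (shift i [:: (Cup true, 1); (Cross b, 0)])
    (shift i [:: (Cup true, 0); (Cross (~~ b), 1)])).
    exact: run_frame_nseq.
  apply: iso_sym; apply: iso_frame => //.
  by rewrite -{2}[b]negbK; apply: move_slide_cup.
apply: (@iso_trans
    (shift i [:: (Cup true, 0); (Cup true, 2); (Cross (~~ b), 1)])).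
  apply: (@iso_cat _ (nseq i true ++ [:: true; false; true;
    false] ++ nseq i false)
    _ (shift i [:: (Cup true, 0); (Cup true, 0)])
    (shift i [:: (Cup true, 0); (Cup true, 2)]) (shift i [:: (Cross (~~ b),
      1)]));
    last exact/iso_refl/run_frame_nseq.
  apply: iso_frame => //.
  have := @move_far (Cup true) (Cup true) i i; rewrite /= subn0 addn0 addn2.
  by apply.
apply: (@iso_catl _ (nseq i true ++ [:: true; false] ++ nseq i false) _
    (shift i [:: (Cup true, 0)]) (shift i [:: (Cup true, 2); (Cross (~~ b), 1)])
    (shift i [:: (Cup true, 1); (Cross b, 2)])).
  exact: run_frame_nseq.
apply: iso_sym; apply: iso_frame => //.
exact: (move_slide_cup true b i.+1).
Qed.

(* A crossing of the i-th and (i+1)-st upward strands slides along the closing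
   arcs to the downward strands that these are joined to. *)
Lemma iso_slide_caps k b i : i < k ->
  iso_between (strands k.+1) [::]
    ((Cross b, i) :: caps k.+1) ((Cross b, k.*2 - i) :: caps k.+1).
Proof.
elim: k => // k IHk; rewrite ltnS leq_eqVlt => /predU1P[->|lt_ik].
  have -> : k.+1.*2 - k = k.+2 by lia.
  rewrite !capsS; apply: (iso_catr (run_caps k) (iso_slide_caps_inner b k)).
rewrite capsS.
apply: iso_trans (iso_catr (run_caps _) (iso_far_cross_cap b lt_ik)) _.
have rc : run [:: (Cap, k.+1)] (strands k.+2) = Some (strands k.+1).
  by rewrite run_cons run_cap_strands.
apply: iso_trans (iso_catl rc (IHk lt_ik)) _.
have -> : k.+1.*2 - i = (k.*2 - i).+2 by lia.
by apply: (iso_catr (run_caps _) (iso_far_cap_cross b _ _)); lia.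
Qed.

Lemma iso_slide_cups k b i : i < k ->
  iso_between [::] (strands k.+1)
    (cups k.+1 ++ [:: (Cross b, i)]) (cups k.+1 ++ [:: (Cross b, k.*2 - i)]).
Proof.
elim: k => // k IHk; rewrite ltnS leq_eqVlt => /predU1P[->|lt_ik].
  have -> : k.+1.*2 - k = k.+2 by lia.
  rewrite !cupsS -!catA.
  apply: (iso_catl (run_cups k) (iso_slide_cups_inner b k)).
rewrite cupsS -!catA.
apply: iso_trans (iso_catl (run_cups _) (iso_far_cup_cross b lt_ik)) _.
have rc : run [:: (Cup true, k.+1)] (strands k.+1) = Some (strands k.+2).
  by rewrite run_cons run_cup_strands.
have := iso_catr rc (IHk lt_ik); rewrite -!catA => /iso_trans; apply.
apply: (iso_catl (run_cups _)).
have -> : k.+1.*2 - i = (k.*2 - i).+2 by lia.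
by apply: iso_far_cross_cup; lia.
Qed.

Lemma iso_far_down k a b j : below k a -> k < j -> j < k.*2.+1 ->
  iso_between (strands k.+1) (strands k.+1)
    (crossings a ++ [:: (Cross b, j)]) ((Cross b, j) :: crossings a).
Proof.
move=> ak lt_kj lt_jk; have rj : run [:: (Cross b, j)] (strands k.+1) =
    Some (strands k.+1) by rewrite run_cons run_cross_down //; lia.
elim: a ak => [|[i e] a IHa] //=; first by move=> _; apply: iso_refl.
case/andP=> lt_ik ak.
have ri : run [:: (Cross e, i)] (strands k.+1) = Some (strands k.+1).
  by rewrite run_cons run_cross_up //; lia.
apply: iso_trans (iso_catl ri (IHa ak)) _.
suff mv : iso_between (strands k.+1) (strands k.+1)
    [:: (Cross e, i); (Cross b, j)] [:: (Cross b, j); (Cross e, i)].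
  exact: (iso_catr (run_crossings ak) mv).
apply/iso_sym/iso_move.
- have := @move_far (Cross e) (Cross b) i j; rewrite /= subnK; last by lia.
  by apply; lia.
- by rewrite -cat1s run_cat rj.
- by rewrite -cat1s run_cat ri.
Qed.

(** The crossing leaves the top of the braid along the caps, runs down the return strands past all
    of [b], and comes back along the cups to the bottom. *)
Lemma isotopic_rot1 k x b : x.1 < k -> below k b ->
  isotopic (nclosure k (b ++ [:: x])) (nclosure k (x :: b)).
Proof.
case: x => i e /= lt_ik bk.
suff: iso_between [::] [::]
    (nclosure k (b ++ [:: (i, e)])) (nclosure k ((i, e) :: b)).
  by case=> _ _ /(_ [::] [::] erefl erefl); rewrite !cats0.
have lt1 : k < k.*2 - i by lia.
have lt2 : k.*2 - i < k.*2.+1 by lia.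
have r : run (crossings b ++ caps k.+1) (strands k.+1) = Some [::].
  by rewrite run_cat run_crossings // [obind _ _]run_caps.
have iso1 := iso_catl (run_cups k.+1)
  (iso_catl (run_crossings bk) (iso_slide_caps e lt_ik)).
have := iso_catl (run_cups k.+1)
  (iso_catr (run_caps k.+1) (iso_far_down e bk lt1 lt2)).
rewrite -(catA (crossings b)) => iso2.
have := iso_catr r (iso_sym (iso_slide_cups e lt_ik)).
rewrite -!(catA (cups _)) => iso3.
rewrite /nclosure crossings_cat -(catA (crossings b)).
exact: (iso_trans iso1 (iso_trans iso2 iso3)).
Qed.

Lemma isotopic_rot k a b : below k a -> below k b ->
  isotopic (nclosure k (a ++ b)) (nclosure k (b ++ a)).
Proof.
elim: b a => [|x b IHb] a ak /=; first by rewrite cats0 => _; apply: rst_refl.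
case/andP=> xk bk; rewrite -cat1s catA.
apply: rst_trans (IHb (a ++ [:: x]) _ bk) _.
  by rewrite below_cat ak /= xk.
by rewrite catA; apply: isotopic_rot1; rewrite // below_cat bk.
Qed.

(** Sliding the crossing across the cap turns the extra loop into a kink at a cup, which the first
    Reidemeister move removes; what is left is a zigzag. *)
Lemma iso_stabilize_arc k e :
  iso_between (strands k.+1) (strands k.+1)
    [:: (Cup true, k.+1); (Cross e, k); (Cap, k.+1)] [::].
Proof.
rewrite strandsS -[[:: true, _ & _]]/([:: true] ++ (false :: nseq k false)).
apply: (@iso_trans (shift k [:: (Cup true, 1); (Cross (~~ e), 1); (Cap, 0)])).
  apply: (@iso_catl _ (nseq k true ++ [:: true; true;
    false] ++ (false :: nseq k false))
    _ (shift k [:: (Cup true, 1)]) (shift k [:: (Cross e, 0); (Cap, 1)])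
    (shift k [:: (Cross (~~ e), 1); (Cap, 0)])); first exact: run_frame_nseq.
  apply: iso_sym; apply: iso_frame => //.
  by rewrite -{2}[e]negbK; apply: move_slide_cap.
apply: (@iso_trans (shift k [:: (Cup false, 1); (Cap, 0)])).
  apply: (@iso_cat _ (nseq k true ++ [:: true; false;
    true] ++ (false :: nseq k false))
    _ (shift k [:: (Cup true, 1); (Cross (~~ e), 1)]) (shift k [:: (Cup false,
      1)])
    (shift k [:: (Cap, 0)])); last exact/iso_refl/run_frame_nseq.
  by apply: iso_frame => //; apply: (move_R1_cup true (~~ e) k.+1).
apply: (@iso_frame [:: (Cup false, 1); (Cap, 0)] [::]) => //.
exact: (move_snake_r false k).
Qed.

Lemma iso_cup_up k b : below k b ->
  iso_between (strands k.+1) (strands k.+2)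
    ((Cup true, k.+1) :: crossings b) (crossings b ++ [:: (Cup true, k.+1)]).
Proof.
have rc : run [:: (Cup true, k.+1)] (strands k.+1) = Some (strands k.+2).
  by rewrite run_cons run_cup_strands.
elim: b => [|[i e] b IHb] /=; first by move=> _; apply: iso_refl.
case/andP=> lt_ik bk.
have := iso_catr (run_crossings (below_widen (leqnSn k) bk))
  (iso_far_cup_cross e lt_ik) => /iso_trans; apply.
apply: (@iso_catl _ _ _ [:: (Cross e, i)] _ _ _ (IHb bk)).
by rewrite run_cons run_cross_up.
Qed.

Lemma isotopic_stabilize k b e : below k b ->
  isotopic (nclosure k.+1 (b ++ [:: (k, e)])) (nclosure k b).
Proof.
move=> bk.
suff: iso_between [::] [::] (nclosure k.+1 (b ++ [:: (k, e)])) (nclosure k b).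
  by case=> _ _ /(_ [::] [::] erefl erefl); rewrite !cats0.
rewrite /nclosure crossings_cat cupsS capsS -!catA;
  apply: (iso_catl (run_cups _)).
pose D := [:: (Cross e, k), (Cap, k.+1) & caps k.+1].
have rD : run D (strands k.+2) = Some [::].
  by rewrite run_cons run_cross_up // [obind _ _]run_cons run_cap_strands
             [obind _ _]run_caps.
have := iso_catr rD (iso_cup_up bk); rewrite -(catA (crossings b)).
move=> /iso_trans; apply.
exact: (iso_catl (run_crossings bk)
  (iso_catr (run_caps k.+1) (iso_stabilize_arc k e))).
Qed.

(** * Cycles of permutations *)

Definition cyc (T : finType) (w : {perm T}) : nat := #|porbits w|.

Lemma permJE (T : finType) (s t : {perm T}) i x :
  ((s ^ t) ^+ i)%g (t x) = t ((s ^+ i)%g x).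
Proof. by rewrite -conjXg permJ. Qed.

Lemma cycJ (T : finType) (s t : {perm T}) : cyc (s ^ t)%g = cyc s.
Proof.
have porbitJ x : porbit (s ^ t)%g (t x) = t @: porbit s x.
  apply/setP => y; apply/porbitP/imsetP => [[i ->]|[_ /porbitP[i ->] ->]].
    by exists ((s ^+ i)%g x); rewrite ?permJE ?mem_porbit.
  by exists i; rewrite permJE.
rewrite /cyc -(card_imset (porbits s) (imset_inj (@perm_inj _ t))).
congr #|pred_of_set _|; apply/setP => A; apply/imsetP/imsetP.
  case=> x _ ->; exists (porbit s ((t^-1)%g x)); first by apply/imsetP;
    exists ((t^-1)%g x).
  by rewrite -porbitJ permKV.
by case=> _ /imsetP[x _ ->] ->; exists (t x); rewrite // porbitJ.
Qed.

Section Cycles.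
Variable m : nat.
Implicit Types u v w : 'S_m.+1.

Lemma permmulA u v w : permmul u (permmul v w) = permmul (permmul u v) w.
Proof. by rewrite /permmul mulgA. Qed.

Lemma permmul1 u : permmul u 1%g = u. Proof. exact: mul1g. Qed.
Lemma permmul1l u : permmul 1%g u = u. Proof. exact: mulg1. Qed.

Lemma permprod_cat (s t : seq 'S_m.+1) :
  permprod (s ++ t) = permmul (permprod s) (permprod t).
Proof. by elim: s => [|u s IHs] /=; rewrite ?permmul1l // IHs permmulA. Qed.

Lemma cyc_permmulC u v : cyc (permmul u v) = cyc (permmul v u).
Proof. by rewrite /permmul -(cycJ (v * u)%g v) conjgE mulgA mulKg. Qed.

Lemma cyc_tperm_split w x y : x != y -> x \in porbit w y ->
  cyc (permmul w (tperm x y)) = (cyc w).+1.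
Proof.
move=> xy xwy; have := porbits_mul_tperm w x y.
by rewrite /= xy xwy /= addn0 addn1.
Qed.

Lemma cyc_tperm_merge w x y : x \notin porbit w y ->
  (cyc (permmul w (tperm x y))).+1 = cyc w.
Proof.
move=> xwy; have xy : x != y by apply: contraNneq xwy => ->; apply: porbit_id.
have /= := porbits_mul_tperm w x y.
by rewrite xy (negbTE xwy) -/(cyc _) -/(cyc w) -[(tperm _ _ * _)%g]/(permmul w
  _) /= => ?; lia.
Qed.

Lemma cyc_tperml w x y :
  cyc (permmul (tperm x y) w) = cyc (permmul w (tperm x y)).
Proof. exact: cyc_permmulC. Qed.

Lemma cyc_tperm_le w x y : cyc w <= (cyc (permmul (tperm x y) w)).+1.
Proof.
rewrite cyc_tperml; have := porbits_mul_tperm w x y.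
rewrite /= -/(cyc _) -/(cyc w) -[(tperm _ _ * _)%g]/(permmul w _).
have [->|xy] := eqVneq x y; first by rewrite porbit_id; lia.
by case: (x \in _); lia.
Qed.

Lemma cyc_tperm_ge w x y : cyc (permmul (tperm x y) w) <= (cyc w).+1.
Proof.
have := cyc_tperm_le (permmul (tperm x y) w) x y.
by rewrite /permmul -mulgA tperm2 mulg1.
Qed.

(** Cyclic rotation brings the inserted transposition to an end of the product, where it splits or
    merges cycles. *)
Lemma cyc_insert u v x y : x != y ->
  cyc (permmul u (permmul (tperm x y) v)) = (cyc (permmul u v)).+1 \/
  cyc (permmul u v) = (cyc (permmul u (permmul (tperm x y) v))).+1.
Proof.
move=> xy; rewrite cyc_permmulC -permmulA cyc_tperml (cyc_permmulC u v).
case: (boolP (x \in porbit (permmul v u) y)) => [/(cyc_tperm_split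
  xy)|/cyc_tperm_merge];
  by [left|right].
Qed.

Lemma cyc1 : cyc (1%g : 'S_m.+1) = m.+1.
Proof.
have p1 (x : 'I_m.+1) : porbit (1%g : 'S_m.+1) x = [set x].
  apply/setP => y; rewrite inE; apply/porbitP/eqP => [[i ->]|->].
    by rewrite expg1n perm1.
  by exists 0; rewrite perm1.
rewrite /cyc /porbits (eq_imset _ p1) card_imset ?card_ord //.
exact: set1_inj.
Qed.

Lemma cyc_le w : cyc w <= m.+1.
Proof. by rewrite -[X in _ <= X](card_ord m.+1) /cyc leq_imset_card. Qed.

Lemma simple_neq i : i < m -> (inord i : 'I_m.+1) != inord i.+1.
Proof.
move=> lt_im; apply/eqP => /(congr1 val) /=.
by rewrite !inordK //; [lia | lia].
Qed.

Definition nperm (b : nbraid) : 'S_m.+1 := permprod [seq simple m x.1 | x <- b].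

Lemma nperm_cat a b : nperm (a ++ b) = permmul (nperm a) (nperm b).
Proof. by rewrite /nperm map_cat permprod_cat. Qed.

Lemma nperm_cons x b : nperm (x :: b) = permmul (simple m x.1) (nperm b).
Proof. by []. Qed.

Lemma nperm_cyc_insert a b i e : i < m ->
  cyc (nperm (a ++ (i, e) :: b)) = (cyc (nperm (a ++ b))).+1 \/
  cyc (nperm (a ++ b)) = (cyc (nperm (a ++ (i, e) :: b))).+1.
Proof.
by move=> /simple_neq; rewrite !nperm_cat nperm_cons; apply: cyc_insert.
Qed.

Lemma nperm_stab k b : below k b -> k < m ->
  forall x : 'I_m.+1, k < x -> nperm b x = x.
Proof.
move=> bk lt_km x lt_kx; elim: b bk => [|[i e] b IHb] /=;
  first by rewrite perm1.
case/andP=> lt_ik /IHb; rewrite nperm_cons permmulE => ->.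
by rewrite tpermD //; apply/eqP => /(congr1 val) /=; rewrite inordK; lia.
Qed.

(** The point k + 1 is fixed by [b], so the new generator joins it to the cycle of k. *)
Lemma cyc_stabilize k b e : below k b -> k < m ->
  (cyc (nperm (b ++ [:: (k, e)]))).+1 = cyc (nperm b).
Proof.
move=> bk lt_km; rewrite nperm_cat nperm_cons permmul1.
apply: cyc_tperm_merge; apply/negP => /porbitP[i].
have lt1 : k < (inord k.+1 : 'I_m.+1) by rewrite inordK.
have fixE : (nperm b ^+ i)%g (inord k.+1) = inord k.+1.
  elim: i => [|i IHi]; first by rewrite perm1.
  by rewrite expgSr permM IHi (nperm_stab bk).
by rewrite fixE => /(congr1 val); rewrite /= !inordK; lia.
Qed.

End Cycles.

Local Open Scope ring_scope.

(** * Coefficients and the skein relation on braid closures *)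

Lemma sum_msupp (K : choiceType) (G : zmodType) (P : {malg G[K]}) k0 :
  \sum_(k <- msupp P) P@_k *+ (k == k0) = P@_k0.
Proof.
rewrite [in RHS](monalgE P) raddf_sum /=.
by apply: eq_bigr => k _; rewrite mcoeffU.
Qed.

Lemma mcoeff_mulaz i j (P : laurent_az) x y :
  (mulaz i j P)@_(x, y) = P@_(x - i, y - j).
Proof.
rewrite raddf_sum -sum_msupp /=; apply: eq_bigr => -[k l] _; rewrite mcoeffU.
rewrite !xpair_eqE /= [k == _]eq_sym [l == _]eq_sym !subr_eq.
by rewrite [x == _]eq_sym [y == _]eq_sym (addrC k) (addrC l).
Qed.

Lemma mcoeff_at_z0 (P : laurent_az) x : (at_z0 P)@_x = P@_(x, 0).
Proof.
rewrite raddf_sum -sum_msupp big_mkcond /=; apply: eq_bigr => -[k l] _ /=.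
by rewrite xpair_eqE andbC; case: (l == 0); rewrite ?mcoeffU ?mulr0n.
Qed.

Definition nwrithe (b : nbraid) : int := \sum_(x <- b) sgn x.2.

Lemma nwrithe_cat a b : nwrithe (a ++ b) = nwrithe a + nwrithe b.
Proof. exact: big_cat. Qed.

Lemma nwrithe_cons x b : nwrithe (x :: b) = sgn x.2 + nwrithe b.
Proof. exact: big_cons. Qed.

Section Homflypt.
Variables (H : seq slice -> laurent_az) (homH : is_HOMFLYPT H).

Definition homfly (k : nat) (b : nbraid) : laurent_az := H (nclosure k b).

Lemma homfly_rot k a b : below k a -> below k b -> homfly k (a ++ b) =
  homfly k (b ++ a).
Proof. by move=> ak bk; apply/(HOMFLYPT_isotopic homH)/isotopic_rot. Qed.

Lemma homfly_stabilize k b e : below k b -> homfly k.+1 (b ++ [:: (k, e)]) =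
  homfly k b.
Proof. by move=> bk; apply/(HOMFLYPT_isotopic homH)/isotopic_stabilize. Qed.

Lemma homfly_skein k a b i : below k a -> below k b -> (i < k)%N -> forall x y,
  (homfly k (a ++ (i, true) :: b))@_(x - 1, y)
    - (homfly k (a ++ (i, false) :: b))@_(x + 1, y) =
        (homfly k (a ++ b))@_(x, y - 1).
Proof.
move=> ak bk lt_ik x y.
pose u := cups k.+1 ++ crossings a; pose v := crossings b ++ caps k.+1.
have ru : run u [::] = Some (strands k.+1) by rewrite run_cat run_cups /=
  run_crossings.
have rv : run v (strands k.+1) = Some [::] by rewrite run_cat run_crossings //=
  run_caps.
have homflyE c : homfly k (a ++ c ++ b) = H (u ++ crossings c ++ v).
  by rewrite /homfly /nclosure !crossings_cat -!catA.
have uv : link_diagram (u ++ v) by rewrite /link_diagram run_cat ru [obind _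
  _]rv.
have := HOMFLYPT_skein homH (i := i) uv ru.
rewrite !nth_cat !size_cat !size_nseq !nth_nseq !ifT //; try by lia.
move=> /(_ _ isT isT) sk; have {}sk := sk ltac:(lia).
move: sk; rewrite -[_ :: v]/(crossings [:: (i, true)] ++ v) -homflyE.
rewrite -[_ :: v]/(crossings [:: (i, false)] ++ v) -homflyE.
rewrite -[u ++ v]/(u ++ crossings [::] ++ v) -homflyE => /(congr1 (mcoeff (x,
  y))).
by rewrite mcoeffB !mcoeff_mulaz opprK !subr0.
Qed.

Lemma homfly_iso k c d : iso_between (strands k.+1) (strands k.+1) (crossings
  c) (crossings d) ->
  forall a b, below k a -> below k b -> homfly k (a ++ c ++ b) =
    homfly k (a ++ d ++ b).
Proof.
move=> iso a b ak bk.
by apply/(HOMFLYPT_isotopic homH)/isotopic_crossings.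
Qed.

Lemma homfly_unknot x y : (homfly 0 [::])@_(x, y) = ((x == 0) && (y == 0))%:R.
Proof.
have -> : homfly 0 [::] = << 1 *g (0, 0) >> := HOMFLYPT_unknot homH.
by rewrite mcoeffU xpair_eqE ![0 == _]eq_sym.
Qed.

End Homflypt.

Local Close Scope ring_scope.

(** * Rewriting of words in the generators *)

(** These are the relations of the positive braid monoid. Squares are not cancelled: in a closure
    they are left to the skein relation. *)
Inductive word_step : seq nat -> seq nat -> Prop :=
| word_far u v i j : i.+1 < j ->
    word_step (u ++ [:: i; j] ++ v) (u ++ [:: j; i] ++ v)
| word_near u v i :
    word_step (u ++ [:: i; i.+1; i] ++ v) (u ++ [:: i.+1; i; i.+1] ++ v).

Definition word_eq : seq nat -> seq nat -> Prop :=
  clos_refl_sym_trans _ word_step.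

Lemma word_eq_ctx a b w w' :
  word_eq w w' -> word_eq (a ++ w ++ b) (a ++ w' ++ b).
Proof.
elim=> {w w'} [w w' [u v i j ij|u v i]|w|w w' _|w w' w'' _ IH1 _ IH2].
- apply: rst_step; rewrite -!catA !(catA a u).
  exact: (word_far (a ++ u) (v ++ b) ij).
- apply: rst_step; rewrite -!catA !(catA a u).
  exact: (word_near (a ++ u) (v ++ b) i).
- exact: rst_refl.
- exact: rst_sym.
- exact: rst_trans IH1 IH2.
Qed.

Lemma word_eq_all k w w' : word_eq w w' ->
  all (fun i => i <= k) w = all (fun i => i <= k) w'.
Proof.
elim=> {w w'} [w w' [u v i j ij|u v i]|w|w w' _|w w' w'' _ -> _ ->] //.
- by rewrite !all_cat /=; case: (i <= k); case: (j <= k).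
- by rewrite !all_cat /=; case: (i < k); case: (i <= k).
Qed.

Lemma word_eq_size w w' : word_eq w w' -> size w = size w'.
Proof.
by elim=> {w w'} [w w' [u v i j ij|u v i]|w|w w' _|w w' w'' _ -> _ ->] //;
  rewrite !size_cat.
Qed.

Lemma word_eq_slide k p a b : all (fun i => i.+1 < k) p ->
  word_eq (a ++ k :: p ++ b) (a ++ p ++ k :: b).
Proof.
elim: p a => [|i p IHp] a /=; first by move=> _; apply: rst_refl.
case/andP=> lt_ik /(IHp (a ++ [:: i])); rewrite -!catA; apply: rst_trans.
exact/rst_sym/rst_step/(word_far a (p ++ b) lt_ik).
Qed.

Lemma split_first (T : eqType) (x : T) s : x \in s ->
  exists a b, s = a ++ x :: b /\ x \notin a.
Proof.
elim: s => // y s IHs; rewrite inE; case: eqVneq =>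
  [<- _|xy /= /IHs[a [b [-> xa]]]].
  by exists [::], s.
by exists (y :: a), b; rewrite /= inE negb_or xy.
Qed.

Lemma split_count2 (T : eqType) (x : T) s : 1 < count_mem x s ->
  exists a b c, s = a ++ x :: b ++ x :: c /\ x \notin b.
Proof.
move=> cs; have /split_first[a [s' [sE xa]]] : x \in s.
  by rewrite -has_pred1 has_count; lia.
have /split_first[b [c [s'E xb]]] : x \in s'.
  move: cs; rewrite sE count_cat /= eqxx (count_memPn xa) -has_pred1 has_count.
  by lia.
by exists a, b, c; rewrite sE s'E.
Qed.

(* Two consecutive occurrences of k.+1 may be assumed to enclose at most one k,
   by induction: with none they become adjacent, and with one the near relation
   replaces them by a single occurrence. *)
Lemma word_reduce k w : all (fun i => i <= k) w ->
  (exists u i v, word_eq w (u ++ [:: i; i] ++ v)) \/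
  (exists2 w', word_eq w w' & count_mem k w' <= 1).
Proof.
elim: k w => [|k IHk] w.
  case: (leqP (count_mem 0 w) 1) => [? _|].
    by right; exists w; [exact: rst_refl | ].
  case/split_count2 => a [b [d [-> nb]]]; rewrite !all_cat /= !all_cat /=.
  case/and3P=> _ b0 _; left; exists a, 0, d.
  case: b nb b0 => [|i b] /=; first by move=> *; apply: rst_refl.
  by rewrite inE leqn0 => + /andP[/eqP i0 _]; rewrite i0.
have [c] := ubnP (count_mem k.+1 w); elim: c w => // c IHc w; rewrite ltnS.
case: (leqP (count_mem k.+1 w) 1) => [? _ _|].
  by right; exists w; [exact: rst_refl | ].
case/split_count2 => a [b [d [-> nb]]] le_c ak1.
have bk : all (fun i => i <= k.+1) b.
  by move: ak1; rewrite !all_cat /= !all_cat /= => /and5P[].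
have bk' : all (fun i => i <= k) b.
  apply/allP => i ib; move/allP: bk => /(_ i ib);
    rewrite leq_eqVlt => /predU1P[ik|//].
  by rewrite ik (negPf nb) in ib.
have ctx b' : word_eq b b' ->
    word_eq (a ++ k.+1 :: b ++ k.+1 :: d) (a ++ k.+1 :: b' ++ k.+1 :: d).
  move=> /(word_eq_ctx (a ++ [:: k.+1]) (k.+1 :: d)); by rewrite -!catA.
have [[u [i [v /ctx bE]]]|[b' bb' le1]] := IHk b bk'.
  left; exists (a ++ k.+1 :: u), i, (v ++ k.+1 :: d); apply: rst_trans bE _.
  by rewrite -!catA; apply: rst_refl.
have b'k : all (fun i => i <= k) b' by rewrite -(word_eq_all _ bb').
have small p : k \notin p -> {subset p <= b'} -> all (fun i => i.+1 < k.+1) p.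
  move=> kp sub; apply/allP => i ip; move/allP: b'k => /(_ i (sub i ip)).
  by rewrite leq_eqVlt => /predU1P[ik|//]; rewrite ik (negPf kp) in ip.
have [kb'|/negPn/split_first[p [q [b'E kp]]]] := boolP (k \notin b').
  left; exists (a ++ b'), k.+1, d; apply: rst_trans (ctx _ bb') _.
  by rewrite -catA; apply/word_eq_slide/small.
have kq : k \notin q.
  apply/count_memPn; move: le1; rewrite b'E count_cat /= eqxx (count_memPn kp).
  by lia.
have eqw : word_eq (a ++ k.+1 :: b ++ k.+1 :: d)
    (a ++ p ++ [:: k; k.+1; k] ++ q ++ d).
  apply: rst_trans (ctx _ bb') _; rewrite b'E.
  apply: (@rst_trans _ _ _ (a ++ p ++ [:: k.+1; k; k.+1] ++ q ++ d)).
    rewrite -catA; apply: rst_trans (word_eq_slide _ _ _) _.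
      by apply: small => // i ip; rewrite b'E mem_cat ip.
    have := @word_eq_slide k.+1 q (a ++ p ++ [:: k.+1; k]) d.
    rewrite -!catA /= => sl; apply/rst_sym/sl/small => // i iq.
    by rewrite b'E mem_cat inE iq !orbT.
  rewrite !(catA a p); apply/rst_sym/rst_step; exact: word_near.
have cnt : count_mem k.+1 (a ++ p ++ [:: k; k.+1; k] ++ q ++ d) < c.
  have subp : {subset p <= b'} by move=> i ip; rewrite b'E mem_cat ip.
  have subq : {subset q <= b'} by move=> i iq; rewrite b'E mem_cat inE iq !orbT.
  have/count_memPn pk : k.+1 \notin p.
    by apply/negP => /(allP (small p kp subp)) /=; rewrite ltnNge leqnSn.
  have/count_memPn qk : k.+1 \notin q.
    by apply/negP => /(allP (small q kq subq)) /=; rewrite ltnNge leqnSn.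
  move: le_c; rewrite !count_cat /= !count_cat /= pk qk eqxx.
  by rewrite ?(gtn_eqF (ltnSn k)) ?(ltn_eqF (ltnSn k)); lia.
have [|[u [i [v H]]]|[w' H le]] := IHc _ cnt _.
- by rewrite -(word_eq_all _ eqw).
- by left; exists u, i, v; apply: rst_trans eqw H.
- by right; exists w' => //; apply: rst_trans eqw H.
Qed.

(** * The leading coefficient in z *)

Local Open Scope ring_scope.

Lemma simple_far m i j : (i.+1 < j < m)%N ->
  permmul (simple m i) (simple m j) = permmul (simple m j) (simple m i).
Proof.
case/andP=> lt_ij lt_jm; have vI l : (l <= m)%N -> (inord l : 'I_m.+1) =
  l :> nat.
  exact: inordK.
rewrite /permmul; apply/esym; rewrite [LHS]conjgC; congr (_ * _)%g.
by rewrite tpermJ !tpermD // -val_eqE /= !vI //; lia.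
Qed.

Lemma simple_near m i : (i.+1 < m)%N ->
  permmul (simple m i) (permmul (simple m i.+1) (simple m i)) =
  permmul (simple m i.+1) (permmul (simple m i) (simple m i.+1)).
Proof.
move=> lt_im; have vI l : (l <= m)%N -> (inord l : 'I_m.+1) = l :> nat.
  exact: inordK.
have sJ (u v : 'S_m.+1) x y : v = tperm x y -> permmul v (permmul u v) =
  (u ^ v)%g.
  by move=> ->; rewrite conjgE /permmul tpermV mulgA.
rewrite (sJ _ _ _ _ erefl) (sJ _ _ _ _ erefl) !tpermJ tpermL tpermR.
by rewrite !tpermD // -val_eqE /= !vI //; lia.
Qed.

Section LeadingCoefficient.
Variables (H : seq slice -> laurent_az) (homH : is_HOMFLYPT H) (m : nat).

Notation homfly := (homfly H).
Notation cycn b := (cyc (nperm m b)).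

(* The closure of [b] on k.+1 strands has [cyc (nperm m b) - (m - k)]
   components, the permutation being considered on m.+1 points. *)
Definition zmin (k : nat) (b : nbraid) : int := m.+1%:Z - k%:Z - (cycn b)%:Z.

Definition regular (k : nat) (b : nbraid) : Prop :=
  forall x y : int, y < zmin k b -> (homfly k b)@_(x, y) = 0.

(** [zmin] is 1 - r for r components, so this is the coefficient of a^x in Q(b). The shift by the
    writhe absorbs the factors a and a^-1 of the skein relation. *)
Definition lead (k : nat) (b : nbraid) (x : int) : int :=
  (homfly k b)@_(x - nwrithe b, zmin k b).

Lemma zmin_insert k a b i e : (i < m)%N ->
  zmin k (a ++ (i, e) :: b) <= zmin k (a ++ b) + 1.
Proof. by move=> /(nperm_cyc_insert a b e); rewrite /zmin; lia. Qed.

Lemma nperm_sign (a b : nbraid) i e f :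
  nperm m (a ++ (i, e) :: b) = nperm m (a ++ (i, f) :: b).
Proof. by rewrite !nperm_cat. Qed.

(** The smoothing has at most one component more, so z times its polynomial starts no lower than
    [zmin] of the crossing. Below that degree the two crossings agree up to a power of a. *)
Lemma regular_flip k a b i e : below k a -> below k b -> (i < k <= m)%N ->
  regular k (a ++ b) -> regular k (a ++ (i, e) :: b) ->
  regular k (a ++ (i, ~~ e) :: b).
Proof.
move=> ak bk /andP[lt_ik le_km] regab.
have lt_im := leq_trans lt_ik le_km.
have zE f : zmin k (a ++ (i, f) :: b) = zmin k (a ++ (i, e) :: b).
  by rewrite /zmin (nperm_sign a b i f e).
have reg0 x y : y < zmin k (a ++ (i, e) :: b) ->
  (homfly k (a ++ b))@_(x, y - 1) = 0.
  by move=> lt_y; apply: regab; have := zmin_insert k a b e lt_im; lia.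
move=> rege x y; rewrite zE => lt_y; case: e {zE} rege reg0 lt_y =>
  rege reg0 lt_y.
  have := homfly_skein homH ak bk lt_ik (x - 1) y.
  by rewrite rege // reg0 // subrK sub0r => /eqP; rewrite oppr_eq0 => /eqP.
have := homfly_skein homH ak bk lt_ik (x + 1) y.
by rewrite reg0 // addrK rege // subr0.
Qed.

Lemma below_unzip k (b : nbraid) : below k b =
  all (fun i => (i < k)%N) (unzip1 b).
Proof. by rewrite /below all_map. Qed.

Definition positive (w : seq nat) : nbraid := [seq (i, true) | i <- w].

Lemma below_positive k w : below k (positive w) = all (fun i => (i < k)%N) w.
Proof. by rewrite /below all_map. Qed.

Lemma positive_cons i w : positive (i :: w) = (i, true) :: positive w.
Proof. by []. Qed.

Lemma nperm_nil : nperm m [::] = 1%g. Proof. by []. Qed.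

Lemma positive_cat u v : positive (u ++ v) = positive u ++ positive v.
Proof. exact: map_cat. Qed.

(* The two sides of a crossing change differ by a shorter closed word. *)
Lemma regular_positive k N : (k <= m)%N ->
  (forall b, below k b -> (size b < N)%N -> regular k b) ->
  forall b, below k b -> size b = N ->
  regular k b <-> regular k (positive (unzip1 b)).
Proof.
move=> le_km short b bk sb.
have flip a i e c : below k (a ++ (i, e) :: c) -> size (a ++ (i, e) :: c) = N ->
    regular k (a ++ (i, e) :: c) -> regular k (a ++ (i, ~~ e) :: c).
  rewrite below_cat /= => /and3P[ak lt_ik ck]; rewrite size_cat /= => szN.
  apply: regular_flip; rewrite ?lt_ik //; apply: short.
    by rewrite below_cat ak.
  by rewrite size_cat; lia.
rewrite -[b in regular k b]cat0s -[positive _]cat0s.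
have: below k ([::] ++ b) by []. have: size ([::] ++ b) = N by [].
elim: b {bk sb} [::] => [|[i e] b IHb] a szN abk /=; first by [].
have flipT : regular k (a ++ (i, e) :: b) <-> regular k (a ++ (i, true) :: b).
  case: e abk szN => abk szN; first by [].
  split; first exact: (flip _ _ _ _ abk szN).
  move=> rT; apply: (flip a i true b) rT; last by rewrite -szN !size_cat.
  by move: abk; rewrite !below_cat.
have := IHb (a ++ [:: (i, true)]); rewrite flipT -!catA; apply.
  by rewrite -szN !size_cat.
by move: abk; rewrite !below_cat /= andbT.
Qed.

Lemma nperm_word_eq w w' : all (fun i => (i < m)%N) w -> word_eq w w' ->
  nperm m (positive w) = nperm m (positive w').
Proof.
case: m => [|n]; first by case: w => // _ /word_eq_size; case: w'.
rewrite -[all _ w]/(all (fun i => i <= n)%N w) => wn ww';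
  elim: ww' wn => {w w'}.
- move=> _ _ [u v i j ij|u v i];
    rewrite !all_cat !positive_cat !nperm_cat => /and3P[_ ik _]; congr permmul;
    congr (permmul _ _); rewrite !positive_cons !nperm_cons !permmul1.
    by apply: simple_far; rewrite ij /=; case/and3P: ik.
  by apply: simple_near; case/and3P: ik.
- by [].
- by move=> w w' ww' IH w'n; apply/esym/IH; rewrite (word_eq_all _ ww').
- move=> w w' w'' ww' IH1 _ IH2 wn; rewrite IH1 // IH2 //.
  by rewrite -(word_eq_all _ ww').
Qed.

Lemma homfly_word_eq k w w' : all (fun i => (i < k)%N) w -> word_eq w w' ->
  homfly k (positive w) = homfly k (positive w').
Proof.
case: k => [|k]; first by case: w => // _ /word_eq_size; case: w'.
rewrite -[all _ w]/(all (fun i => i <= k)%N w) => wk ww';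
  elim: ww' wk => {w w'}.
- move=> _ _ [u v i j ij|u v i]; rewrite !all_cat => /and3P[uk ik vk];
    have [uk' vk'] : below k.+1 (positive u) /\ below k.+1 (positive v)
      by rewrite !below_positive.
    have lt_jk : (j < k.+1)%N by case/and3P: ik.
    have := homfly_iso homH (iso_far true true ij lt_jk) uk' vk'.
    by rewrite !positive_cat.
  have lt_ik : (i.+1 < k.+1)%N by case/and3P: ik.
  have := homfly_iso homH (iso_near true lt_ik) uk' vk'.
  by rewrite !positive_cat.
- by [].
- by move=> w w' ww' IH w'k; apply/esym/IH; rewrite (word_eq_all _ ww').
- move=> w w' w'' ww' IH1 _ IH2 wk; rewrite IH1 // IH2 //.
  by rewrite -(word_eq_all _ ww').
Qed.

Lemma homfly_cancel k a b i e : below k a -> below k b -> (i < k)%N ->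
  homfly k (a ++ [:: (i, e); (i, ~~ e)] ++ b) = homfly k (a ++ b).
Proof.
by move=> ak bk lt_ik; apply: (homfly_iso homH (d := [::])) => //;
  apply: iso_cancel.
Qed.

Lemma nperm_cancel a b i e f :
  nperm m (a ++ [:: (i, e); (i, f)] ++ b) = nperm m (a ++ b).
Proof.
rewrite !nperm_cat !nperm_cons nperm_nil permmul1 /=.
by rewrite [permmul (simple m i) _]/permmul tperm2 permmul1l.
Qed.

Lemma regular_eq k b b' : homfly k b = homfly k b' -> cycn b = cycn b' ->
  regular k b -> regular k b'.
Proof. by rewrite /regular /zmin => -> ->. Qed.

(** A crossing is added between the last strand and its neighbour: with either sign it is a
    stabilization of [b], and smoothing it leaves a split unknot. Thus the unknot contributes (a -
    a^-1) / z. *)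
Lemma homfly_split k b x y : below k b ->
  (homfly k.+1 b)@_(x, y - 1) = (homfly k b)@_(x - 1,
    y) - (homfly k b)@_(x + 1, y).
Proof.
move=> bk; have bk' := below_widen (leqnSn k) bk.
have := homfly_skein homH bk' (erefl : below k.+1 [::]) (ltnSn k) x y.
by rewrite cats0 !(homfly_stabilize homH).
Qed.

Lemma cyc_rot a b : cycn (a ++ b) = cycn (b ++ a).
Proof. by rewrite !nperm_cat cyc_permmulC. Qed.

(** Induction on the strands, then on the length. Signs can be taken positive, since a sign change
    costs only a shorter word; the braid relations then produce a square, or at most one occurrence
    of the last generator. *)
Theorem regular_all k b : (k <= m)%N -> below k b -> regular k b.
Proof.
elim: k b => [|k IHk] b le_km bk.
  case: b bk => // _ x y; rewrite /zmin cyc1 => lt_y.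
  by rewrite (homfly_unknot homH); case: (y =P 0) => [y0|_];
    [lia|rewrite andbF].
have [N] := ubnP (size b); elim: N b bk => // N IHN b bk;
  rewrite ltnS leq_eqVlt.
case/predU1P=> [sz|]; last exact: IHN.
apply/(regular_positive le_km IHN bk sz).
have wk : all (fun i => (i <= k)%N) (unzip1 b) by move: bk; rewrite below_unzip.
have szw : size (unzip1 b) = N by rewrite size_map.
move: (unzip1 b) wk szw => w wk szw {b bk sz}.
have wm : all (fun i => (i < m)%N) w.
  by apply: sub_all wk => i ik; apply: leq_ltn_trans ik _.
(* For a square, flipping one of its two letters makes them cancel; both the cancelled word and the
   smoothing are shorter. *)
case: (word_reduce wk) => [[u [i [v eqw]]]|[w' eqw cw']].
  apply: (regular_eq (esym (@homfly_word_eq k.+1 _ _ wk eqw))).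
    by rewrite (nperm_word_eq wm eqw).
  have uvk : below k.+1 (positive (u ++ [:: i; i] ++ v)).
    by rewrite below_positive -(word_eq_all _ eqw).
  have szN : size (positive (u ++ [:: i; i] ++ v)) = N.
    by rewrite size_map -(word_eq_size eqw).
  move: uvk szN; rewrite !positive_cat !below_cat /= andbT.
  case/and3P=> uk /andP[ik _] vk szN; rewrite -[_ ++ _]/(_ ++ [:: (i,
    true)] ++ _) catA.
  have uik : below k.+1 (positive u ++ [:: (i, true)]) by rewrite below_cat uk
    /= ik.
  apply: (@regular_flip k.+1 _ _ i false uik vk); first by apply/andP.
    apply: IHN; first by rewrite below_cat uik.
    by move: szN; rewrite !size_cat /=; lia.
  rewrite -catA; apply: (@regular_eq k.+1 (positive u ++ positive v)).
  - by rewrite -(homfly_cancel true uk vk ik).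
  - by rewrite -(nperm_cancel _ _ i true false).
  - apply: IHN; first by rewrite below_cat uk.
    by move: szN; rewrite !size_cat /=; lia.
have w'k : all (fun i => (i <= k)%N) w' by rewrite -(word_eq_all _ eqw).
apply: (regular_eq (esym (@homfly_word_eq k.+1 _ _ wk eqw))).
  by rewrite (nperm_word_eq wm eqw).
have lek p : k \notin p -> all (fun i => (i <= k)%N) p -> below k (positive p).
  move=> kp /allP pk; rewrite below_positive; apply/allP => i ip.
  move: (pk i ip); rewrite leq_eqVlt => /predU1P[ik|//].
  by rewrite ik (negPf kp) in ip.
(* A single k is a stabilization after rotation. It adds a strand and loses a cycle, so [zmin] does
   not change. *)
case: (boolP (k \in w')) => [/split_first[p [q [w'E kp]]]|kw'].
  have kq : k \notin q.
    apply/count_memPn; move: cw'; rewrite w'E count_cat /= eqxx (count_memPn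
      kp).
    by lia.
  move: w'k; rewrite w'E all_cat /= => /and3P[/(lek _ kp) pk _ /(lek _ kq) qk].
  have qpk : below k (positive q ++ positive p) by rewrite below_cat qk.
  rewrite positive_cat -[positive (k :: q)]/([:: (k, true)] ++ positive q) catA.
  apply: (@regular_eq k.+1 ((positive q ++ positive p) ++ [:: (k, true)])).
  - rewrite -catA; apply: (homfly_rot homH).
      exact: below_widen (leqnSn k) qk.
    by rewrite below_cat (below_widen (leqnSn k) pk) /= ltnSn.
  - by rewrite -catA cyc_rot.
  - have cE := cyc_stabilize true qpk le_km.
    move=> x y lt_y; rewrite (homfly_stabilize homH) //.
    by apply: (IHk _ (ltnW le_km)) => //; move: lt_y; rewrite /zmin -cE; lia.
(* Without k the last strand is a split unknot, which lowers [zmin] by one. *)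
have w'k' := lek _ kw' w'k; move=> x y lt_y.
rewrite -[y](addrK 1) homfly_split // !(IHk _ (ltnW le_km)) ?subrr //;
  by move: lt_y; rewrite /zmin; lia.
Qed.

Lemma lead_eq k b b' : homfly k b = homfly k b' ->
  nperm m b = nperm m b' -> nwrithe b = nwrithe b' -> lead k b =1 lead k b'.
Proof. by rewrite /lead /zmin => -> -> -> x. Qed.

Lemma lead_rot k a b : below k a -> below k b ->
  lead k (a ++ b) =1 lead k (b ++ a).
Proof.
move=> ak bk x; rewrite /lead /zmin cyc_rot (homfly_rot homH) //.
by rewrite !nwrithe_cat (addrC (nwrithe a)).
Qed.

Lemma lead_cancel k a b i e : below k a -> below k b -> (i < k)%N ->
  lead k (a ++ [:: (i, e); (i, ~~ e)] ++ b) =1 lead k (a ++ b).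
Proof.
move=> ak bk ik; apply: lead_eq; first exact: homfly_cancel.
  exact: nperm_cancel.
rewrite !nwrithe_cat !nwrithe_cons /=.
by case: e; rewrite /nwrithe /sgn /= !big_nil; lia.
Qed.

Lemma lead_stabilize k b e x : below k b -> (k < m)%N ->
  lead k.+1 (b ++ [:: (k, e)]) x = lead k b (x - sgn e).
Proof.
move=> bk lt_km; rewrite /lead (homfly_stabilize homH) //.
rewrite nwrithe_cat nwrithe_cons /nwrithe big_nil /zmin -(cyc_stabilize e bk
  lt_km).
by congr (_ @_ (_, _)); rewrite /=; lia.
Qed.

Lemma lead_split k b x : below k b ->
  lead k.+1 b x = lead k b (x - 1) - lead k b (x + 1).
Proof.
move=> bk; rewrite /lead.
have -> : zmin k.+1 b = zmin k b - 1 by rewrite /zmin; lia.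
by rewrite homfly_split // (addrAC x _ (-1)) (addrAC x _ 1).
Qed.

Lemma lead_unknot x : lead 0 [::] x = (x == 0)%:R.
Proof.
rewrite /lead (homfly_unknot homH) /zmin cyc1 /nwrithe big_nil subr0.
by rewrite subr0 subrr eqxx andbT.
Qed.

Lemma lead_skein k a b i x : below k a -> below k b -> (i < k <= m)%N ->
  lead k (a ++ (i, true) :: b) x =
  lead k (a ++ (i, false) :: b) x +
    (if (cycn (a ++ (i, true) :: b) < cycn (a ++ b))%N then lead k (a ++ b) x
      else 0).
Proof.
move=> ak bk /andP[lt_ik le_km]; have lt_im := leq_trans lt_ik le_km.
have := homfly_skein homH ak bk lt_ik (x - nwrithe (a ++ b)) (zmin k (a ++ (i,
  true) :: b)).
rewrite /lead (_ : zmin k (a ++ (i, false) :: b) =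
  zmin k (a ++ (i, true) :: b));
  last by rewrite /zmin (nperm_sign a b i false true).
have -> : x - nwrithe (a ++ (i, true) :: b) = x - nwrithe (a ++ b) - 1.
  by rewrite !nwrithe_cat nwrithe_cons /=; lia.
have -> : x - nwrithe (a ++ (i, false) :: b) = x - nwrithe (a ++ b) + 1.
  by rewrite !nwrithe_cat nwrithe_cons /=; lia.
move/eqP; rewrite subr_eq => /eqP ->; apply: etrans (addrC _ _) _;
  congr (_ + _).
(* If smoothing merges two components, its [zmin] exceeds that of the crossing while the coefficient
   wanted is one degree lower, hence zero by regularity. If it splits one, this coefficient is the
   leading one. *)
have [] := nperm_cyc_insert a b true lt_im => cE.
  rewrite ifF; last by rewrite cE; lia.
  by apply: regular_all; rewrite ?below_cat ?ak // /zmin cE; lia.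
by rewrite ifT ?cE //; congr (_ @_ (_, _)); rewrite /zmin cE; lia.
Qed.

End LeadingCoefficient.

Local Close Scope ring_scope.

(** * Band generators *)

Section Bands.
Variables (G : groupType) (m : nat) (s : nat -> G).
Hypothesis far : forall i j, i.+1 < j < m -> commute (s i) (s j).
Hypothesis near : forall i, i.+1 < m ->
  (s i * s i.+1 * s i = s i.+1 * s i * s i.+1)%g.
Local Open Scope group_scope.

Definition braided (x y : G) : Prop := x * y * x = y * x * y.

Lemma braidedJ x y z : braided x y -> braided (x ^ z) (y ^ z).
Proof. by rewrite /braided -!conjMg => ->. Qed.

Lemma commuteJ (x y z : G) : commute x y -> commute (x ^ z) (y ^ z).
Proof. by rewrite /commute -!conjMg => ->. Qed.

Lemma conj_fix (x y : G) : commute x y -> x ^ y = x.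
Proof. by move=> xy; rewrite conjgE xy mulKg. Qed.

Lemma braided_conj x y : braided x y -> y ^ x^-1 = x ^ y.
Proof.
move=> xy; rewrite !conjgE invgK; apply: (mulIg x); apply: (mulgI y).
by rewrite !mulgA mulgVK mulgV mul1g.
Qed.

(** The Birman-Ko-Lee generators, in any group satisfying the braid relations. In the braid group
    they are the dual lifts of the transpositions. *)
Definition band (i j : nat) : G :=
  locked (\prod_(i <= q < j.-1) s q * s j.-1 * (\prod_(i <= q < j.-1) s q)^-1).

Lemma bandE i j : band i j =
  \prod_(i <= q < j.-1) s q * s j.-1 * (\prod_(i <= q < j.-1) s q)^-1.
Proof. by rewrite /band -lock. Qed.

Lemma band1 i : band i i.+1 = s i.
Proof. by rewrite bandE big_geq // mul1g invg1 mulg1. Qed.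

Lemma bandS i j : i.+1 < j -> band i j = (band i.+1 j) ^ (s i)^-1.
Proof.
move=> lt_ij; rewrite !bandE big_ltn; last by lia.
by rewrite conjgE invgK invMg !mulgA.
Qed.

Lemma commute_prod (x : G) (r : seq nat) :
  {in r, forall q, commute x (s q)} -> commute x (\prod_(q <- r) s q).
Proof.
move=> xs; rewrite big_seq; apply: (big_ind (commute x)) => // [|y z xy xz].
  exact: commute1.
exact: commuteM.
Qed.

Lemma commute_band x i j : i < j ->
  (forall q, i <= q < j -> commute x (s q)) -> commute x (band i j).
Proof.
move=> lt_ij xs; have xp : commute x (\prod_(i <= q < j.-1) s q).
  by apply: commute_prod => q; rewrite mem_index_iota => ?; apply: xs; lia.
by rewrite bandE; apply/commuteM/commuteV => //; apply: commuteM => //;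
  apply: xs; lia.
Qed.

Lemma commute_gen_band q i j : i < j -> j <= m -> q < m -> q.+1 < i \/ j < q ->
  commute (s q) (band i j).
Proof.
move=> lt_ij le_jm lt_qm out; apply: commute_band => // r ijr.
by case: out => ?; [apply: far; lia | apply/commute_sym/far; lia].
Qed.

Lemma commute_sep i j k l : i < j < k -> k < l <= m ->
  commute (band i j) (band k l).
Proof.
case/andP=> ij jk /andP[kl lm]; apply: commute_band => // q klq.
by apply/commute_sym/commute_gen_band; lia.
Qed.

(** By commutation i may be moved up to q - 1. Then [s q] and [band i j] are conjugates of [s i] and
    [band q.+1 j] by the same element, and these commute because their supports are apart. *)
Lemma commute_gen_nest q i j : i < q -> q.+1 < j <= m ->
  commute (s q) (band i j).
Proof.
move=> lt_iq /andP[lt_qj le_jm]; have [d] := ubnP (q - i).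
elim: d i lt_iq => // d IHd i lt_iq lt_d.
rewrite (bandS (i := i)); last by lia.
case: (eqVneq i.+1 q) => [iq|ne_iq]; last first.
  have -> : s q = s q ^ (s i)^-1.
    by rewrite conj_fix //; apply/commuteV/commute_sym/far; lia.
  by apply/commuteJ/IHd; lia.
rewrite iq (bandS lt_qj) -conjgM -invMg.
have br : braided (s i) (s q) by rewrite /braided -iq; apply: near; lia.
have sqE : s q = s i ^ (s i * s q)^-1.
  by rewrite conjgE invgK mulgA br -(mulgA (s q)) mulgK.
rewrite [X in commute X _]sqE.
by apply/commuteJ/commute_gen_band; lia.
Qed.

Lemma commute_nest i j k l : i < j < k -> k < l <= m ->
  commute (band i l) (band j k).
Proof.
case/andP=> ij jk /andP[kl lm]; apply: commute_band => // q jkq.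
by apply/commute_sym/commute_gen_nest; lia.
Qed.

(** One conjugation carries the pair [s i.+1], [band i.+2 k] to the pair [s i], [band i.+1 k]; the
    induction ends at the braid relation. *)
Lemma braided_gen i k : i.+1 < k <= m -> braided (s i) (band i.+1 k).
Proof.
case/andP=> lt_ik le_km; have [d] := ubnP (k - i).
elim: d i lt_ik => // d IHd i lt_ik lt_d.
case: (eqVneq k i.+2) => [ki|ne_ki].
  by rewrite ki band1; apply: near; lia.
have br : braided (s i) (s i.+1) by apply: near; lia.
rewrite (bandS (i := i.+1)); last by lia.
have -> : s i = (s i.+1 ^ (s i)^-1) ^ (s i.+1)^-1.
  by rewrite (braided_conj br) conjgK.
apply: braidedJ.
have -> : band i.+2 k = band i.+2 k ^ (s i)^-1.
  by rewrite conj_fix //; apply/commuteV/commute_sym/commute_gen_band; lia.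
by apply/braidedJ/IHd; lia.
Qed.

(** This packs the dual braid relations t_ij t_jk = t_jk t_ik = t_ik t_ij. Conjugation by [s i]
    lowers the least point of the triangle, starting from j = i + 1. *)
Lemma band_triangle i j k : i < j < k -> k <= m ->
  band i k = (band j k) ^ (band i j)^-1 /\ braided (band i j) (band j k).
Proof.
case/andP=> lt_ij lt_jk le_km; have [d] := ubnP (j - i).
elim: d i lt_ij => // d IHd i lt_ij lt_d.
rewrite (bandS (i := i) (j := k)); last by lia.
case: (eqVneq j i.+1) => [->|ne_ji].
  by rewrite band1; split=> //; apply: braided_gen; lia.
have [|| E br] := IHd i.+1; try by lia.
rewrite (bandS (i := i) (j := j)); last by lia.
have -> : band j k = band j k ^ (s i)^-1.
  by rewrite conj_fix //; apply/commuteV/commute_sym/commute_gen_band; lia.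
by split; [rewrite E -conjVg -!conjJg | apply: braidedJ].
Qed.

Lemma band_left i j k : i < j < k -> k <= m ->
  band i k * band i j = band i j * band j k.
Proof.
move=> ijk /(band_triangle ijk)[-> _]; move: (band i j) (band j k) => x y.
by rewrite conjgE invgK !mulgA mulgVK.
Qed.

Lemma band_right i j k : i < j < k -> k <= m ->
  band i j * band j k = band j k * band i k.
Proof.
move=> ijk /(band_triangle ijk)[-> br]; rewrite (braided_conj br).
move: (band i j) (band j k) {br} => x y; by rewrite conjgE !mulgA mulgV mul1g.
Qed.

End Bands.

(** * Noncrossing permutations *)

Section Noncrossing.
Variable m : nat.
Implicit Types w : 'S_m.+1.

(* This says that w lies below the long cycle in the absolute order: the cycles
   of w are increasing, and the blocks they form do not cross. *)
Definition noncrossing w : Prop :=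
  forall x y : 'I_m.+1, x < y < w x -> x < w y < w x.

Lemma porbit_closed w (S : pred 'I_m.+1) : (forall x, S x -> S (w x)) ->
  forall x y, y \in porbit w x -> S x -> S y.
Proof.
move=> Sw x y /porbitP[i ->] Sx; elim: i => [|i IHi]; first by rewrite perm1.
by rewrite expgSr permM; apply: Sw.
Qed.

(** The open interval under an arc is stable under [w], so it contains every cycle that it meets. *)
Lemma nc_under w : noncrossing w -> forall a x y : 'I_m.+1,
  y \in porbit w x -> a < x < w a -> a < y < w a.
Proof.
move=> ncw a x y yx ax.
exact: (@porbit_closed w (fun z : 'I_m.+1 => a < z < w a) (ncw a) x y yx ax).
Qed.

Lemma mem_porbit_step w x y : y \in porbit w x -> w y \in porbit w x.
Proof.
rewrite -!eq_porbit_mem => /eqP <-; rewrite eq_porbit_mem.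
exact: (mem_porbit w 1).
Qed.

(** A cycle with points on both sides of the gap between k and k + 1 must step upwards over it. *)
Lemma porbit_crossing w (x y : 'I_m.+1) k : y \in porbit w x -> x <= k < y ->
  exists2 z, z \in porbit w x & z <= k < w z.
Proof.
move=> yx /andP[xk ky].
have [/existsP[z /andP[zx zk]]|/existsPn no] :=
  boolP [exists z, (z \in porbit w x) && (z <= k < w z)]; first by exists z.
pose S := fun z : 'I_m.+1 => (z \in porbit w x) && (z <= k).
have : S y.
  apply: (@porbit_closed w S _ x y yx); last by rewrite /S porbit_id.
  move=> z /andP[zx zk]; move: (no z); rewrite zx zk /= -leqNgt /S => ->.
  by rewrite andbT; apply: mem_porbit_step.
by rewrite /S leqNgt ky andbF.
Qed.

(** Some arc z -> w z of the cycle of i and j covers y. It cannot pass over i or j, since by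
    [nc_under] their cycle, z included, would lie strictly under the arc. The noncrossing condition
    for this arc then locates w y. *)
Lemma nc_between w (i j y : 'I_m.+1) : noncrossing w ->
  j \in porbit w i -> i <= y < j -> i < w y <= j.
Proof.
move=> ncw ji iyj; have [z zi /andP[zy yz]] := porbit_crossing ji iyj.
have iz : i \in porbit w z by rewrite porbit_sym.
have jz : j \in porbit w z by rewrite -eq_porbit_mem (eqP (_ : porbit w j ==
  porbit w i)) ?eq_porbit_mem.
have le_iz : i <= z.
  rewrite leqNgt; apply/negP => lt_zi.
  have zw : i < w z by lia.
  have := @nc_under w ncw z i z; rewrite porbit_sym iz lt_zi zw => /(_ isT isT).
  by rewrite ltnn.
have le_wj : w z <= j.
  rewrite leqNgt; apply/negP => lt_jw.
  have zj : z < j by lia.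
  have := @nc_under w ncw z j z; rewrite porbit_sym jz zj lt_jw => /(_ isT isT).
  by rewrite ltnn.
have [yz'|ne_yz] := eqVneq y z; first by rewrite yz'; lia.
have zy' : z < y < w z.
  by rewrite yz andbT ltn_neqAle zy andbT; apply: contra_neq ne_yz => /val_inj.
by have := ncw z y zy'; lia.
Qed.

Lemma cox_noncrossing : noncrossing (cox m).
Proof.
move=> x y; rewrite permE /=; have := ltn_ord x; rewrite ltnS leq_eqVlt.
case/predU1P=> [->|lt_xm]; first by rewrite modnn ltn0 andbF.
by rewrite modn_small //; lia.
Qed.

(** * Splitting a cycle of a noncrossing permutation *)

Section Step.
Variables (w : 'S_m.+1) (i j : 'I_m.+1).
Hypotheses (ncw : noncrossing w) (lt_ij : i < j) (ji : j \in porbit w i).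

Let v : 'S_m.+1 := permmul (tperm i j) w.
Let i0 := (w^-1)%g i.
Let j0 := (w^-1)%g j.

Lemma step_wi0 : w i0 = i. Proof. exact: permKV. Qed.
Lemma step_wj0 : w j0 = j. Proof. exact: permKV. Qed.

Lemma step_vi0 : v i0 = j. Proof. by rewrite permmulE step_wi0 tpermL. Qed.
Lemma step_vj0 : v j0 = i. Proof. by rewrite permmulE step_wj0 tpermR. Qed.

Lemma step_v x : x != i0 -> x != j0 -> v x = w x.
Proof.
by move=> xi xj; rewrite permmulE tpermD //; [apply: contra_neq xi|apply:
  contra_neq xj];
  move=> e; apply: (@perm_inj _ w); rewrite ?step_wi0 ?step_wj0.
Qed.

Lemma step_under (a : 'I_m.+1) : (a < i < w a) = (a < j < w a).
Proof.
by apply/idP/idP; apply: nc_under; rewrite // porbit_sym.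
Qed.

(** An arc of the cycle goes from below j to j or beyond. Ending beyond, it would have j, a point of
    its own cycle, under it; starting before i, it would pass over i but not over j. *)
Lemma step_j0 : i <= j0 < j.
Proof.
have ij : i <= j.-1 < j by lia.
have [z zi /andP[zj jz]] := porbit_crossing ji ij.
have jz' : j \in porbit w z.
  by rewrite -eq_porbit_mem (eqP (_ : porbit w j == porbit w i)) ?eq_porbit_mem
    // porbit_sym.
have wz : w z = j.
  apply/ord_inj/eqP; rewrite eqn_leq; apply/andP; split; last by lia.
  rewrite leqNgt; apply/negP => lt_jw; have zj' : z < j < w z by lia.
  have := nc_under ncw (_ : z \in porbit w j) zj'.
  by rewrite porbit_sym ltnn => /(_ jz').
have -> : j0 = z by rewrite /j0 -wz permK.
suff : ~~ (z < i) by lia.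
apply/negP => lt_zi; have := step_under z; rewrite wz lt_zi lt_ij ltnn.
by rewrite andbF.
Qed.

Lemma step_i0 : (i0 < i) || (j <= i0).
Proof.
case: (ltnP i0 i) => //= le_i; rewrite leqNgt; apply/negP => lt_j.
have := nc_between ncw ji (_ : i <= i0 < j).
by rewrite step_wi0 ltnn le_i lt_j => /(_ isT).
Qed.

Lemma step_noncrossing : noncrossing v.
Proof.
have j0b := step_j0; have i0b := step_i0.
have nij : i0 != j0.
  apply/eqP => e; move: step_wi0 step_wj0; rewrite e => -> ij;
  by move: lt_ij; rewrite ij ltnn.
move=> x y; have [->|xi] := eqVneq x i0.
  (* Here [i0] is below i, and its arc is lengthened from i to j. Points before i were already under
     it, those in [i, j) are handled by [nc_between], and the value j is now taken by [i0]. *)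
  rewrite step_vi0 => /andP[xy yj].
  have lt_i0 : i0 < i by lia.
  have wy : i0 < w y <= j.
    case: (ltnP y i) => yi.
      by have := ncw (x := i0) (y := y); rewrite step_wi0 xy yi => /(_ isT);
        lia.
    by have := nc_between ncw ji (_ : i <= y < j); rewrite yi yj => /(_ isT);
      lia.
  have [->|yj0] := eqVneq y j0; first by rewrite step_vj0; lia.
  rewrite step_v //; last by apply: contraTneq xy => ->; rewrite ltnn.
  suff : val (w y) != val j by rewrite /=; lia.
  by rewrite val_eqE; apply: contra_neq yj0 => e; rewrite /j0 -e permK.
have [->|xj] := eqVneq x j0; first by rewrite step_vj0; lia.
rewrite (step_v xi xj) => xy; have wy := ncw xy.
have [yi|yi] := eqVneq y i0.
  by rewrite yi step_vi0 -step_under -step_wi0 -yi.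
have [yj|yj] := eqVneq y j0.
  by rewrite yj step_vj0 step_under -step_wj0 -yj.
by rewrite step_v.
Qed.

End Step.

Variables (G : groupType) (s : nat -> G).
Hypothesis far : forall i j, i.+1 < j < m -> commute (s i) (s j).
Hypothesis near : forall i, i.+1 < m ->
  (s i * s i.+1 * s i = s i.+1 * s i * s i.+1)%g.

Local Open Scope group_scope.
Notation band := (band s).

Definition letter w (x : 'I_m.+1) : G := if x < w x then band x (w x) else 1.

(* The arcs x -> w x with x < w x, in increasing order of x, give the element of
   the dual braid monoid that lifts w. *)
Definition nc_lift w : G := \prod_(x <- enum 'I_m.+1) letter w x.

Definition nc_segment w a b : G := \prod_(a <= x < b) letter w (inord x).

Lemma nc_segment_cat w a b c : a <= b <= c ->
  nc_segment w a c = nc_segment w a b * nc_segment w b c.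
Proof. by case/andP=> ab bc; rewrite /nc_segment (big_cat_nat ab bc). Qed.

Lemma nc_segmentS w a b : a <= b ->
  nc_segment w a b.+1 = nc_segment w a b * letter w (inord b).
Proof. by move=> ab; rewrite /nc_segment big_nat_recr. Qed.

Lemma nc_liftE w : nc_lift w = nc_segment w 0 m.+1.
Proof.
rewrite /nc_lift /nc_segment /index_iota subn0 -val_enum_ord [RHS]big_map.
by apply: eq_bigr => x _; rewrite inord_val.
Qed.

(** * Absorbing a band into the lift of a noncrossing permutation *)

Section StepLift.
Variables (w : 'S_m.+1) (i j : 'I_m.+1).
Hypotheses (ncw : noncrossing w) (lt_ij : i < j) (ji : j \in porbit w i).

Let v : 'S_m.+1 := permmul (tperm i j) w.
Let i0 := w^-1 i.
Let j0 := w^-1 j.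

Let wi0 := step_wi0 w i : w i0 = i.
Let wj0 := step_wj0 w j : w j0 = j.
Let vi0 := step_vi0 w i j : v i0 = j.
Let vj0 := step_vj0 w i j : v j0 = i.
Let j0P := step_j0 ncw lt_ij ji : i <= j0 < j.
Let i0P := step_i0 ncw ji : (i0 < i) || (j <= i0).

(** Below i, only the letter of [i0] differs between [w] and [v]: the arc to i becomes an arc to j,
    which is [band_right]. Every other arc is apart from (i j) or passes over both its ends, and
    commutes with it. *)
Lemma letter_slide (x : 'I_m.+1) : x < i ->
  band i j * letter v x = letter w x * band i j.
Proof.
move=> xi; have xj0 : x != j0 by apply: contraTneq xi => ->; rewrite -leqNgt;
  case/andP: j0P.
have jm := ltn_ord j; rewrite ltnS in jm.
have [x_i0|xi0] := eqVneq x i0.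
  rewrite /letter x_i0 vi0 wi0 -x_i0 xi (ltn_trans xi lt_ij).
  by rewrite (band_right far near) // xi.
rewrite /letter (step_v xi0 xj0); case: ltnP => xw; last by rewrite mulg1 mul1g.
have wi : val (w x) != val i by rewrite val_eqE; apply: contra_neq xi0 => e;
  rewrite /i0 -e permK.
have wj : val (w x) != val j by rewrite val_eqE; apply: contra_neq xj0 => e;
  rewrite /j0 -e permK.
have un := step_under ncw ji x; rewrite xi /= (ltn_trans xi lt_ij) /= in un.
case: (ltnP (w x) i) => wxi.
  by apply/commute_sym/(commute_sep far); lia.
have {}wj : val (w x) != j by [].
move: wi wj un => /= wi wj un.
have wm := ltn_ord (w x).
by apply/commute_sym/(commute_nest far near); lia.
Qed.

Lemma segment_slide a : a <= i ->
  band i j * nc_segment v 0 a = nc_segment w 0 a * band i j.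
Proof.
elim: a => [|a IHa] ai; first by rewrite /nc_segment !big_geq // mulg1 mul1g.
rewrite !nc_segmentS // mulgA IHa ?(ltnW ai) // -!mulgA.
  rewrite letter_slide //.
by rewrite inordK //; have := ltn_ord i; lia.
Qed.

(** The band that travels to the right is [band z j], where z is the least point of the cycle of i
    that is at least a. [band_left] takes it past the arc z -> w z, where it becomes [band (w z) j];
    arcs of other cycles met on the way end before z, so they commute with it. *)
Lemma segment_follow a : i <= a <= j0 ->
  exists z : 'I_m.+1, [/\ z \in porbit w i, a <= z <= j0,
    forall y : 'I_m.+1, y \in porbit w i -> a <= y -> z <= y
    & band i j * nc_segment w i a = nc_segment w i a * band z j].
Proof.
have jm := ltn_ord j; rewrite ltnS in jm.
elim: a => [|a IHa] aij.
  exists i; split; rewrite ?porbit_id //; first by lia.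
    by move=> y _ _; lia.
  by rewrite /nc_segment !big_geq ?mulg1 ?mul1g //; lia.
have [ia|ia] := eqVneq (i : nat) a.+1.
  exists i; split; rewrite ?porbit_id //; first by lia.
    by move=> y _; lia.
  by rewrite ia /nc_segment !big_geq ?mulg1 ?mul1g.
have [z [zi az zmin E]] := IHa ltac:(lia).
have am : (inord a : 'I_m.+1) = a :> nat.
  by apply: inordK; have := ltn_ord j; lia.
have jz : j \in porbit w z.
  by move: zi ji; rewrite -!eq_porbit_mem => /eqP -> /eqP ->.
rewrite nc_segmentS ?mulgA ?E; last by lia.
have [az'|ne_az] := eqVneq (inord a) z.
  have za : z = a :> nat by rewrite -az'.
  have /andP[zw wj] : z < w z <= j by apply: nc_between ncw jz _; lia.
  have wzj : w z != j.
    apply/eqP => e; have zj0 : z = j0 by rewrite /j0 -e permK.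
    by rewrite -zj0 in aij; lia.
  have {wj}wj : w z < j by rewrite ltn_neqAle wj andbT.
  have wj0z : w z <= j0.
    rewrite leqNgt; apply/negP => lt_j0; have jwz : j \in porbit w (w z).
      by rewrite porbit_sym; apply: mem_porbit_step; rewrite porbit_sym.
    have := nc_under ncw (a := j0) jwz.
    by rewrite wj0 lt_j0 wj ltnn andbF => /(_ isT).
  exists (w z); split; first exact: mem_porbit_step.
  - by lia.
  - move=> y yi ay; rewrite leqNgt; apply/negP => lt_y.
    have zy : z \in porbit w y by move: yi zi;
      rewrite -!eq_porbit_mem => /eqP -> /eqP ->.
    have := nc_under ncw (a := z) zy.
    by rewrite ltnn lt_y andbT => /(_ ltac:(lia)).
  - rewrite az' /letter zw -!mulgA; congr (_ * _).
    by rewrite (band_left far near) // zw.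
have lt_az : a < z by rewrite ltn_neqAle; case/andP: az => -> _; rewrite andbT;
  apply: contra_neq ne_az => e; apply: ord_inj; rewrite am.
exists z; split=> //; first by lia.
  by move=> y yi ay; apply: zmin => //; apply: ltnW.
rewrite -!mulgA; congr (_ * _); rewrite /letter.
case: ltnP => [aw|_]; last by rewrite mulg1 mul1g.
have waz : w (inord a) != z.
  apply: contraTneq lt_az => e; rewrite -leqNgt;
    apply: leq_trans (zmin (inord a) _ _) _; rewrite ?am //.
  have : w (inord a) \in porbit w (inord a) by apply/mem_porbit_step/porbit_id.
  by rewrite e -eq_porbit_mem => /eqP oE; rewrite -eq_porbit_mem -oE
    eq_porbit_mem.
have {}waz : val (w (inord a)) != val z by rewrite val_eqE.
case: (ltnP (w (inord a)) z) => wz.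
  by apply/commute_sym/(commute_sep far); lia.
have := nc_under ncw (a := inord a) (_ : i \in porbit w z).
by rewrite am lt_az porbit_sym => /(_ zi) /(_ ltac:(rewrite /= in waz *; lia));
  lia.
Qed.

Lemma letter_same (x : 'I_m.+1) : i <= x -> x != j0 -> letter v x = letter w x.
Proof.
move=> ix xj0; have [xi0|xi0] := eqVneq x i0;
  last by rewrite /letter (step_v xi0 xj0).
have ji0 : j <= i0 by rewrite xi0 in ix; case/orP: i0P => //; lia.
by rewrite /letter xi0 vi0 wi0 !ltnNge ji0 (leq_trans (ltnW lt_ij) ji0).
Qed.

(** On reaching [j0] the travelling band is [band j0 j], the letter of [j0] in [w]; in [v] this
    letter is trivial because [j0] is sent to i <= j0. The other letters from i on agree. *)
Lemma nc_lift_step : nc_lift w = band i j * nc_lift v.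
Proof.
have j0m := ltn_ord j0; case/andP: j0P => ij0 j0j.
rewrite !nc_liftE !(@nc_segment_cat _ 0 i m.+1); try by lia.
rewrite !(@nc_segment_cat _ i j0 m.+1) ?(@nc_segment_cat _ j0 j0.+1 m.+1);
  try by lia.
rewrite [RHS]mulgA segment_slide // -[RHS]mulgA; congr (_ * _).
have [z [zi /andP[jz zj] _ E]] := @segment_follow j0 ltac:(lia).
have zE : z = j0 by apply: ord_inj; lia.
have same a b : i <= a -> b <= m.+1 -> j0 < a \/ b <= j0 ->
    nc_segment v a b = nc_segment w a b.
  move=> ia bm out; apply: eq_big_nat => x abx.
  have vx : (inord x : 'I_m.+1) = x :> nat by apply: inordK; lia.
  apply: letter_same; first by rewrite vx; lia.
  by apply/eqP => /(congr1 val); rewrite /= vx; lia.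
rewrite (same i j0 (leqnn _) (ltnW j0m) (or_intror (leqnn _))).
rewrite (same j0.+1 m.+1 (leqW ij0) (leqnn _) (or_introl (ltnSn _))).
rewrite [RHS]mulgA E zE -!mulgA; congr (_ * _).
rewrite !mulgA; congr (_ * _); rewrite /nc_segment !big_nat1 !inord_val /letter.
by rewrite vj0 wj0 j0j ltnNge ij0 mulg1.
Qed.

End StepLift.

End Noncrossing.

(** * The braid group *)

Section BraidGroup.
Variable m : nat.
Implicit Types a b c : braid m.

Lemma braid_eq_refl a : braid_eq a a. Proof. exact: rst_refl. Qed.

Lemma braid_eq_ctx u v a b : braid_eq a b -> braid_eq (u ++ a ++ v) (u ++ b ++
  v).
Proof.
elim=> {a b} [a b [u' v' l r lr]|a|a b _|a b c _ IH1 _ IH2].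
- by apply: rst_step; rewrite -!catA !(catA u u'); apply: BraidStep.
- exact: rst_refl.
- exact: rst_sym.
- exact: rst_trans IH1 IH2.
Qed.

Lemma braid_eq_cat a b c d : braid_eq a b -> braid_eq c d ->
  braid_eq (a ++ c) (b ++ d).
Proof.
move=> /(braid_eq_ctx [::] c) /= ab /(braid_eq_ctx b [::]); rewrite !cats0.
exact: rst_trans ab.
Qed.

Lemma braid_inv_cat a b : braid_inv (a ++ b) = braid_inv b ++ braid_inv a.
Proof. by rewrite /braid_inv rev_cat map_cat. Qed.

Lemma braid_invK : involutive (@braid_inv m).
Proof.
move=> a; rewrite /braid_inv -map_rev revK -map_comp map_id_in // =>
  -[i e] _ /=.
by rewrite negbK.
Qed.

Lemma braid_eq_invr a : braid_eq (a ++ braid_inv a) [::].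
Proof.
elim: a => [|[i e] a IHa]; first exact: rst_refl.
rewrite -cat1s braid_inv_cat -catA (catA a).
apply: rst_trans (braid_eq_ctx [:: (i, e)] (braid_inv [:: (i, e)]) IHa) _.
exact: (rst_step _ _ _ _ (BraidStep [::] [::] (braid_cancel i e))).
Qed.

Lemma braid_eq_invl a : braid_eq (braid_inv a ++ a) [::].
Proof. by rewrite -{2}[a]braid_invK; apply: braid_eq_invr. Qed.

Lemma braid_eq_inv a b : braid_eq a b -> braid_eq (braid_inv a) (braid_inv b).
Proof.
move=> ab; have e1 := braid_eq_cat (braid_eq_refl (braid_inv a)) (braid_eq_invr
  b).
rewrite cats0 in e1; apply: rst_trans (rst_sym _ _ _ _ e1) _.
have e2 := braid_eq_ctx (braid_inv a) (braid_inv b) (rst_sym _ _ _ _ ab).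
apply: rst_trans e2 _; rewrite catA.
exact: (braid_eq_cat (braid_eq_invl a) (braid_eq_refl _)).
Qed.

Definition braid_eqb a b : bool := `[< braid_eq a b >].

Lemma braid_eqb_refl : reflexive braid_eqb.
Proof. by move=> a; apply/asboolP/rst_refl. Qed.

Lemma braid_eqb_sym : symmetric braid_eqb.
Proof. by move=> a b; apply/asboolP/asboolP; apply: rst_sym. Qed.

Lemma braid_eqb_trans : transitive braid_eqb.
Proof.
by move=> b a c /asboolP ab /asboolP bc; apply/asboolP; apply: rst_trans ab bc.
Qed.

Canonical braid_equiv := EquivRel braid_eqb braid_eqb_refl braid_eqb_sym
  braid_eqb_trans.

Local Open Scope quotient_scope.

(** The quotient is a [groupType], to which the identities between bands, proved in an abstract
    group, apply. *)
Definition braid_group := {eq_quot braid_equiv}.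
HB.instance Definition _ := Choice.on braid_group.

Definition cls a : braid_group := \pi_({eq_quot braid_equiv}) a.

Lemma clsP a b : cls a = cls b <-> braid_eq a b.
Proof.
split=> [/eqP|/asboolP ab]; last by apply/eqmodP.
by rewrite /cls => /eqP/eqmodP/asboolP.
Qed.

Definition repr_cls (x : braid_group) : braid m := repr (x : {eq_quot
  braid_equiv}).

Lemma cls_repr x : cls (repr_cls x) = x.
Proof. exact: reprK. Qed.

Definition bg_mul (x y : braid_group) := cls (repr_cls x ++ repr_cls y).
Definition bg_inv (x : braid_group) := cls (braid_inv (repr_cls x)).

Lemma bg_mulE a b : bg_mul (cls a) (cls b) = cls (a ++ b).
Proof. by apply/clsP/braid_eq_cat; apply/clsP; rewrite cls_repr. Qed.

Lemma bg_invE a : bg_inv (cls a) = cls (braid_inv a).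
Proof. by apply/clsP/braid_eq_inv/clsP; rewrite cls_repr. Qed.

Lemma bg_mulA : associative bg_mul.
Proof.
move=> x y z; rewrite -[x]cls_repr -[y]cls_repr -[z]cls_repr !bg_mulE.
by rewrite catA.
Qed.

Lemma bg_mul1 : left_id (cls [::]) bg_mul.
Proof. by move=> x; rewrite -[x]cls_repr bg_mulE. Qed.

Lemma bg_mulr1 : right_id (cls [::]) bg_mul.
Proof. by move=> x; rewrite -[x]cls_repr bg_mulE cats0. Qed.

Lemma bg_mulV : left_inverse (cls [::]) bg_inv bg_mul.
Proof.
move=> x; rewrite -[x]cls_repr bg_invE bg_mulE.
exact/clsP/braid_eq_invl.
Qed.

Lemma bg_mulrV : right_inverse (cls [::]) bg_inv bg_mul.
Proof.
move=> x; rewrite -[x]cls_repr bg_invE bg_mulE.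
exact/clsP/braid_eq_invr.
Qed.

HB.instance Definition _ :=
  isGroup.Build braid_group bg_mulA bg_mul1 bg_mulr1 bg_mulV bg_mulrV.

Local Open Scope group_scope.

Lemma cls_cat a b : cls (a ++ b) = cls a * cls b.
Proof. by rewrite -bg_mulE. Qed.

Lemma cls_inv a : cls (braid_inv a) = (cls a)^-1.
Proof. by rewrite -bg_invE. Qed.

Definition gen (i : nat) : braid_group :=
  if insub i is Some o then cls [:: (o : 'I_m, true)] else 1.

Lemma genE (i : 'I_m) : gen i = cls [:: (i, true)].
Proof. by rewrite /gen valK. Qed.

Lemma gen_far i j : i.+1 < j < m -> commute (gen i) (gen j).
Proof.
case/andP=> ij jm; have im : i < m by lia.
rewrite -[i]/(val (Ordinal im)) -[j]/(val (Ordinal jm)) !genE /commute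
  -!cls_cat.
apply/clsP; apply: rst_step.
exact: (BraidStep [::] [::] (@braid_far m (Ordinal im) (Ordinal jm) ij)).
Qed.

Lemma gen_near i : i.+1 < m ->
  gen i * gen i.+1 * gen i = gen i.+1 * gen i * gen i.+1.
Proof.
move=> i1m; have im : i < m by lia.
rewrite -[i.+1]/(val (Ordinal i1m)) -[i]/(val (Ordinal im)) !genE -!cls_cat.
apply/clsP; apply: rst_step.
exact: (BraidStep [::] [::] (@braid_near m (Ordinal im) (Ordinal i1m) erefl)).
Qed.

Lemma cls_posbraid (s : seq 'I_m) : cls (posbraid s) =
  \prod_(q <- map val s) gen q.
Proof.
elim: s => [|i s IHs]; first by rewrite big_nil.
by rewrite /= big_cons genE -IHs -cls_cat.
Qed.

Lemma enum_segment i j : j <= m ->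
  [seq val k | k <- [seq k : 'I_m <- enum 'I_m | i <= k & k < j]] =
    iota i (j - i).
Proof.
move=> jm; apply: (irr_sorted_eq ltn_trans ltnn).
- rewrite sorted_map; apply: sorted_filter => [y x z|]; first exact: ltn_trans.
  by have := iota_ltn_sorted 0 m; rewrite -val_enum_ord sorted_map.
- exact: iota_ltn_sorted.
move=> q; rewrite mem_iota; apply/mapP/andP => [[k]|[iq qj]].
  by rewrite mem_filter => /andP[/andP[ik kj] _] ->; split=> //=; lia.
have qm : q < m by lia.
by exists (Ordinal qm) => //; rewrite mem_filter mem_enum /= iq andbT; lia.
Qed.

Lemma cls_dual_lift (t : transp m) :
  cls (dual_lift t) = band gen (val t).1 (val t).2.
Proof.
case: t => -[i j] /= ij; rewrite /dual_lift /= !cls_cat cls_inv !cls_posbraid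
  bandE.
have jm := ltn_ord j; have j0 : j.-1 < m by lia.
have -> : [seq k : 'I_m <- enum 'I_m | i <= k & k.+1 < j] =
    [seq k : 'I_m <- enum 'I_m | i <= k & k < j.-1].
  by apply: eq_filter => k; congr (_ && _); lia.
rewrite enum_segment ?(ltnW j0) // -/(index_iota i j.-1).
have -> : [seq k : 'I_m <- enum 'I_m | k.+1 == j :> nat] =
  [seq k : 'I_m <- enum 'I_m | j.-1 <= k & k < j].
  by apply: eq_filter => k; lia.
rewrite enum_segment // (_ : j - j.-1 = 1%N); last by lia.
by rewrite big_seq1 mulgA.
Qed.

Lemma cls_cox : cls (braid_cox m) = nc_lift gen (cox m).
Proof.
rewrite /braid_cox cls_posbraid val_enum_ord nc_liftE /nc_segment.
(* The last point goes back to 0 and carries no arc. *)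
rewrite big_nat_recr //= {2}/letter.
have -> : (inord m : 'I_m.+1) = ord_max by apply: ord_inj; rewrite inordK.
rewrite permE /= modnn ltn0 mulg1 /index_iota subn0.
apply: eq_big_seq => q; rewrite mem_iota => /andP[_ qm].
have vq : (inord q : 'I_m.+1) = q :> nat by rewrite inordK //; lia.
by rewrite /letter permE /= vq modn_small ?ltnS // leqnn band1.
Qed.

End BraidGroup.

(** * Evaluation of the leading coefficient *)

Local Open Scope ring_scope.

Definition natw m (b : braid m) : nbraid := [seq (val x.1, x.2) | x <- b].

Lemma natw_cat m (a b : braid m) : natw (a ++ b) = natw a ++ natw b.
Proof. exact: map_cat. Qed.

Lemma below_natw m (b : braid m) : below m (natw b).
Proof. by rewrite /below all_map; apply/allP => x _ /=. Qed.

Lemma braid_closureE m (b : braid m) : braid_closure b = nclosure m (natw b).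
Proof. by rewrite /nclosure /crossings -map_comp. Qed.

Lemma braid_permE m (b : braid m) : braid_perm b = nperm m (natw b).
Proof. by rewrite /nperm -map_comp. Qed.

Lemma writheE m (b : braid m) : writhe b = nwrithe (natw b).
Proof. by rewrite /nwrithe big_map. Qed.

Lemma braid_perm_cat m (a b : braid m) :
  braid_perm (a ++ b) = permmul (braid_perm a) (braid_perm b).
Proof. by rewrite !braid_permE natw_cat nperm_cat. Qed.

Lemma braid_eq_perm m (a b : braid m) : braid_eq a b -> braid_perm a =
  braid_perm b.
Proof.
elim=> {a b} [_ _ [u v l r lr]|//|a b _ ->|a b c _ -> _ ->] //.
rewrite !braid_perm_cat; congr (permmul _ (permmul _ _)).
case: lr => [i e|i j ij|i j ji].
- by rewrite !braid_permE (nperm_cancel m [::] [::]).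
- rewrite /braid_perm /= !permmul1; apply: simple_far.
  by rewrite ij ltn_ord.
- rewrite /braid_perm /= !permmul1 ji; apply: simple_near.
  by rewrite -ji ltn_ord.
Qed.

Lemma braid_perm_cls m (a b : braid m) : cls a = cls b -> braid_perm a =
  braid_perm b.
Proof. by move=> /clsP/braid_eq_perm. Qed.

Section Evaluation.
Variables (H : seq slice -> laurent_az) (homH : is_HOMFLYPT H) (m : nat).

Definition blead (b : braid m) (x : int) : int := lead H m m (natw b) x.

Lemma blead_cls (a b : braid m) : cls a = cls b -> blead a =1 blead b.
Proof.
move=> /clsP; elim=> {a b} [_ _ [u v l r lr]|//|a b _ IH|a b c _ IH1 _ IH2] x;
  last 2 first.
- by rewrite IH.
- by rewrite IH1.
rewrite /blead !natw_cat; apply: lead_eq.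
- apply: (homfly_iso homH); rewrite ?below_natw //;
    case: lr => [i e|i j ij|i j ji].
  + exact: (iso_cancel e (ltn_ord i)).
  + exact: (iso_far true true ij (ltn_ord j)).
  + by rewrite /= ji; apply: (@iso_near m i true); rewrite -ji ltn_ord.
- rewrite -!natw_cat -!braid_permE; apply/braid_eq_perm/rst_step.
  exact: BraidStep.
- rewrite !nwrithe_cat; congr (_ + (_ + _)).
  case: lr => [i e|i j ij|i j ji]; rewrite /nwrithe !big_cons !big_nil //=.
  by case: e.
Qed.

Lemma blead_rot (a b : braid m) : blead (a ++ b) =1 blead (b ++ a).
Proof. by move=> x; rewrite /blead !natw_cat; apply: lead_rot;
  rewrite ?below_natw. Qed.

Lemma blead_skein (a b : braid m) i x :
  blead (a ++ (i, true) :: b) x = blead (a ++ (i, false) :: b) x +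
    (if (cyc (braid_perm (a ++ (i, true) :: b)) < cyc (braid_perm (a ++ b)))%N
     then blead (a ++ b) x else 0).
Proof.
by rewrite /blead !braid_permE !natw_cat; apply: lead_skein;
  rewrite ?below_natw //= ltn_ord leqnn.
Qed.

Lemma dual_lift_conj (t : transp m) :
  exists (a : braid m) i, dual_lift t = a ++ (i, true) :: braid_inv a.
Proof.
case: t => -[i j] /= ij; have jm := ltn_ord j; have j0 : (j.-1 < m)%N by lia.
have jE : [seq k : 'I_m <- enum 'I_m | k.+1 == j :> nat] = [:: Ordinal j0].
  apply: (inj_map val_inj).
  have -> : [seq k : 'I_m <- enum 'I_m | k.+1 == j :> nat] =
      [seq k : 'I_m <- enum 'I_m | j.-1 <= k & k < j]%N.
    by apply: eq_filter => k; lia.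
  by rewrite enum_segment // (_ : j - j.-1 = 1)%N //; lia.
exists (posbraid [seq k : 'I_m <- enum 'I_m | i <= k & k.+1 < j])%N,
  (Ordinal j0).
by rewrite /dual_lift /= jE.
Qed.

(* Flipping a crossing of t inside t^2 or t^-2 and cancelling; when t merges no
   components, the sign of t in the remaining term is irrelevant. *)
Lemma blead_pure (a b : braid m) t e x :
  blead (a ++ pure_PP t e ++ b) x = blead (a ++ b) x +
    sgn e * (if (cyc (braid_perm (a ++ b)) < cyc (braid_perm (a ++ dual_lift t
      ++ b)))%N
     then blead (a ++ braid_inv (dual_lift t) ++ b) x else 0).
Proof.
have [c [i tE]] := dual_lift_conj t; rewrite /pure_PP tE.
have iE f : braid_inv (c ++ (i, f) :: braid_inv c) =
  c ++ (i, ~~ f) :: braid_inv c.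
  by rewrite braid_inv_cat -cat1s braid_inv_cat braid_invK -catA.
pose K f : braid m := [:: (i, f)].
have sqE f : cls (a ++ ((c ++ (i, f) :: braid_inv c) ++ (c ++ (i,
  f) :: braid_inv c)) ++ b)
    = cls ((a ++ c) ++ (i, f) :: ((i, f) :: braid_inv c ++ b)).
  transitivity (cls (a ++ ((c ++ K f ++ braid_inv c) ++ (c ++ K f ++ braid_inv
    c)) ++ b)).
    by [].
  transitivity (cls ((a ++ c) ++ K f ++ K f ++ braid_inv c ++ b)); last by [].
  rewrite !cls_cat cls_inv.
  by move: (cls a) (cls b) (cls c) (cls (K f)) => A B C D;
    rewrite -!mulgA mulKg.
have cancelE f : cls ((a ++ c) ++ (i, f) :: ((i, ~~ f) :: braid_inv c ++ b)) =
  cls (a ++ b).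
  transitivity (cls ((a ++ c) ++ K f ++ braid_inv (K f) ++ braid_inv c ++ b));
    first by [].
  rewrite !cls_cat !cls_inv.
  by move: (cls a) (cls b) (cls c) (cls (K f)) => A B C D;
    rewrite -!mulgA !mulKVg.
have oneE f : a ++ (c ++ (i, f) :: braid_inv c) ++ b
    = (a ++ c) ++ (i, f) :: (braid_inv c ++ b) by rewrite -!catA.
have perm_sign (d d' : braid m) f : braid_perm (d ++ (i, f) :: d') =
  braid_perm (d ++ (i, true) :: d').
  by rewrite !braid_perm_cat.
have cE : braid_perm ((a ++ c) ++ (i, true) :: ((i,
  true) :: braid_inv c ++ b)) =
    braid_perm (a ++ b).
  rewrite -(braid_perm_cls (cancelE false)) perm_sign.
  by [].
have dE : braid_perm ((a ++ c) ++ braid_inv c ++ b) = braid_perm (a ++ b).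
  apply: braid_perm_cls; rewrite !cls_cat cls_inv.
  by rewrite -!mulgA mulKVg.
case: e; last first.
  rewrite braid_inv_cat !iE (blead_cls (sqE false)) !oneE.
  have := blead_skein (a ++ c) ((i, false) :: braid_inv c ++ b) i x.
  rewrite (blead_cls (cancelE true)) (braid_perm_cls (cancelE true)) => ->.
  by rewrite mulN1r (perm_sign (a ++ c) (braid_inv c ++ b) false) addrK.
rewrite (blead_cls (sqE true)) iE !oneE blead_skein (blead_cls (cancelE false))
  cE mul1r.
congr (_ + _); case: ifP => // lt_c; rewrite blead_skein dE; case: ifP;
  last by rewrite addr0.
by rewrite ltnNge ltnW.
Qed.

Lemma braid_perm_pure (t : transp m) e : braid_perm (pure_PP t e) = 1%g.
Proof.
have inv1 (d : braid m) : braid_perm d = 1%g -> braid_perm (braid_inv d) = 1%g.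
  move=> d1; have := braid_perm_cls (_ : cls (braid_inv d ++ d) = cls [::]).
  rewrite braid_perm_cat d1 permmul1; apply.
  by apply/clsP/braid_eq_invl.
have sq : braid_perm (dual_lift t ++ dual_lift t) = 1%g.
  have [c [i ->]] := dual_lift_conj t.
  have <- : braid_perm ((c ++ (i, true) :: braid_inv c) ++ (c ++ (i,
    false) :: braid_inv c)) = 1%g.
    rewrite -[RHS]/(braid_perm (Nil ('I_m * bool))); apply: braid_perm_cls.
    rewrite -[(i, true) :: _]/([:: (i, true)] ++ _) -[(i,
      false) :: _]/(braid_inv [:: (i, true)] ++ _).
    rewrite !cls_cat !cls_inv; move: (cls c) (cls [:: _]) => A B.
    by rewrite -!mulgA mulKg mulKVg mulgV.
  by rewrite !braid_perm_cat.
by rewrite /pure_PP; case: e => //; apply: inv1.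
Qed.

(* [binomial_coef s e x] is the coefficient of a^x in a^e (a - a^-1)^s. *)
Fixpoint binomial_coef (s : nat) (e x : int) : int :=
  if s is s'.+1 then binomial_coef s' e (x - 1) - binomial_coef s' e (x + 1)
  else (x == e)%:R.

Lemma binomial_coef_shift s e x :
  binomial_coef s (e + 1) x = binomial_coef s e (x - 1).
Proof.
elim: s x => [|s IHs] x /=; first by rewrite subr_eq.
by rewrite !IHs addrK subrK.
Qed.

Definition ninv (x : nbraid) : nbraid := [seq (q.1, ~~ q.2) | q <- rev x].

Lemma below_ninv k x : below k (ninv x) = below k x.
Proof. by rewrite /below all_map all_rev. Qed.

Definition nband (p : nat * nat) : nbraid :=
  let x := positive (iota p.1 (p.2.-1 - p.1)) in x ++ (p.2.-1, true) :: ninv x.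

Lemma below_nband_conj k i j : (j <= k)%N -> below k (positive (iota i (j -
  i))).
Proof. by move=> jk; rewrite below_positive; apply/allP => q; rewrite mem_iota;
  lia. Qed.

Lemma below_nband k p : (p.1 < p.2 <= k)%N -> below k (nband p).
Proof.
case: p => i j /= /andP[ij jk]; have j1k : (j.-1 < k)%N by lia.
by rewrite /nband below_cat /= below_ninv below_nband_conj ?j1k // ltnW.
Qed.

Lemma nperm_nband i j : (i < j <= m)%N ->
  nperm m (nband (i, j)) = tperm (inord i) (inord j).
Proof.
have [d] := ubnP (j - i); elim: d i => // d IHd i lt_d /andP[ij jm].
have vI l : (l <= m)%N -> (inord l : 'I_m.+1) = l :> nat by exact: inordK.
have [ji|ji] := eqVneq j i.+1.
  by rewrite /nband /= ji subnn /= /nperm /= permmul1.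
have -> : nband (i, j) = [:: (i, true)] ++ nband (i.+1, j) ++ [:: (i, false)].
  rewrite /nband /= (_ : j.-1 - i = (j.-1 - i.+1).+1)%N; last by lia.
  by rewrite /= /ninv rev_cons map_rcons -cats1 -!catA.
rewrite (nperm_cat m [:: _]) (nperm_cat m (nband (i.+1, j))) IHd; try by lia.
have sJ (t : 'S_m.+1) : permmul (simple m i) (permmul t (simple m i)) =
  (t ^ simple m i)%g.
  by rewrite conjgE /permmul tpermV mulgA.
rewrite /nperm /= !permmul1 sJ tpermJ tpermR tpermD //;
  rewrite -val_eqE /= !vI //; lia.
Qed.

Lemma natw_posbraid (s : seq 'I_m) : natw (posbraid s) = positive (map val s).
Proof. by rewrite /natw /posbraid /positive -!map_comp. Qed.

Lemma natw_inv (b : braid m) : natw (braid_inv b) = ninv (natw b).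
Proof. by rewrite /natw /ninv -map_rev -!map_comp. Qed.

Lemma natw_dual_lift (t : transp m) : natw (dual_lift t) =
  nband (nat_of_ord (val t).1, nat_of_ord (val t).2).
Proof.
case: t => -[i j] /= ij; have jm := ltn_ord j.
rewrite /dual_lift /= !natw_cat natw_inv !natw_posbraid.
have -> : [seq k : 'I_m <- enum 'I_m | i <= k & k.+1 < j]%N =
    [seq k : 'I_m <- enum 'I_m | i <= k & k < j.-1]%N.
  by apply: eq_filter => k; congr (_ && _); lia.
have -> : [seq k : 'I_m <- enum 'I_m | k.+1 == j :> nat] =
  [seq k : 'I_m <- enum 'I_m | j.-1 <= k & k < j]%N.
  by apply: eq_filter => k; lia.
have j1m : (j.-1 <= m)%N by lia.
by rewrite (enum_segment i j1m) (@enum_segment m j.-1 j jm) (_ : j - j.-1 =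
  1)%N //; lia.
Qed.

Lemma braid_perm_dual_lift (t : transp m) : braid_perm (dual_lift t) =
  tperm_of t.
Proof.
rewrite braid_permE natw_dual_lift nperm_nband ?inord_val //.
by case: t => -[i j] /= ij; rewrite ij -ltnS ltn_ord.
Qed.

Definition nbands (J : seq (nat * nat)) : nbraid := flatten [seq nband p | p <-
  J].

Lemma nbands_cat J1 J2 : nbands (J1 ++ J2) = nbands J1 ++ nbands J2.
Proof. by rewrite /nbands map_cat flatten_cat. Qed.

Lemma below_nbands k J : all (fun p => p.1 < p.2 <= k)%N J ->
  below k (nbands J).
Proof.
elim: J => //= p J IHJ /andP[pk /IHJ Jk].
by rewrite [nbands _]/= below_cat below_nband.
Qed.

Lemma lead_cancel_word k a x b : below k a -> below k x -> below k b ->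
  lead H m k (a ++ x ++ ninv x ++ b) =1 lead H m k (a ++ b).
Proof.
elim/last_ind: x a b => [|x [i e] IHx] a b // ak + bk y.
rewrite /below all_rcons -/(below k x) => /andP[/= ik xk].
rewrite /ninv rev_rcons /= -cats1 -catA catA.
rewrite (lead_cancel homH m (a := a ++ x) (b := ninv x ++ b) e) //.
- by rewrite -catA; apply: IHx.
- by rewrite below_cat ak.
- by rewrite below_cat below_ninv xk.
Qed.

(** At most one band reaches the last strand. If one does, rotation brings its middle letter to the
    end, destabilization removes it with a factor a, and its two conjugating halves cancel. If none
    does, the strand splits off with a factor a - a^-1. *)
Lemma lead_bands k J : (k <= m)%N -> all (fun p => p.1 < p.2 <= k)%N J ->
  uniq [seq p.2 | p <- J] ->
  lead H m k (nbands J) =1 binomial_coef (k - size J) (size J)%:Z.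
Proof.
elim: k J => [|k IHk] J km Jk uJ x.
  case: J Jk uJ => [|[i j] J] /=; first by move=> _ _;
    rewrite (lead_unknot homH).
  by case/andP=> /andP[]; case: j.
have small (J' : seq (nat * nat)) : all (fun p => p.1 < p.2 <= k.+1)%N J' ->
    k.+1 \notin [seq p.2 | p <- J'] -> all (fun p => p.1 < p.2 <= k)%N J'.
  move=> J'k kJ; apply/allP => p pJ; have /andP[p12 pk] := allP J'k p pJ;
    rewrite p12 /=.
  move: pk; rewrite leq_eqVlt => /predU1P[pk|//].
  by case/negP: kJ; apply/mapP; exists p.
case: (boolP (k.+1 \in [seq p.2 | p <- J])) => [/mapP[[i k1] /= + k1E]|kJ];
  last first.
  have Jk' := small J Jk kJ; have Jsz : (size J <= k)%N.
    rewrite -(size_map snd) -(size_iota 1 k);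
      apply: uniq_leq_size => // q /mapP[p pJ ->].
    by have := allP Jk' p pJ; rewrite mem_iota; lia.
  rewrite (lead_split homH) ?below_nbands // !(IHk _ (ltnW km)) //.
  by rewrite subSn.
rewrite -{k1}k1E => /path.splitPr JE; case: JE Jk uJ => J1 J2.
rewrite all_cat /= => /and3P[J1k /andP[ik _] J2k].
rewrite map_cat /= uniq_catC /= mem_cat negb_or => /andP[/andP[k2 k1] u21].
have {}J1k := small _ J1k k1; have {}J2k := small _ J2k k2.
have kk := below_widen (leqnSn k).
set X := positive (iota i (k - i)); have Xk : below k X by apply:
  below_nband_conj.
have N1 := below_nbands J1k; have N2 := below_nbands J2k.
have -> : nbands (J1 ++ (i, k.+1) :: J2) = (nbands J1 ++ X) ++ (k,
  true) :: ninv X ++ nbands J2.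
  rewrite nbands_cat -catA; congr (_ ++ _).
  by rewrite -[LHS]/(nband (i, k.+1) ++ nbands J2) /nband -catA.
rewrite -cat1s catA (lead_rot homH) ?below_cat /= ?ltnSn ?below_ninv ?kk //.
rewrite catA (lead_stabilize homH) ?below_cat ?below_ninv ?Xk ?N1 ?N2 //.
rewrite -catA (lead_rot homH) ?below_cat ?below_ninv ?Xk ?N1 ?N2 //.
rewrite -!catA catA -[in LHS](cats0 (ninv X)) lead_cancel_word ?below_cat ?N1
  ?N2 // cats0.
rewrite (lead_rot homH) // -nbands_cat (IHk _ (ltnW km)).
- rewrite !size_cat /= addnS subSS.
  have -> : (size J1 + size J2).+1%:Z = (size J1 + size J2)%N%:Z + 1 by lia.
  by rewrite binomial_coef_shift.
- by rewrite all_cat J1k.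
- by rewrite map_cat uniq_catC.
Qed.

Definition nc_word (w : 'S_m.+1) : braid m :=
  flatten [seq (if insub (x, w x) is Some t then dual_lift (t : transp m) else
    [::])
          | x <- enum 'I_m.+1].

Lemma cls_nc_word w : cls (nc_word w) = nc_lift (gen m) w.
Proof.
rewrite /nc_word /nc_lift; elim: (enum _) => [|x s IHs] /=;
  first by rewrite big_nil.
rewrite big_cons -IHs cls_cat; congr (_ * _)%g; rewrite /letter.
case: insubP => [t xw tE|/negPf xw]; rewrite /= in xw; rewrite xw //.
by rewrite cls_dual_lift tE.
Qed.

Definition nc_pairs (w : 'S_m.+1) : seq ('I_m.+1 * 'I_m.+1) :=
  [seq (x, w x) | x : 'I_m.+1 <- enum 'I_m.+1 & (x < w x)%N].

Lemma natw_nc_word w : natw (nc_word w) =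
  nbands [seq (nat_of_ord p.1, nat_of_ord p.2) | p <- nc_pairs w].
Proof.
rewrite /nc_word /nc_pairs /nbands; elim: (enum _) => //= x s IHs.
rewrite natw_cat IHs; case: insubP => [t xw tE|/negPf xw]; rewrite /= in xw;
  rewrite xw //.
by rewrite natw_dual_lift tE.
Qed.

Lemma blead_nc_word w :
  blead (nc_word w) =1 binomial_coef (m - size (nc_pairs w)) (size (nc_pairs
    w))%:Z.
Proof.
move=> x; rewrite /blead natw_nc_word lead_bands ?size_map //.
  apply/allP => _ /mapP[p + ->]; rewrite /nc_pairs => /mapP[y];
    rewrite mem_filter => /andP[yw _] -> /=.
  by rewrite yw -ltnS ltn_ord.
rewrite -map_comp map_inj_in_uniq.
  rewrite /nc_pairs map_inj_uniq; last by move=> y z [].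
  exact: filter_uniq (enum_uniq _).
move=> p q /mapP[y _ ->] /mapP[z _ ->] /= /ord_inj/perm_inj -> //.
Qed.

End Evaluation.

Local Close Scope ring_scope.

Local Open Scope ring_scope.

(** * Sums over subwords *)

Fixpoint sublists (T : Type) (s : seq T) : seq (seq T) :=
  if s is x :: s' then map (cons x) (sublists s') ++ sublists s' else [:: [::]].

Lemma big_sublists_cat (T : Type) (V : nmodType) (a b : seq T) (F : seq T ->
  V) :
  \sum_(s <- sublists (a ++ b)) F s =
  \sum_(s1 <- sublists a) \sum_(s2 <- sublists b) F (s1 ++ s2).
Proof.
elim: a F => [|x a IHa] F /=; first by rewrite big_seq1.
rewrite !big_cat !big_map /=; congr (_ + _); last exact: IHa.
exact: (IHa (fun s => F (x :: s))).
Qed.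

Lemma big_sublists_rcons (T : Type) (V : nmodType) (a : seq T) x (F : seq T ->
  V) :
  \sum_(s <- sublists (rcons a x)) F s =
  \sum_(s <- sublists a) F s + \sum_(s <- sublists a) F (rcons s x).
Proof.
rewrite -cats1 big_sublists_cat -big_split /=; apply: eq_bigr => s _.
by rewrite big_cons big_seq1 cats0 cats1 addrC.
Qed.

Lemma sublists_map (T U : Type) (f : T -> U) s :
  sublists (map f s) = map (map f) (sublists s).
Proof.
elim: s => //= x s ->; rewrite map_cat -!map_comp; congr (_ ++ _).
Qed.

Lemma big_sublists_rev (T : Type) (V : nmodType) (a : seq T) (F : seq T -> V) :
  \sum_(s <- sublists (rev a)) F s = \sum_(s <- sublists a) F (rev s).
Proof.
elim: a F => [|x a IHa] F /=; first by rewrite !big_seq1.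
rewrite rev_cons big_sublists_rcons !IHa big_cat big_map addrC; congr (_ + _).
by apply: eq_bigr => s _; rewrite rev_cons.
Qed.

Lemma mem_sublists (T : eqType) (s r : seq T) : (r \in sublists s) = subseq r s.
Proof.
elim: s r => [|x s IHs] r /=; first by rewrite inE; case: r.
rewrite mem_cat IHs; case: r => [|y r]; first by rewrite sub0seq orbT.
case: (eqVneq y x) => [->|yx].
  rewrite mem_map ?IHs; last by move=> ? ? [].
  apply/orb_idr => /(subseq_trans (subseq_cons r x)) //.
rewrite orb_idl //; case/mapP=> r' _ [yx' _]; by rewrite yx' eqxx in yx.
Qed.

Lemma sum_sublists_eq (T : eqType) (s r : seq T) : uniq s ->
  (\sum_(s' <- sublists s) (s' == r)%:R : int) = (subseq r s)%:R.
Proof.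
elim: s r => [|x s IHs] r /=; first by rewrite big_seq1; case: r.
case/andP=> xs us; rewrite big_cat big_map /= IHs //.
case: r => [|y r].
  by rewrite big1 ?sub0seq ?add0r.
case: (eqVneq y x) => [->|yx].
  rewrite (_ : subseq (x :: r) s = false) ?addr0; last first.
    by apply/negP => /mem_subseq/(_ x); rewrite mem_head (negPf xs) => /(_ isT).
  by rewrite -IHs //; apply: eq_bigr => s' _; rewrite eqseq_cons eqxx.
by rewrite big1 ?add0r // => s' _; rewrite eqseq_cons eq_sym (negPf yx).
Qed.

Lemma enum_setE (T : finType) (A : {set T}) :
  enum A = [seq x <- enum T | x \in A].
Proof. by rewrite [LHS]/enum_mem -enumT. Qed.

(** Sets of positions are split by whether they contain 0; [up] and [dn] translate between sets of
    positions in the tail and sets avoiding 0. *)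
Lemma sum_sets_sublists (T : Type) (x0 : T) (V : nmodType) (a : seq T) (F : seq
  T -> V) :
  \sum_(I : {set 'I_(size a)}) F [seq nth x0 a (val i) | i <- enum I] =
  \sum_(s <- sublists a) F s.
Proof.
elim: a F => [|x a IHa] F /=.
  rewrite big_seq1 (big_pred1 set0) => [|I]; first by rewrite enum_set0.
  by rewrite /= eq_sym; apply/esym/eqP/setP => -[].
rewrite big_cat big_map /= -!IHa (bigID (fun I : {set _} => ord0 \in I)) /=.
pose up (J : {set 'I_(size a)}) : {set 'I_(size a).+1} := lift ord0 @: J.
pose dn (I : {set 'I_(size a).+1}) : {set 'I_(size a)} := lift ord0 @^-1: I.
have upK : cancel up dn.
  by move=> J; apply/setP => i; rewrite inE mem_imset //; apply: lift_inj.
have z J : ord0 \notin up J.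
  by apply/imsetP => -[i _ /(congr1 val)].
have enumS (I : {set 'I_(size a).+1}) : enum I =
    [seq i <- [:: ord0] | i \in I] ++ [seq lift ord0 i | i <- enum (dn I)].
  rewrite !enum_setE enum_ordSl /= filter_map.
  have -> : [seq i <- enum 'I_(size a) | preim (lift ord0) (fun i =>
    i \in I) i] =
      [seq i <- enum 'I_(size a) | i \in dn I].
    by apply: eq_filter => i; rewrite /= inE.
  by case: ifP.
have dnup I : up (dn I) = I :\ ord0.
  apply/setP => i; rewrite !inE; case: (unliftP ord0 i) => [j ->|->].
    by rewrite mem_imset; [rewrite inE | apply: lift_inj].
  by rewrite eqxx (negPf (z _)).
congr (_ + _).
  rewrite (reindex_onto (fun J => ord0 |: up J) dn) /= => [|I I0]; last first.
    by rewrite dnup setD1K.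
  apply: eq_big => [J|J _].
    rewrite setU11 /=; apply/eqP; rewrite -[RHS]upK; apply/setP => i.
    by rewrite !inE.
  rewrite enumS /= setU11 /= -map_comp; congr (F (_ :: _)).
  have -> : dn (ord0 |: up J) = J by rewrite -[RHS]upK; apply/setP => i;
    rewrite !inE.
  by apply: eq_map => i /=.
rewrite (reindex_onto up dn) /= => [|I I0]; last first.
  by rewrite dnup; apply/setP => i; rewrite !inE; case: eqP => // ->;
    rewrite (negPf I0).
apply: eq_big => [J|J _]; first by rewrite upK eqxx andbT z.
rewrite enumS /= (negPf (z J)) /= upK -map_comp.
by congr F; apply: eq_map => i /=.
Qed.

Lemma sub_T_sublists m eta (a : seq 'S_m.+1) w : size eta = size a ->
  sub_T eta a w = \sum_(s <- sublists (zip a eta))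
    (if (size s == ellT w) && (permprod (unzip1 s) == w)
     then \prod_(x <- s) sgn x.2 else 0).
Proof.
move=> sz; have sz' : size (zip a eta) = size a by rewrite size1_zip ?sz.
rewrite -(sum_sets_sublists (1%g, true)) /sub_T sz' big_mkcond /=.
apply: eq_bigr => I _; rewrite size_map -cardE.
have -> : unzip1 [seq nth (1%g, true) (zip a eta) (val i) | i <- enum I] =
    [seq nth 1%g a (val i) | i <- enum I].
  by rewrite /unzip1 -map_comp; apply: eq_map => i /=; rewrite nth_zip.
case: ifP => // _; rewrite big_map big_enum /=.
by apply: eq_bigr => i _; rewrite nth_zip.
Qed.

(** * Expansion of the leading coefficient *)

Definition tprod m (s : seq (transp m * bool)) : 'S_m.+1 :=
  permprod [seq tperm_of x.1 | x <- s].

Definition esgn (T : Type) (s : seq (T * bool)) : int := \prod_(x <- s) sgn x.2.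

Lemma esgn_rcons T s (x : T * bool) : esgn (rcons s x) = esgn s * sgn x.2.
Proof. by rewrite /esgn -cats1 big_cat big_seq1. Qed.

Lemma tprod_rcons m s (x : transp m * bool) :
  tprod (rcons s x) = permmul (tprod s) (tperm_of x.1).
Proof. by rewrite /tprod map_rcons -cats1 permprod_cat /= permmul1. Qed.

Lemma cyc_tprod_le m s (w : 'S_m.+1) :
  (cyc (permmul (@tprod m s) w) <= cyc w + size s)%N.
Proof.
elim: s => [|x s IHs]; first by rewrite /tprod /= permmul1l addn0.
rewrite /tprod /= -permmulA addnS; apply: leq_trans (cyc_tperm_ge _ _ _) _.
by rewrite ltnS.
Qed.

Definition exc m (w : 'S_m.+1) : nat := #|[set x : 'I_m.+1 | x < w x]|%N.

Lemma size_nc_pairs m (w : 'S_m.+1) : size (nc_pairs w) = exc w.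
Proof.
rewrite /nc_pairs size_map /exc cardE enum_setE; congr (size _).
by apply: eq_filter => x; rewrite inE.
Qed.

(** Only the arc from [j0] is lost, as [v] sends [j0] to i <= j0. The other changed point [i0] is
    below i or at least j, so it starts an arc for the target i exactly when it does for j. *)
Lemma exc_step m (w : 'S_m.+1) (i j : 'I_m.+1) : noncrossing w -> (i < j)%N ->
  j \in porbit w i -> exc w = (exc (permmul (tperm i j) w)).+1.
Proof.
move=> ncw ij ji; set v := permmul _ w.
have /andP[ij0 j0j] := step_j0 ncw ij ji; have i0P := step_i0 ncw ji.
set j0 := (w^-1)%g j in ij0 j0j; set i0 := (w^-1)%g i in i0P.
rewrite /exc (cardsD1 j0) inE (step_wj0 w j) j0j add1n; congr (_.+1).
congr #|pred_of_set _|; apply/setP => x; rewrite !inE.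
have [->|xj0] := eqVneq x j0; first by rewrite /v step_vj0 [RHS]ltnNge ij0.
have [->|xi0] := eqVneq x i0; last by rewrite /v step_v.
by rewrite /v step_vi0 step_wi0; move: i0P; case: ltnP => /=; lia.
Qed.

Lemma binomial_coefE (s : nat) (e x : int) :
  binomial_coef s e x = \sum_(l < s.+1) (-1) ^+ l * 'C(s,
    l)%:R * (x == e + s%:Z - l%:Z *+ 2)%:R.
Proof.
elim: s x => [|s IHs] x /=.
  by rewrite big_ord_recl big_ord0 /= bin0 !mul1r addr0;
    congr (nat_of_bool _)%:R; lia.
rewrite !IHs; set t := fun (l : nat) (n : nat) => (-1) ^+ l * n%:R * (x == e +
  s.+1%:Z - l%:Z *+ 2)%:R : int.
pose c' (l : nat) := if l is l'.+1 then 'C(s, l') else 0%N.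
have -> : \sum_(l < s.+2) (-1) ^+ l * 'C(s.+1, l)%:R * (x == e + s.+1%:Z - l%:Z
  *+ 2)%:R = \sum_(l < s.+2) t l 'C(s, l) + \sum_(l < s.+2) t l (c' l).
  rewrite -big_split; apply: eq_bigr => -[[|l] ls] _ /=;
    rewrite /t /c' ?bin0 /= ?mulr0 ?mul0r ?addr0 //.
  by rewrite binS natrD mulrDr mulrDl.
have tz l : t l 0%N = 0 by rewrite /t mulr0 mul0r.
rewrite [X in _ = X + _]big_ord_recr [X in _ =
  _ + X]big_ord_recl /= bin_small // !tz addr0 add0r.
congr (_ + _); first by apply: eq_bigr => l _; rewrite /t;
  congr (_ * (nat_of_bool _)%:R); lia.
rewrite -sumrN; apply: eq_bigr => l _; rewrite /t /bump /= add1n exprS mulN1r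
  !mulNr.
by congr (- (_ * (nat_of_bool _)%:R)); lia.
Qed.

Section Expansion.
Variables (H : seq slice -> laurent_az) (homH : is_HOMFLYPT H) (m : nat).
Implicit Types w : 'S_m.+1.
Implicit Types ts s : seq (transp m * bool).
Notation blead := (@blead H m).

Definition pure_word ts : braid m := flatten [seq pure_PP x.1 x.2 | x <- ts].

Lemma braid_perm_pure_word ts : braid_perm (pure_word ts) = 1%g.
Proof.
elim: ts => // x ts IHts; rewrite -[pure_word _]/(pure_PP x.1 x.2 ++ pure_word
  ts).
by rewrite braid_perm_cat IHts braid_perm_pure // permmul1.
Qed.

(** Both conditions are carried from c through each splitting, which replaces a direct computation
    of the product of the arcs. *)
Definition lifted w : Prop := noncrossing w /\ braid_perm (nc_word w) = w.

Lemma cls_nc_step w (t : transp m) : noncrossing w ->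
  (val t).2 \in porbit w (val t).1 ->
  cls (braid_inv (dual_lift t) ++ nc_word w) =
    cls (nc_word (permmul (tperm_of t) w)).
Proof.
move=> ncw ji; have ij : ((val t).1 < (val t).2)%N := valP t.
rewrite cls_cat cls_inv cls_dual_lift !cls_nc_word.
rewrite (nc_lift_step (@gen_far m) (@gen_near m) ncw ij ji).
by rewrite mulKg.
Qed.

Lemma lifted_step w (t : transp m) : lifted w ->
  (val t).2 \in porbit w (val t).1 -> lifted (permmul (tperm_of t) w).
Proof.
case=> ncw pw ji; have ij : ((val t).1 < (val t).2)%N := valP t.
split; first exact: step_noncrossing.
rewrite -(braid_perm_cls (cls_nc_step ncw ji)) braid_perm_cat pw.
congr permmul; have := braid_eq_perm (braid_eq_invl (dual_lift t)).
rewrite braid_perm_cat braid_perm_dual_lift => inv1.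
by apply: (mulgI (tperm_of t)); rewrite tperm2; apply: inv1.
Qed.

Lemma transp_neq (t : transp m) : (val t).1 != (val t).2.
Proof. by have := valP t; rewrite -val_eqE neq_ltn /= => ->. Qed.

Lemma cyc_transp w (t : transp m) :
  if (val t).2 \in porbit w (val t).1
  then cyc (permmul (tperm_of t) w) = (cyc w).+1
  else (cyc (permmul (tperm_of t) w)).+1 = cyc w.
Proof.
rewrite cyc_tperml porbit_sym; case: ifP => [tw|/negbT tw].
  by rewrite cyc_tperm_split // transp_neq.
by rewrite cyc_tperm_merge.
Qed.

(** Equality in [cyc_tprod_le]: the transpositions of [s], applied to [w] from the last to the
    first, each split a cycle. *)
Definition good w s : bool := cyc (permmul (tprod s) w) == (cyc w + size s)%N.

Lemma good_rcons w s x : good w (rcons s x) =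
  ((val x.1).2 \in porbit w (val x.1).1) && good (permmul (tperm_of x.1) w) s.
Proof.
rewrite /good tprod_rcons size_rcons -permmulA.
have := cyc_transp w x.1; case: ifP => _ cE; first by rewrite cE addnS addSn.
have := cyc_tprod_le s (permmul (tperm_of x.1) w).
by apply: contraTF => /eqP ->; rewrite -cE; lia.
Qed.

Lemma good_lifted w s : lifted w -> good w s ->
  lifted (permmul (tprod s) w) /\ exc w = (exc (permmul (tprod s) w) + size
    s)%N.
Proof.
elim/last_ind: s w => [|s x IHs] w lw; first by rewrite /tprod /= permmul1l
  addn0.
rewrite good_rcons => /andP[ji gs].
have [lv eE] := IHs _ (lifted_step lw ji) gs.
rewrite tprod_rcons size_rcons -permmulA; split=> //.
by rewrite addnS -eE; apply: exc_step => //; [case: lw | exact: (valP x.1)].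
Qed.

(** The last pure factor is next to [nc_word w]. If its t splits a cycle, the smoothed term has t^-1
    in front of [nc_word w], and [cls_nc_step] turns this into the word of t w. If t merges two
    cycles, neither that term nor the subwords ending in t contribute. *)
Lemma blead_expand ts w x : lifted w ->
  blead (pure_word ts ++ nc_word w) x = \sum_(s <- sublists ts)
    (if good w s then esgn s *
       binomial_coef (m - (exc w - size s)) (exc w - size s)%N%:Z x else 0).
Proof.
elim/last_ind: ts w => [|ts [t e] IHts] w lw.
  rewrite /= big_seq1 /good /tprod /= permmul1l addn0 eqxx /esgn big_nil mul1r
    subn0.
  by rewrite (blead_nc_word homH) size_nc_pairs.
have -> : pure_word (rcons ts (t, e)) = pure_word ts ++ pure_PP t e.
  by rewrite /pure_word map_rcons flatten_rcons.
rewrite -catA (blead_pure homH) big_sublists_rcons IHts //; congr (_ + _).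
rewrite !braid_perm_cat braid_perm_pure_word // !permmul1l braid_perm_dual_lift.
case: (lw) => ncw ->; have := cyc_transp w t; case: ifP => ji cE; last first.
  rewrite ifF; last by apply/negbTE; rewrite -cE; lia.
  by rewrite mulr0 big1 // => s _; rewrite good_rcons ji.
rewrite cE ltnSn.
rewrite (_ : blead _ x = blead (pure_word ts ++ nc_word (permmul (tperm_of t)
  w)) x); last first.
  by apply: (blead_cls homH); rewrite cls_cat cls_nc_step // -cls_cat.
rewrite IHts; last exact: lifted_step.
rewrite big_distrr /=; apply: eq_bigr => s _; rewrite good_rcons ji /=.
case: ifP => _; last by rewrite mulr0.
rewrite esgn_rcons size_rcons (exc_step ncw (valP t) ji) subSS.
by rewrite mulrA (mulrC (sgn e)).
Qed.

Lemma cyc_cox : cyc (cox m) = 1%N.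
Proof.
have all0 k (km : (k <= m)%N) : (inord k : 'I_m.+1) \in porbit (cox m) ord0.
  elim: k km => [|k IHk] km.
    by rewrite (_ : inord 0 = ord0) ?porbit_id //; apply: ord_inj;
      rewrite inordK.
  have -> : inord k.+1 = cox m (inord k).
    apply: ord_inj; rewrite permE /= !inordK ?modn_small //; lia.
  by apply/mem_porbit_step/IHk/ltnW.
rewrite /cyc -(cards1 (porbit (cox m) ord0)); congr #|pred_of_set _|.
apply/setP => A; rewrite inE; apply/imsetP/eqP => [[x _ ->]|->];
  last by exists ord0.
apply/eqP; rewrite eq_porbit_mem -[x]inord_val; apply: all0.
by rewrite -ltnS ltn_ord.
Qed.

Lemma exc_cox : exc (cox m) = m.
Proof.
rewrite /exc -[RHS]/(m.+1.-1) -[in RHS](card_ord m.+1) -(cardsC1 (ord_max :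
  'I_m.+1)).
congr #|pred_of_set _|; apply/setP => x; rewrite !inE permE /= -val_eqE /=.
have := ltn_ord x; rewrite ltnS leq_eqVlt => /predU1P[->|xm].
  by rewrite modnn eqxx.
by rewrite modn_small // ltnSn (ltn_eqF xm).
Qed.

Lemma lifted_cox : lifted (cox m).
Proof.
split; first exact: cox_noncrossing.
have -> : braid_perm (nc_word (cox m)) = braid_perm (braid_cox m).
  by apply: braid_perm_cls; rewrite cls_nc_word cls_cox.
rewrite coxE -val_enum_ord -map_comp /braid_perm /braid_cox /posbraid -map_comp.
by [].
Qed.

Lemma good_size s : good (cox m) s -> (size s <= m)%N.
Proof.
rewrite /good cyc_cox => /eqP gs; have := cyc_le (permmul (tprod s) (cox m)).
by rewrite gs; lia.
Qed.

Theorem blead_formula (beta gb : braid m) ts x :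
  braid_eq (gb ++ beta ++ braid_inv gb ++ braid_inv (braid_cox m)) (pure_word
    ts) ->
  blead beta x = \sum_(s <- sublists ts)
    (if good (cox m) s then esgn s * binomial_coef (size s) (m - size s)%N%:Z x
      else 0).
Proof.
move=> eqb.
have -> : blead beta x = blead (gb ++ beta ++ braid_inv gb) x.
  rewrite (blead_rot homH); apply: (blead_cls homH); rewrite !cls_cat cls_inv.
  by rewrite mulgKV.
have -> : blead (gb ++ beta ++ braid_inv gb) x =
  blead (pure_word ts ++ nc_word (cox m)) x.
  apply: (blead_cls homH); move/clsP: eqb; rewrite !cls_cat !cls_inv
    cls_nc_word -cls_cox => <-.
  by rewrite !mulgA mulgKV.
rewrite blead_expand ?exc_cox; last exact: lifted_cox.
by apply: eq_bigr => s _; case: ifP => // /good_size sm; rewrite subKn.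
Qed.

End Expansion.

Local Close Scope ring_scope.

(** * Inversions *)

Section Inversions.
Variable m : nat.
Implicit Types u v : 'S_m.+1.

Definition inversions u : {set 'I_m.+1 * 'I_m.+1} :=
  [set p : 'I_m.+1 * 'I_m.+1 | (p.1 < p.2) && (u p.2 < u p.1)].

(** The map [phi] applies the transposition to a pair when this keeps its order, and fixes the pair
    otherwise. It sends the inversions of [v] injectively to inversions of [u], missing (p, q). *)
Lemma ell_swap u (p q : 'I_m.+1) : p < q -> u q < u p ->
  ell (permmul u (tperm p q)) < ell u.
Proof.
move=> pq uqp; pose t := tperm p q; set v := permmul u t.
have vE x : v x = u (t x) by rewrite permmulE.
have tK x : t (t x) = x by rewrite /t tpermK.
pose phi (a : 'I_m.+1 * 'I_m.+1) := if t a.1 < t a.2 then (t a.1, t a.2) else a.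
have phi_inj : {in inversions v &, injective phi}.
  move=> [x y] [x' y']; rewrite !inE /phi /= => /andP[xy _] /andP[xy' _].
  case: ifP => txy; case: ifP => txy' // [] e1 e2.
  - by rewrite (perm_inj e1) (perm_inj e2).
  - by move: txy'; rewrite -e1 -e2 !tK xy.
  - by move: txy; rewrite e1 e2 !tK xy'.
rewrite [X in X < _](_ : _ = #|phi @: inversions v|);
  last by rewrite card_in_imset.
rewrite [X in _ < X](_ : _ = #|inversions u|) // (cardsD1 (p,
  q) (inversions u)).
rewrite inE /= pq uqp add1n ltnS; apply/subset_leq_card/subsetP =>
  _ /imsetP[[x y] + ->].
rewrite !inE /phi /= !vE => /andP[xy txy]; case: ifP => /= lt_t.
  rewrite lt_t txy xpair_eqE negb_and !andbT orbC -implybE;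
    apply/implyP => /eqP tyq.
  apply/eqP => txp; have := xy; rewrite -(tK x) -(tK y) txp tyq /t tpermL
    tpermR.
  by lia.
rewrite xy /= xpair_eqE; move: lt_t txy; rewrite /t.
have dif (a b : 'I_m.+1) : a <> b -> a != b :> nat by move=> /eqP;
  rewrite -val_eqE.
case: (tpermP p q x) => [xp|xq|/dif xp /dif xq];
  case: (tpermP p q y) => [yp|yq|/dif yp /dif yq];
  rewrite -?val_eqE /=; try subst x; try subst y; rewrite ?eqxx /=; lia.
Qed.

Lemma ell_swapE u (p q : 'I_m.+1) : p < q ->
  (ell (permmul u (tperm p q)) < ell u) = (u q < u p).
Proof.
move=> pq; apply/idP/idP; last exact: ell_swap.
apply: contraTT; rewrite -!leqNgt leq_eqVlt => /predU1P[/val_inj/perm_inj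
  e|lt_u].
  by move: pq; rewrite e ltnn.
have := @ell_swap (permmul u (tperm p q)) p q pq.
have -> : permmul (permmul u (tperm p q)) (tperm p q) = u.
  by rewrite /permmul mulgA tperm2 mul1g.
rewrite !permmulE tpermL tpermR => /(_ lt_u).
exact: ltnW.
Qed.

Lemma simple_lt i : i < m -> (inord i : 'I_m.+1) < (inord i.+1 : 'I_m.+1).
Proof. by move=> im; rewrite !inordK //; lia. Qed.

Lemma ell_simpleE u i : i < m ->
  (ell (permmul u (simple m i)) < ell u) = (u (inord i.+1) < u (inord i)).
Proof. by move=> /simple_lt/ell_swapE. Qed.

Lemma ell_simple_le u i : i < m -> ell (permmul u (simple m i)) <= (ell u).+1.
Proof.
move=> im; set t := simple m i; set p : 'I_m.+1 := inord i;
  set q : 'I_m.+1 := inord i.+1.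
have vp : p = i :> nat by rewrite inordK //; lia.
have vq : q = i.+1 :> nat by rewrite inordK //; lia.
rewrite [X in X <= _](_ : _ = #|inversions (permmul u t)|) //.
rewrite [X in _ <= X.+1](_ : _ = #|inversions u|) //.
rewrite (cardsD1 (p, q)) -[X in _ <= X]add1n; apply: leq_add (leq_b1 _) _.
pose phi (a : 'I_m.+1 * 'I_m.+1) := (t a.1, t a.2).
have phi_inj : injective phi by move=> [x y] [x' y'] [] /perm_inj ->
  /perm_inj ->.
rewrite -(card_imset _ phi_inj); apply/subset_leq_card/subsetP =>
  _ /imsetP[[x y] + ->].
rewrite !inE /phi /= !permmulE xpair_eqE => /and3P[npq xy ->]; rewrite andbT.
have dif (a b : 'I_m.+1) : a <> b -> a != b :> nat by move=> /eqP;
  rewrite -val_eqE.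
move: npq xy; rewrite /t /simple -/p -/q.
case: (tpermP p q x) => [->|->|/dif xp /dif xq];
  case: (tpermP p q y) => [->|->|/dif yp /dif yq];
  rewrite -?val_eqE /= ?eqxx /=; lia.
Qed.

Lemma ell1 : ell (1%g : 'S_m.+1) = 0.
Proof.
apply/eqP; rewrite cards_eq0; apply/eqP/setP => -[x y]; rewrite !inE /= !perm1.
by case: ltngtP.
Qed.

Lemma wprod_cat w1 w2 : wprod m (w1 ++ w2) = permmul (wprod m w1) (wprod m w2).
Proof. by rewrite /wprod map_cat permprod_cat. Qed.

Lemma wprod_rcons w i : wprod m (rcons w i) = permmul (wprod m w) (simple m i).
Proof. by rewrite -cats1 wprod_cat /wprod /= permmul1. Qed.

Lemma ell_wprod_cat_le u w : all (fun i => i < m) w ->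
  ell (permmul u (wprod m w)) <= ell u + size w.
Proof.
elim/last_ind: w => [|w i IHw]; first by rewrite permmul1 addn0.
rewrite all_rcons => /andP[im wm]; rewrite wprod_rcons permmulA size_rcons
  addnS.
by apply: leq_trans (ell_simple_le _ im) _; rewrite ltnS IHw.
Qed.

(** Were the letter i a descent, reading it would shorten the prefix, and [w2] could not make up for
    the loss. *)
Lemma reduced_no_descent w1 i w2 : all (fun j => j < m) (w1 ++ i :: w2) ->
  size (w1 ++ i :: w2) = ell (wprod m (w1 ++ i :: w2)) ->
  wprod m w1 (inord i) < wprod m w1 (inord i.+1).
Proof.
rewrite all_cat /= => /and3P[w1m im w2m] sz.
have ne : wprod m w1 (inord i) != wprod m w1 (inord i.+1).
  by apply/eqP => /perm_inj e; have := simple_lt im; rewrite e ltnn.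
rewrite ltn_neqAle val_eqE ne leqNgt -(ell_simpleE _ im); apply/negP => desc.
have := ell_wprod_cat_le (wprod m (rcons w1 i)) w2m.
rewrite -wprod_cat cat_rcons -sz size_cat /= wprod_rcons.
have := ell_wprod_cat_le 1%g w1m; rewrite permmul1l ell1; lia.
Qed.

Lemma mem_Invs u (i j : 'I_m.+1) : i < j ->
  (tperm i j \in Invs u) = ((u^-1)%g j < (u^-1)%g i).
Proof.
move=> ij; rewrite inE.
have -> : tperm i j \in transps m by apply/imsetP; exists (i, j); rewrite ?inE.
have -> : permmul (tperm i j) u = permmul u (tperm ((u^-1)%g i) ((u^-1)%g j)).
  by rewrite /permmul -tpermJ conjgE invgK !mulgA mulgKV.
case: (ltngtP ((u^-1)%g i) ((u^-1)%g j)) => [lt_ij|lt_ji|/val_inj/perm_inj e].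
- by rewrite ell_swapE // !permKV /= ltnNge (ltnW ij).
- by rewrite tpermC ell_swapE // !permKV /= ij.
- by move: ij; rewrite e ltnn.
Qed.

Lemma mem_Des u (i : 'I_m) : (i \in Des u) = (u (inord i.+1) < u (inord i)).
Proof. by rewrite inE ell_simpleE. Qed.

Lemma card_Invs_pairs u :
  #|[set p : 'I_m.+1 * 'I_m.+1 | (p.1 < p.2) && ((u^-1)%g p.2 < (u^-1)%g p.1)]|
    = ell u.
Proof.
rewrite [RHS](_ : _ = #|inversions u|) //.
pose phi (a : 'I_m.+1 * 'I_m.+1) := (u a.2, u a.1).
have phi_inj : injective phi by move=> [x y] [x' y'] [] /perm_inj ->
  /perm_inj ->.
rewrite -(card_imset (inversions u) phi_inj); congr #|pred_of_set _|.
apply/setP => -[x y]; rewrite inE /=; apply/andP/imsetP => [[xy uxy]|[[a b]]].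
  exists ((u^-1)%g y, (u^-1)%g x); last by rewrite /phi /= !permKV.
  by rewrite inE /= !permKV uxy.
by rewrite inE /= => /andP[ab uab] [-> ->]; rewrite !permK.
Qed.

(** * The c-sorting word of the longest element *)

Definition cword_rounds (r : nat) : seq nat := flatten [seq iota 0 (m - q) | q
  <- iota 0 r].

(* The q-th round uses the letters 0, ..., m - q - 1, at the positions q * m + i
   of the infinite word ccc... *)
Definition cpositions (r : nat) (n : nat) : seq nat :=
  flatten [seq iota (q * m) (m - q) | q <- iota r n].

Lemma cword_roundsS r : cword_rounds r.+1 = cword_rounds r ++ iota 0 (m - r).
Proof. by rewrite /cword_rounds -addn1 iotaD map_cat flatten_cat /= cats0. Qed.

(* The one-line notation of the product of the first r rounds and of the letters
   0, ..., x - 1. *)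
Definition cword_value (r x y : nat) : nat :=
  if y < x then r + y.+1 else if y == x then r else if y <= m - r then r + y
    else m - y.

Lemma ell_ascent u i : i < m -> u (inord i) < u (inord i.+1) ->
  ell (permmul u (simple m i)) = (ell u).+1.
Proof.
move=> im asc; apply/eqP; rewrite eqn_leq ell_simple_le //=.
have := @ell_simpleE (permmul u (simple m i)) i im.
have -> : permmul (permmul u (simple m i)) (simple m i) = u.
  by rewrite /permmul mulgA tperm2 mul1g.
by rewrite !permmulE tpermL tpermR asc.
Qed.

Lemma cword_value0 y : y <= m -> cword_value 0 0 y = y.
Proof. by rewrite /cword_value; do ?case: ifP; lia. Qed.

Lemma cword_value_next r y : r < m -> y <= m ->
  cword_value r (m - r) y = cword_value r.+1 0 y.
Proof. by rewrite /cword_value; do ?case: ifP; lia. Qed.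

Definition cword_prefix_ok r x : Prop :=
  (forall y : 'I_m.+1,
     wprod m (cword_rounds r ++ iota 0 x) y = cword_value r x y :> nat) /\
  ell (wprod m (cword_rounds r ++ iota 0 x)) =
    size (cword_rounds r ++ iota 0 x).

Lemma cword_prefix_round r x : r < m -> cword_prefix_ok r 0 ->
  x <= m - r -> cword_prefix_ok r x.
Proof.
move=> rm ok0; elim: x => // x IHx xm; have [vE sE] := IHx (ltnW xm).
have x1m : x < m by lia.
have vI l : l <= m -> (inord l : 'I_m.+1) = l :> nat by exact: inordK.
have wE : cword_rounds r ++ iota 0 x.+1 = rcons (cword_rounds r ++ iota 0 x) x.
  by rewrite -cats1 -catA -addn1 iotaD.
rewrite /cword_prefix_ok wE wprod_rcons size_rcons -sE; split.
  move=> y; rewrite permmulE /simple; case: tpermP => [->|->|yx yx1].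
  - by rewrite vE !vI //; [rewrite /cword_value; do ?case: ifP; lia | lia].
  - by rewrite vE !vI //; [rewrite /cword_value; do ?case: ifP; lia | lia].
  - have {}yx : y != x :> nat by apply/eqP => e; apply: yx; apply: ord_inj;
      rewrite vI // ltnW.
    have {}yx1 : y != x.+1 :> nat by apply/eqP => e; apply: yx1;
      apply: ord_inj; rewrite vI.
    by rewrite vE; rewrite /cword_value; do ?case: ifP; lia.
apply: ell_ascent => //; rewrite !vE !vI //; last by lia.
by rewrite /cword_value; do ?case: ifP; lia.
Qed.

Lemma cword_prefix0 r : r <= m -> cword_prefix_ok r 0.
Proof.
elim: r => [|r IHr] rm.
  by split=> [y|]; rewrite /= ?perm1 ?ell1 // cword_value0 // -ltnS.
have [vE sE] := cword_prefix_round rm (IHr (ltnW rm)) (leqnn (m - r)).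
rewrite /cword_prefix_ok cats0 cword_roundsS; split=> // y.
by rewrite vE cword_value_next // -ltnS.
Qed.

Lemma cword_prefix r x : r < m -> x <= m - r -> cword_prefix_ok r x.
Proof. by move=> rm; apply: cword_prefix_round rm (cword_prefix0 (ltnW rm)).
  Qed.

Lemma wprod_cword : wprod m (cword_rounds m) = wlong m.
Proof.
have [vE _] := cword_prefix0 (leqnn m); apply/permP => y; apply: ord_inj.
rewrite -[cword_rounds m]cats0 vE permE /= /cword_value subnn subSS.
by have := ltn_ord y; do ?case: ifP; lia.
Qed.

Lemma ell_cword : size (cword_rounds m) = ell (wlong m).
Proof. by have [_] := cword_prefix0 (leqnn m); rewrite cats0 wprod_cword. Qed.

Lemma all_cword r : all (fun i => i < m) (cword_rounds r).
Proof.
apply/allP => i /flatten_mapP[q _]; rewrite mem_iota add0n /=; lia.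
Qed.

Lemma cpositionsS r n : cpositions r n.+1 = iota (r * m) (m - r) ++ cpositions
  r.+1 n.
Proof. by []. Qed.

Lemma cpositions_rcons r n :
  cpositions r n.+1 = cpositions r n ++ iota ((r + n) * m) (m - (r + n)).
Proof. by rewrite /cpositions -addn1 iotaD map_cat flatten_cat /= cats0. Qed.

Lemma subword_cpositions n : subword_at m (cpositions 0 n) = cword_rounds n.
Proof.
elim: n => // n IHn; rewrite cpositions_rcons cword_roundsS -IHn /subword_at
  map_cat.
congr (_ ++ _); rewrite -(addn0 ((0 + n) * m)) iotaDl -map_comp -[RHS]map_id.
apply/eq_in_map => i; rewrite mem_iota /= add0n => im.
by rewrite modnMDl modn_small //; lia.
Qed.

Lemma sorted_cpositions r n : sorted ltn (cpositions r n) /\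
  all (fun p => r * m <= p) (cpositions r n).
Proof.
elim: n r => [|n IHn] r //; rewrite cpositionsS; have [so al] := IHn r.+1.
split; last first.
  rewrite all_cat; apply/andP; split; apply/allP => p.
    by rewrite mem_iota => /andP[].
  by move=> /(allP al); rewrite mulSn; lia.
rewrite (sorted_pairwise ltn_trans) pairwise_cat -!(sorted_pairwise ltn_trans).
rewrite so iota_ltn_sorted !andbT; apply/allrelP => p q.
rewrite mem_iota => /andP[_ pm] /(allP al); rewrite mulSn; lia.
Qed.

Lemma wlong_cpositions : wlong_positions m (cpositions 0 m).
Proof.
rewrite /wlong_positions (sorted_cpositions 0 m).1 /reduced_word
  subword_cpositions.
by rewrite all_cword ell_cword wprod_cword !eqxx.
Qed.

Lemma reduced_size_cpositions q : wlong_positions m q -> size q =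
  size (cpositions 0 m).
Proof.
have := wlong_cpositions; rewrite /wlong_positions /reduced_word !size_map.
by case/andP=> _ /and3P[_ /eqP -> _] /andP[_ /and3P[_ /eqP -> _]].
Qed.

(* Within a round the next position is the least possible; between the rounds
   r - 1 and r, the skipped letters are descents. *)
Lemma cpositions_greedy_gap r i y b : r < m -> i < m - r ->
  wlong_positions m (cpositions 0 r ++ iota (r * m) i ++ y :: b) ->
    r * m + i <= y.
Proof.
move=> rm im /andP[so red]; rewrite leqNgt; apply/negP => lt_y.
case: i => [|i] in im so red lt_y *; last first.
  move: so; rewrite (sorted_pairwise ltn_trans) !pairwise_cat.
  case/and3P=> _ _ /and3P[/allrelP/(_ (r * m + i) y) lt _ _].
  by have := lt ltac:(rewrite mem_iota; lia) (mem_head _ _); lia.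
case: r => [|r] in rm im so red lt_y *; first by lia.
have lt_last : r * m + (m - r.+1) < y.
  move: so; rewrite cpositions_rcons /= add0n (sorted_pairwise ltn_trans)
    pairwise_cat.
  case/and3P=> /allrelP/(_ (r * m + (m - r.+1)) y) lt _ _; apply: lt;
    last exact: mem_head.
  by rewrite mem_cat mem_iota; lia.
have ym : y %% m = y - r * m.
  rewrite -[in LHS](subnKC (_ : r * m <= y)); last by lia.
  by rewrite modnMDl modn_small //; rewrite mulSn in lt_y; lia.
move: red; rewrite /reduced_word /= /subword_at map_cat /= -/(subword_at m _)
  subword_cpositions.
case/and3P=> al /eqP sz /eqP wE.
have := reduced_no_descent al; rewrite sz wE => /(_ erefl).
have [vE _] := cword_prefix0 (ltnW rm).
have vI l : l <= m -> (inord l : 'I_m.+1) = l :> nat by exact: inordK.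
rewrite -[cword_rounds r.+1]cats0 !vE ym !vI; try by rewrite mulSn in lt_y; lia.
by rewrite /cword_value; rewrite mulSn in lt_y; do ?case: ifP; lia.
Qed.

(** Entry by entry: after agreement so far, [cpositions_greedy_gap] bounds the next entry below by
    the greedy one. A larger entry decides the comparison, an equal one extends the agreement. *)
Lemma cpositions_greedy r b : r <= m -> wlong_positions m (cpositions 0 r ++ b)
  ->
  (cpositions r (m - r) <= b :> seqlexi nat)%O.
Proof.
move Ed: (m - r) => d; elim: d r Ed b => [|d IHd] r Ed b rm vb;
  first exact: lexi0s.
have lt_rm : r < m by lia.
rewrite cpositionsS.
suff inner e i b' : m - r = i + e -> wlong_positions m (cpositions 0 r ++ iota
  (r * m) i ++ b') ->
    (iota (r * m + i) e ++ cpositions r.+1 d <= b' :> seqlexi nat)%O.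
  by have := inner (m - r) 0 b; rewrite addn0; apply.
elim: e i b' => [|e IHe] i b' ie vb'.
  apply: IHd; try lia; move: vb'; rewrite catA -[in X in _ ->
    X](add0n r) => vb'.
  by rewrite cpositions_rcons add0n ie addn0.
(* The sequence cannot stop here, because all reduced words of the longest element have the same
   length. *)
case: b' => [|y b'] in vb' *.
  have := reduced_size_cpositions vb'; rewrite -[in RHS](subnKC rm) Ed.
  rewrite /cpositions iotaD map_cat flatten_cat -/(cpositions 0 r)
    -/(cpositions _ d.+1).
  by rewrite cpositionsS !size_cat !size_iota /= add0n; lia.
have im : i < m - r by lia.
have le_y := cpositions_greedy_gap lt_rm im vb'.
rewrite /= lexi_cons.
apply/andP; split; first exact: le_y.
apply/implyP => ge_y; have yE : y = r * m + i by apply/eqP;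
  rewrite eqn_leq le_y andbT.
rewrite -addnS; apply: IHe; first by lia.
by move: vb'; rewrite yE -cat1s -addn1 iotaD -!catA.
Qed.

Lemma c_sorting_wordE w : c_sorting_word m w -> w = cword_rounds m.
Proof.
case=> p [-> vp min_p]; rewrite -subword_cpositions; congr (subword_at m _).
apply: (@le_anti _ (seqlexi nat)); rewrite min_p ?wlong_cpositions //=.
by have := @cpositions_greedy 0 p (leq0n m) vp; rewrite subn0.
Qed.

(** * The inversion sequence in lexicographic order *)

Definition lexrow (q n : nat) : seq ('I_m.+1 * 'I_m.+1) :=
  [seq (inord q, inord j) | j <- iota q.+1 n].

Definition lexrows (r : nat) : seq ('I_m.+1 * 'I_m.+1) :=
  flatten [seq lexrow q (m - q) | q <- iota 0 r].

Lemma lexrowsS r : lexrows r.+1 = lexrows r ++ lexrow r (m - r).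
Proof.
by rewrite /lexrows -[X in iota 0 X]addn1 iotaD map_cat flatten_cat /= cats0.
Qed.

Lemma wprod_rev (w : seq nat) : wprod m (rev w) = ((wprod m w)^-1)%g.
Proof.
elim/last_ind: w => [|w i IHw]; first by rewrite /wprod /= invg1.
rewrite rev_rcons -cat1s wprod_cat IHw wprod_rcons /permmul invMg.
by rewrite /wprod /= permmul1 tpermV.
Qed.

Lemma inv_seq_rcons w i : inv_seq m (rcons w i) =
  rcons (inv_seq m w) (tperm (wprod m w (inord i)) (wprod m w (inord i.+1))).
Proof.
rewrite /inv_seq size_rcons -(addn1 (size w)) iotaD map_cat -[RHS]cats1 /=
  add0n.
congr cat; last first.
  rewrite take_oversize ?size_rcons // -cats1 take_size_cat // cats1;
    congr (_ :: _).
  by rewrite wprod_cat wprod_rcons wprod_rev /permmul -tpermJ conjgE.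
apply/eq_in_map => j; rewrite mem_iota add0n => /andP[_ jw].
by rewrite -cats1 !takel_cat // ltnW.
Qed.

(** When the letter x of round r is read, the positions x and x + 1 hold the values r and r + x + 1.
    Round r thus lists the transpositions with smaller point r in increasing order. *)
Lemma inv_seq_round r x : r < m -> x <= m - r ->
  inv_seq m (cword_rounds r) = [seq tperm p.1 p.2 | p <- lexrows r] ->
  inv_seq m (cword_rounds r ++ iota 0 x) =
  [seq tperm p.1 p.2 | p <- lexrows r ++ lexrow r x].
Proof.
move=> rm xm inv0; elim: x xm => [|x IHx] xm; first by rewrite !cats0.
have wE : cword_rounds r ++ iota 0 x.+1 = rcons (cword_rounds r ++ iota 0 x) x.
  by rewrite -cats1 -catA -[X in iota 0 X]addn1 iotaD.
have iE : iota r.+1 x.+1 = iota r.+1 x ++ [:: r.+1 + x] by rewrite -(addn1 x)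
  iotaD.
rewrite wE inv_seq_rcons (IHx (ltnW xm)) /lexrow iE.
rewrite !map_cat catA /= cats1; congr (rcons _ (tperm _ _)); apply: ord_inj;
  have [vE _] := cword_prefix rm (ltnW xm); rewrite vE !inordK //; try by lia.
  by rewrite /cword_value ltnn eqxx.
by rewrite /cword_value; do ?case: ifP; lia.
Qed.

Lemma inv_seq_cword : inv_seq m (cword_rounds m) =
  [seq tperm p.1 p.2 | p <- lexrows m].
Proof.
suff : forall r, r <= m -> inv_seq m (cword_rounds r) =
  [seq tperm p.1 p.2 | p <- lexrows r].
  exact.
elim=> // r IHr rm.
by rewrite cword_roundsS lexrowsS inv_seq_round // IHr // ltnW.
Qed.

Definition lexlt (p q : 'I_m.+1 * 'I_m.+1) : bool :=
  (p.1 < q.1) || (p.1 == q.1 :> nat) && (p.2 < q.2).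

Lemma lexlt_trans : transitive lexlt.
Proof. by move=> q p r; rewrite /lexlt; lia. Qed.

Lemma lexlt_irr : irreflexive lexlt.
Proof. by move=> p; rewrite /lexlt !ltnn andbF. Qed.

Lemma lexrow_lt q n p : q + n <= m -> p \in lexrow q n ->
  p.1 = q :> nat /\ p.1 < p.2.
Proof.
move=> qn /mapP[j + ->] /=; rewrite mem_iota => /andP[qj jn].
by rewrite !inordK //; lia.
Qed.

Lemma sorted_lexrows r : r <= m ->
  sorted lexlt (lexrows r) /\ all (fun p : 'I_m.+1 * 'I_m.+1 =>
    (p.1 < r) && (p.1 < p.2)) (lexrows r).
Proof.
elim: r => // r IHr rm; have [so al] := IHr (ltnW rm).
have qn : r + (m - r) <= m by lia.
rewrite lexrowsS; split.
  rewrite (sorted_pairwise lexlt_trans) pairwise_cat -!(sorted_pairwise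
    lexlt_trans) so /=.
  apply/andP; split.
    apply/allrelP => p q /(allP al) /andP[pr _] /(lexrow_lt qn)[qr _].
    by rewrite /lexlt qr pr.
  rewrite /lexrow sorted_map; apply: (@sub_in_sorted _ (fun j => j <= m) ltn);
    last first.
  - exact: iota_ltn_sorted.
  - by apply/allP => j; rewrite mem_iota; lia.
  move=> i j im jm ij; rewrite /lexlt /= eqxx ltnn /= !inordK //.
rewrite all_cat; apply/andP; split; apply/allP => p.
  by move/(allP al) => /andP[pr ->]; rewrite andbT (ltn_trans pr).
by move=> /(lexrow_lt qn)[-> ->]; rewrite ltnSn.
Qed.

Lemma mem_lexrows (p : 'I_m.+1 * 'I_m.+1) : (p \in lexrows m) = (p.1 < p.2).
Proof.
have [_ al] := sorted_lexrows (leqnn m).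
apply/idP/idP => [/(allP al) /andP[] //|lt_p].
have pm := ltn_ord p.2; apply/flatten_mapP; exists (val p.1);
  first by rewrite mem_iota /=; lia.
apply/mapP; exists (val p.2); first by rewrite mem_iota /=; lia.
by rewrite !inord_val; case: p {lt_p pm}.
Qed.

Lemma uniq_lexrows : uniq (lexrows m).
Proof. by apply: (sorted_uniq lexlt_trans lexlt_irr);
  have [] := sorted_lexrows (leqnn m). Qed.

Definition inv_pairs u : seq ('I_m.+1 * 'I_m.+1) :=
  [seq p <- lexrows m | (u^-1)%g p.2 < (u^-1)%g p.1].

Lemma inv_cE w u : c_sorting_word m w ->
  inv_c w u = [seq tperm p.1 p.2 | p <- inv_pairs u].
Proof.
move=> /c_sorting_wordE ->; rewrite /inv_c inv_seq_cword filter_map; congr map.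
by apply/eq_in_filter => p; rewrite mem_lexrows => /= /mem_Invs ->.
Qed.

Lemma size_inv_pairs u : size (inv_pairs u) = ell u.
Proof.
rewrite -card_Invs_pairs cardE; apply/perm_size/uniq_perm.
- exact/filter_uniq/uniq_lexrows.
- exact: enum_uniq.
by move=> p; rewrite mem_filter mem_enum inE mem_lexrows andbC.
Qed.

End Inversions.

(** * Lexicographic factorizations of noncrossing permutations *)

Section Factorization.
Variable m : nat.
Implicit Types u v w : 'S_m.+1.
Implicit Types J : seq ('I_m.+1 * 'I_m.+1).

Definition pairs_prod J : 'S_m.+1 := permprod [seq tperm p.1 p.2 | p <- J].

Lemma pairs_prod_rev J : pairs_prod (rev J) = ((pairs_prod J)^-1)%g.
Proof.
elim/last_ind: J => [|J p IHJ]; first by rewrite invg1.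
rewrite rev_rcons /pairs_prod /= map_rcons -cats1 permprod_cat -/(pairs_prod _)
  IHJ.
by rewrite [permprod [:: _]]permmul1 /permmul invMg tpermV.
Qed.

Lemma cyc_pairs_prod J : m.+1 <= cyc (pairs_prod J) + size J.
Proof.
elim: J => [|p J IHJ]; first by rewrite /pairs_prod /= cyc1 addn0.
apply: leq_trans IHJ _; rewrite addnS -addSn leq_add2r.
exact: cyc_tperm_le.
Qed.

Lemma mem_nc_pairs v p : (p \in nc_pairs v) = (p.1 < p.2) && (v p.1 == p.2).
Proof.
apply/mapP/andP => [[x]|[lt_p /eqP vp]].
  by rewrite mem_filter => /andP[xv _] ->.
by exists p.1; [rewrite mem_filter mem_enum vp andbT | rewrite vp;
  case: p {lt_p vp}].
Qed.

Lemma sorted_nc_pairs v : sorted (@lexlt m) (nc_pairs v).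
Proof.
rewrite /nc_pairs sorted_map; apply: (@sub_sorted _ (fun x y : 'I_m.+1 =>
  x < y)).
  by move=> x y xy; rewrite /lexlt /= xy.
apply: sorted_filter => [y x z|]; first exact: ltn_trans.
by have := iota_ltn_sorted 0 m.+1; rewrite -val_enum_ord sorted_map.
Qed.

(** A first pair (i, j) is peeled off. The rest factors the noncrossing permutation (i j) v, so by
    induction it lists its arcs, all of which come after (i, j). This excludes every splitting
    except the one along an arc i -> j of [v]. *)
Lemma nc_pairs_unique J v : noncrossing v -> sorted (@lexlt m) J ->
  all (fun p : 'I_m.+1 * 'I_m.+1 => p.1 < p.2) J -> pairs_prod J = v ->
  size J + cyc v = m.+1 -> J = nc_pairs v.
Proof.
elim: J v => [|[i j] J IHJ] v ncv.
  move=> _ _ <- _; rewrite /nc_pairs -[LHS]/(map (fun x => (x,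
    pairs_prod [::] x)) [::]); congr map.
  by apply/esym/eqP; rewrite -(negbK (_ == _)) -has_filter; apply/hasPn => x _;
    rewrite perm1 ltnn.
rewrite /= => soJ /andP[ij Jlt] vE sz.
have v1E : pairs_prod J = permmul (tperm i j) v.
  by rewrite -vE /pairs_prod /= permmulA {2}/permmul tperm2 permmul1l.
have cJ := cyc_pairs_prod J.
(* If (i j) merged two cycles of [v], the remaining product would have fewer cycles than [size J]
   transpositions allow. *)
have ji : j \in porbit v i.
  apply: contraT => nji; have nij : i \notin porbit v j by rewrite porbit_sym.
  have := cyc_tperm_merge nij; rewrite -cyc_tperml -v1E; lia.
have cv1 : cyc (pairs_prod J) = (cyc v).+1.
  rewrite v1E cyc_tperml cyc_tperm_split //; last by rewrite porbit_sym.
  by rewrite -val_eqE /=; lia.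
have ncv1 : noncrossing (pairs_prod J) by rewrite v1E; apply: step_noncrossing.
have JE := IHJ _ ncv1 (path_sorted soJ) Jlt erefl ltac:(lia).
have lexJ p : p \in J -> lexlt (i, j) p.
  by move: soJ; rewrite (path_sortedE (@lexlt_trans m)) =>
    /andP[/allP al _] /al.
have /andP[ij0 j0j] := step_j0 ncv ij ji; have i0P := step_i0 ncv ji.
have wi0 := step_wi0 v i; have wj0 := step_wj0 v j.
have vi0 := step_vi0 v i j; have vj0 := step_vj0 v i j.
have vx := @step_v _ v i j; rewrite -v1E in vi0 vj0 vx.
set j0 := (v^-1)%g j in ij0 j0j wj0 vj0 vx; set i0 := (v^-1)%g i in i0P wi0 vi0
  vx.
(* An [i0] below i would give (i j) v the arc i0 -> j, which comes before (i, j). *)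
have ji0 : j <= i0.
  case: (ltnP i0 i) i0P => //= lt_i0 _.
  have /lexJ : (i0, j) \in J by rewrite JE mem_nc_pairs /= vi0 eqxx andbT
    (ltn_trans lt_i0).
  by rewrite /lexlt /=; lia.
(* Otherwise i keeps its image, giving an arc i -> v i with v i < j, again too early. *)
have j0i : j0 = i.
  apply/eqP; apply: contraT => j0i.
  have lt_i : i < j0 by rewrite ltn_neqAle ij0 andbT eq_sym.
  have i_i0 : i != i0 by rewrite -val_eqE /=; lia.
  have := nc_between (y := i) ncv ji; rewrite leqnn ij => /(_ isT) /andP[iv vj].
  have vij : v i != j by apply: contra_neq j0i => e; rewrite /j0 -e permK.
  have /lexJ : (i, v i) \in J.
    by rewrite JE mem_nc_pairs /= vx ?eqxx ?iv // eq_sym.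
  by rewrite /lexlt /= ltnn eqxx /= ltnNge vj.
apply: (irr_sorted_eq (@lexlt_trans m) (@lexlt_irr m)) => // [|[a b]];
  first exact: sorted_nc_pairs.
rewrite inE JE !mem_nc_pairs /= xpair_eqE.
have [->|ai] := eqVneq a i.
  have vi : v i = j by rewrite -{1}j0i.
  have v1i : pairs_prod J i = i by rewrite -{1}j0i.
  rewrite vi v1i [j == b]eq_sym; case: (eqVneq b j) => [->|_];
    rewrite ?ij ?andbF //=.
  by apply/andP => -[ib /eqP bi]; rewrite bi ltnn in ib.
have [->|ai0] := eqVneq a i0.
  rewrite vi0 wi0 /=; apply/andP/andP => -[lt /eqP e]; move: lt; rewrite -e;
    lia.
by rewrite vx // j0i.
Qed.

Lemma nperm_nbands J : all (fun p : 'I_m.+1 * 'I_m.+1 => p.1 < p.2) J ->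
  nperm m (nbands [seq (nat_of_ord p.1, nat_of_ord p.2) | p <- J]) =
    pairs_prod J.
Proof.
elim: J => // -[i j] J IHJ /= /andP[ij /IHJ JE].
rewrite -[nbands _]/(nband (nat_of_ord i, nat_of_ord j) ++ nbands _) nperm_cat
  JE.
by rewrite nperm_nband ?inord_val // ij -ltnS ltn_ord.
Qed.

Lemma pairs_prod_nc w : lifted w -> pairs_prod (nc_pairs w) = w.
Proof.
case=> _ {2}<-; rewrite braid_permE natw_nc_word nperm_nbands //.
by apply/allP => p; rewrite mem_nc_pairs => /andP[].
Qed.

(* The first factor is inverse to the noncrossing permutation tprod s c, whose
   only factorization in lexicographic order is the one by its arcs. *)
Lemma complement_nc J (s : seq (transp m * bool)) :
  sorted (@lexlt m) J -> all (fun p : 'I_m.+1 * 'I_m.+1 => p.1 < p.2) J ->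
  (size J + size s == m) &&
    (permmul (pairs_prod (rev J)) (tprod s) == (cox m)^-1%g) =
  good (cox m) s && (J == nc_pairs (permmul (tprod s) (cox m))).
Proof.
move=> soJ Jlt; set v := permmul (tprod s) (cox m).
have prodE : (permmul (pairs_prod (rev J)) (tprod s) == (cox m)^-1%g) =
  (pairs_prod J == v).
  rewrite pairs_prod_rev /v /permmul; apply/eqP/eqP => [e|->].
    have := congr1 (fun x => x^-1)%g e; rewrite invMg !invgK => cE.
    by rewrite -cE mulgKV.
  by rewrite invMg mulKVg.
rewrite prodE; apply/andP/andP => [[/eqP sz /eqP vE]|[gs /eqP JE]].
  have gs : good (cox m) s.
    rewrite /good cyc_cox eqn_leq -{1}(cyc_cox m) cyc_tprod_le -/v -vE.
    by have := cyc_pairs_prod J; lia.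
  split=> //; apply/eqP/nc_pairs_unique => //.
    by have [[]] := good_lifted (lifted_cox m) gs.
  by move: gs; rewrite /good cyc_cox => /eqP ->; lia.
have [lv eE] := good_lifted (lifted_cox m) gs.
rewrite JE pairs_prod_nc // eqxx size_nc_pairs; split=> //.
by rewrite -eE exc_cox.
Qed.

End Factorization.

(** * Permutations with initial descents *)

Section InitialDescents.
Variable m : nat.
Implicit Types u v w : 'S_m.+1.
Implicit Types A D : {set 'I_m.+1}.

(** The set A of the overview: for [u] in [Snk m k] the least value 0 stands at position k, at the
    turn from descents to ascents, and these are the k values before it. *)
Definition before0 u : {set 'I_m.+1} := [set x | (u^-1)%g x < (u^-1)%g ord0].

Lemma card_lt_ord (p : 'I_m.+1) : #|[set q : 'I_m.+1 | q < p]| = p.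
Proof.
have -> : [set q : 'I_m.+1 | q < p] = widen_ord (ltnW (ltn_ord p)) @: [set:
  'I_p].
  apply/setP => q; rewrite inE; apply/idP/imsetP => [qp|[x _ ->]];
    last by rewrite /= ltn_ord.
  by exists (Ordinal qp) => //; apply: ord_inj.
rewrite card_imset ?cardsT ?card_ord // => x y /(congr1 val) /= /ord_inj //.
Qed.

(* The one-line notation of u in [Snk m k] lists [before0 u] decreasingly, then
   its complement increasingly; this is the position of x in that list. *)
Definition hook_rank A (x : 'I_m.+1) : nat :=
  if x \in A then #|[set y in A | x < y]| else #|A| + #|[set y in ~: A | y <
    x]|.

Section Snk.
Variables (k : nat) (u : 'S_m.+1).
Hypotheses (km : k <= m) (uk : u \in Snk m k).

Let vI l : l <= m -> (inord l : 'I_m.+1) = l :> nat. Proof. exact: inordK. Qed.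

Lemma Snk_des l : l < m -> (u (inord l.+1) < u (inord l)) = (l < k).
Proof.
move=> lm; move: uk; rewrite inE => /eqP/setP/(_ (Ordinal lm)).
by rewrite mem_Des inE.
Qed.

Lemma Snk_dec (x y : 'I_m.+1) : x < y -> y <= k -> u y < u x.
Proof.
have dec d l : l + d.+1 <= k -> u (inord (l + d.+1)) < u (inord l).
  elim: d => [|d IHd] lk; first by rewrite addn1 Snk_des //; lia.
  apply: ltn_trans (IHd _); last by lia.
  by rewrite addnS Snk_des //; lia.
move=> xy yk; rewrite -[x]inord_val -[y]inord_val.
by have := dec (y - x.+1) x; rewrite addnS -addSn subnKC //; apply.
Qed.

Lemma Snk_inc (x y : 'I_m.+1) : x < y -> k <= x -> u x < u y.
Proof.
have asc l : k <= l -> l < m -> u (inord l) < u (inord l.+1).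
  move=> kl lm; rewrite ltn_neqAle leqNgt Snk_des // -leqNgt kl andbT val_eqE.
  by apply/eqP => /perm_inj/(congr1 val) /=; rewrite !vI //; lia.
have inc d l : k <= l -> l + d.+1 <= m -> u (inord l) < u (inord (l + d.+1)).
  move=> kl; elim: d => [|d IHd] lm; first by rewrite addn1 asc //; lia.
  apply: ltn_trans (IHd _) _; first by lia.
  by rewrite (addnS l d.+1) asc //; lia.
move=> xy kx; rewrite -[x in u x]inord_val -[y]inord_val.
have := inc (y - x.+1) x kx; rewrite addnS -addSn subnKC //; apply.
by rewrite -ltnS ltn_ord.
Qed.

Lemma Snk_pos0 : (u^-1)%g ord0 = k :> nat.
Proof.
suff -> : ord0 = u (inord k) by rewrite permK vI.
apply/eqP; apply: contraT => ne0.
have := permKV u ord0; set p := (u^-1)%g ord0 => up.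
have pk : p != k :> nat.
  by apply: contra_neq ne0 => pk; rewrite -up -[p]inord_val pk.
case: (ltngtP p k) pk => // lt_pk _.
  have := @Snk_dec p (inord k) ltac:(rewrite vI //) ltac:(rewrite vI //).
  by rewrite up.
have := @Snk_inc (inord k) p ltac:(rewrite vI //) ltac:(rewrite vI //).
by rewrite up.
Qed.

Lemma Snk_before0 x : (x \in before0 u) = ((u^-1)%g x < k).
Proof. by rewrite inE Snk_pos0. Qed.

(** A value of A is in the decreasing part, so it stands before every smaller value; a value outside
    A is in the increasing part, after every smaller value. *)
Lemma Snk_inverted (i j : 'I_m.+1) : i < j ->
  ((u^-1)%g j < (u^-1)%g i) = (j \in before0 u).
Proof.
move=> ij; rewrite Snk_before0; set p := (u^-1)%g j; set q := (u^-1)%g i.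
have up : u p = j := permKV u j; have uq : u q = i := permKV u i.
have npq : p != q :> nat.
  by apply/eqP => /ord_inj e; move: ij; rewrite -up -uq e ltnn.
apply/idP/idP => [pq|pk].
  rewrite ltnNge; apply/negP => kp; have := Snk_inc pq kp.
  by rewrite up uq ltnNge ltnW.
rewrite ltnNge leq_eqVlt negb_or eq_sym npq /=; apply/negP => qp.
have := Snk_dec qp (ltnW pk); rewrite up uq; lia.
Qed.

Lemma card_before0 : #|before0 u| = k.
Proof.
have -> : before0 u = u @: [set q : 'I_m.+1 | q < (inord k : 'I_m.+1)].
  apply/setP => x; rewrite Snk_before0; apply/idP/imsetP => [xk|[q]].
    by exists ((u^-1)%g x); rewrite ?inE ?vI ?permKV.
  by rewrite inE vI // => qk ->; rewrite permK.
by rewrite card_imset ?card_lt_ord ?vI //; apply: perm_inj.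
Qed.

Lemma Snk_rank x : (u^-1)%g x = hook_rank (before0 u) x :> nat.
Proof.
rewrite /hook_rank; set p := (u^-1)%g x; have up : u p = x := permKV u x.
(* A set of values is counted through the positions of its elements. *)
have pE (S : {set 'I_m.+1}) (f : pred 'I_m.+1) : (forall y, (y \in S) =
  f ((u^-1)%g y)) ->
    #|S| = #|[set q | f q]|.
  move=> SE; rewrite -(card_imset [set q | f q] (@perm_inj _ u));
    congr #|pred_of_set _|.
  apply/setP => y; rewrite SE; apply/idP/imsetP => [fy|[q]].
    by exists ((u^-1)%g y); rewrite ?inE ?permKV.
  by rewrite inE => fq ->; rewrite permK.
case: ifP => xk; rewrite Snk_before0 -/p in xk.
  rewrite (pE _ (fun q : 'I_m.+1 => q < p)) ?card_lt_ord // => y.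
  rewrite inE Snk_before0; set q := (u^-1)%g y; have uq : u q = y := permKV u y.
  apply/andP/idP => [[qk xy]|qp].
    rewrite ltnNge leq_eqVlt negb_or; apply/andP; split.
      by apply/eqP => /ord_inj e; move: xy; rewrite -up -uq e ltnn.
    by apply/negP => pq; have := Snk_dec pq (ltnW qk); rewrite up uq; lia.
  have := Snk_dec qp (ltnW xk); rewrite up uq => ->; split=> //.
  exact: ltn_trans xk.
rewrite card_before0 (pE _ (fun q : 'I_m.+1 => k <= q < p)); last first.
  move=> y; rewrite !inE Snk_pos0 -leqNgt; set q := (u^-1)%g y;
    have uq : u q = y := permKV u y.
  apply/andP/andP => -[kq lt]; split=> //.
    rewrite ltnNge leq_eqVlt negb_or; apply/andP; split.
      by apply/eqP => /ord_inj e; move: lt; rewrite -up -uq e ltnn.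
    apply/negP => pq; have := Snk_inc pq; rewrite up uq leqNgt xk => /(_ isT);
      lia.
  by have := Snk_inc lt kq; rewrite up uq.
have kp : k <= p by rewrite leqNgt xk.
have := cardsID [set q : 'I_m.+1 | q < (inord k : 'I_m.+1)] [set q : 'I_m.+1 |
  q < p].
rewrite card_lt_ord (_ : _ :&: _ = [set q : 'I_m.+1 | q < (inord k :
  'I_m.+1)]); last first.
  by apply/setP => q; rewrite !inE vI //; lia.
rewrite card_lt_ord vI // => e; rewrite -[LHS]e; congr (_ + _);
  congr #|pred_of_set _|.
by apply/setP => q; rewrite !inE -leqNgt.
Qed.

End Snk.

Lemma hook_rank_in A x y : x \in A -> y \in A -> x < y ->
  hook_rank A y < hook_rank A x.
Proof.
rewrite /hook_rank => xA yA xy; rewrite xA yA; apply: proper_card;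
  apply/properP; split.
  by apply/subsetP => z; rewrite !inE => /andP[-> yz]; rewrite (ltn_trans xy).
by exists y; rewrite !inE ?yA ?xy ?ltnn.
Qed.

Lemma hook_rank_out A x y : x \notin A -> y \notin A -> x < y ->
  hook_rank A x < hook_rank A y.
Proof.
rewrite /hook_rank => xA yA xy; rewrite (negPf xA) (negPf yA) ltn_add2l.
apply: proper_card; apply/properP; split.
  by apply/subsetP => z; rewrite !inE => /andP[-> zx]; rewrite (ltn_trans zx).
by exists x; rewrite !inE ?xA ?xy ?ltnn ?andbF.
Qed.

Lemma hook_rank_lt A x : (hook_rank A x < #|A|) = (x \in A).
Proof.
rewrite /hook_rank; case: ifP => xA; last by rewrite ltnNge leq_addr.
apply: proper_card; apply/properP; split.
  by apply/subsetP => z; rewrite inE => /andP[].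
by exists x; rewrite // !inE ltnn andbF.
Qed.

Lemma hook_rank_le A x : hook_rank A x <= m.
Proof.
have cA : #|A| + #|~: A| = m.+1 by rewrite cardsC card_ord.
have [xA|xA] := boolP (x \in A).
  have := hook_rank_lt A x; rewrite xA; lia.
rewrite /hook_rank (negPf xA) -ltnS; apply: leq_trans (_ : _ < #|A| + #|~: A|)
  _; last by rewrite cA.
rewrite ltn_add2l.
apply: proper_card; apply/properP; split.
  by apply/subsetP => z; rewrite inE => /andP[].
by exists x; rewrite !inE ?xA ?ltnn ?andbF.
Qed.

Lemma hook_rank_inj A : injective (fun x => inord (hook_rank A x) : 'I_m.+1).
Proof.
move=> x y /(congr1 val) /=; rewrite !inordK ?ltnS ?hook_rank_le // => e.
have := hook_rank_lt A x; rewrite e hook_rank_lt => xyA.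
apply: ord_inj; case: (ltngtP x y) => // xy; move: e.
  case: (boolP (x \in A)) xyA => xA yA; last have := hook_rank_out xA (negbT
    yA) xy; first have := hook_rank_in xA yA xy; lia.
case: (boolP (x \in A)) xyA => xA yA; last have := hook_rank_out (negbT yA) xA
  xy; first have := hook_rank_in yA xA xy; lia.
Qed.

Lemma hook_surj k A : k <= m -> ord0 \notin A -> #|A| = k ->
  exists2 u, u \in Snk m k & before0 u = A.
Proof.
move=> km A0 cA; pose rho : 'S_m.+1 := perm (@hook_rank_inj A).
have rE x : rho x = hook_rank A x :> nat by rewrite permE inordK // ltnS
  hook_rank_le.
have A_lt x : (hook_rank A x < k) = (x \in A) by rewrite -cA hook_rank_lt.
exists (rho^-1)%g; last first.
  apply/setP => x; rewrite inE invgK !rE -A_lt; congr (_ < _).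
  rewrite /hook_rank (negPf A0) cA (_ : #|_| = 0) ?addn0 //.
  by apply/eqP; rewrite cards_eq0; apply/eqP/setP => y; rewrite !inE ltn0 andbF.
rewrite inE; apply/eqP/setP => i; rewrite mem_Des inE.
set a := (rho^-1)%g (inord i); set b := (rho^-1)%g (inord i.+1).
have im := ltn_ord i.
have ra : hook_rank A a = i by rewrite -rE permKV inordK //; lia.
have rb : hook_rank A b = i.+1 by rewrite -rE permKV inordK.
have aA := A_lt a; have bA := A_lt b; rewrite ra in aA; rewrite rb in bA.
have ab : a != b :> nat by apply/eqP => /ord_inj e; move: ra; rewrite e rb; lia.
apply/idP/idP => [ba|ik].
  rewrite aA; apply: contraT => na; rewrite (negPf na) in aA.
  have nb : b \notin A by rewrite -bA; lia.
  by have := hook_rank_out nb na ba; lia.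
rewrite ik in aA; case: (boolP (b \in A)) => [bA'|nb].
  rewrite ltnNge leq_eqVlt negb_or ab /=; apply/negP => lt_ab.
  by have := hook_rank_in (esym aA) bA' lt_ab; lia.
(* Position i + 1 is then the first one outside A, and it holds the least element of the complement,
   which is 0. *)
have b0 : b = ord0.
  case: (eqVneq b ord0) => // b0.
  have lt0 : 0 < b by rewrite lt0n; move: b0; rewrite -val_eqE.
  have := hook_rank_out A0 nb (lt0 : ord0 < b); have := hook_rank_lt A ord0.
  by rewrite (negPf A0) cA rb; lia.
have a0 : 0 < a by rewrite lt0n; move: ab; rewrite b0.
by rewrite b0.
Qed.

(** A set A containing D and avoiding 0 is encoded by the set of nonzero points outside A, an (m -
    k)-subset of the m - |D| nonzero points outside D. *)
Lemma card_Snk_before D k : k <= m -> ord0 \notin D -> 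
  #|[set u in Snk m k | D \subset before0 u]| = 'C(m - #|D|, m - k).
Proof.
move=> km D0.
have inj : {in [set u in Snk m k | D \subset before0 u] &, injective before0}.
  move=> u v; rewrite inE => /andP[uk _]; rewrite inE => /andP[vk _] e.
  apply: invg_inj; apply/permP => x; apply: ord_inj.
  by rewrite (Snk_rank km uk) (Snk_rank km vk) e.
have cE : #|(~: D) :\ ord0| = m - #|D|.
  have := cardsC D; rewrite card_ord (cardsD1 ord0 (~: D)) !inE D0 /= add1n
    addnS.
  by case=> e; rewrite -[X in _ = X - _]e addKn.
rewrite -(card_in_imset inj) -cE -cards_draws.
pose f (B : {set 'I_m.+1}) := ~: (ord0 |: B).
have f_inj : {in [set B : {set 'I_m.+1} | B \subset ~: D :\ ord0 & #|B| == m -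
  k] &, injective f}.
  move=> B C; rewrite !inE !subsetD1 => /andP[/andP[_ B0] _] /andP[/andP[_ C0]
    _].
  by move=> /setC_inj e; rewrite -(setU1K B0) e setU1K.
rewrite -(card_in_imset f_inj); congr #|pred_of_set _|.
apply/setP => A; apply/imsetP/imsetP => [[u]|[B]].
  rewrite inE => /andP[uk Du] ->.
  have u0 : ord0 \notin before0 u by rewrite inE ltnn.
  exists (~: (ord0 |: before0 u)); last first.
    apply/setP => x; rewrite !inE; case: (eqVneq x ord0) => [->|_] /=;
      first by rewrite ltnn.
    by rewrite negbK.
  rewrite !inE subsetD1 !inE eqxx andbT; apply/andP; split.
    by rewrite setCS (subset_trans Du) // subsetUr.
  have := cardsC (ord0 |: before0 u); rewrite card_ord cardsU1 u0 (card_before0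
    km uk).
  by rewrite /= add1n addSn => -[e]; rewrite -[X in _ == X - _]e addKn.
rewrite inE subsetD1 => /andP[/andP[BD B0] /eqP cB] ->.
have [||u uk uA] := @hook_surj k (f B) km.
- by rewrite !inE eqxx.
- have : 1 + (m - k) + #|f B| = m.+1.
    by rewrite -cB -[RHS](card_ord m.+1) -(cardsC (ord0 |: B)) cardsU1 B0.
  by move: #|f B| => n; lia.
exists u => //; rewrite inE uk uA; apply/subsetP => x xD; rewrite !inE negb_or.
apply/andP; split; first by apply: contraNneq D0 => <-.
by apply/negP => /(subsetP BD); rewrite inE xD.
Qed.

End InitialDescents.

(** * Counting subwords *)

(** The reversed word of c has m letters, and fewer transpositions cannot bring m + 1 cycles down to
    one. *)
Lemma ellT_cox m : ellT (cox m)^-1%g = m.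
Proof.
rewrite /ellT; case: ex_minnP => k /existsP[s /andP[sT /eqP sE]] min_k.
apply/eqP; rewrite eqn_leq; apply/andP; split.
  apply: min_k; apply/existsP.
  pose w := [seq simple m i | i <- rev (iota 0 m)].
  have sz : size w == m by rewrite size_map size_rev size_iota.
  exists (Tuple sz) => /=; rewrite -[permprod w]/(wprod m (rev (iota 0 m))).
  rewrite wprod_rev [wprod _ _](esym (coxE m)) eqxx andbT.
  apply/allP => _ /mapP[i + ->]; rewrite mem_rev mem_iota => /andP[_ im].
  by apply/imsetP; exists (inord i, inord i.+1); rewrite // inE /= simple_lt.
have cyc_ge (r : seq 'S_m.+1) : all [in transps m] r ->
  m.+1 <= cyc (permprod r) + size r.
  elim: r => [|x r IHr] /=; first by rewrite cyc1 addn0.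
  case/andP=> /imsetP[p _ ->] /IHr; rewrite addnS -addSn => le;
    apply: leq_trans le _.
  by rewrite leq_add2r cyc_tperm_le.
have := cyc_ge s sT; rewrite sE size_tuple /cyc porbitsV -/(cyc _) cyc_cox.
by rewrite add1n ltnS.
Qed.

Local Open Scope ring_scope.

Section SubwordCounts.
Variable m : nat.
Implicit Types (s : seq (transp m * bool)) (u : 'S_m.+1).

Definition tops s : {set 'I_m.+1} :=
  [set permmul (tprod s) (cox m) x | x : 'I_m.+1 in
    [set x : 'I_m.+1 | x < permmul (tprod s) (cox m) x]%N].

Lemma card_tops s : good (cox m) s -> #|tops s| = (m - size s)%N.
Proof.
move=> gs; have [_] := good_lifted (lifted_cox m) gs.
rewrite exc_cox /tops card_imset; last exact: perm_inj.
by move=> e; rewrite -/(exc _) [X in _ = (X - _)%N]e addnK.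
Qed.

Lemma tops0 s : ord0 \notin tops s.
Proof. by apply/imsetP => -[x]; rewrite inE => + e; rewrite -e. Qed.

(** By [complement_nc] only the list of arcs can contribute, and it occurs at most once since
    [inv_pairs u] has no repetition. *)
Lemma sum_inv_pairs s u (x : int) :
  \sum_(J <- sublists (inv_pairs u))
    (if ((size J + size s)%N == m) &&
        (permmul (pairs_prod (rev J)) (tprod s) == (cox m)^-1%g) then x else 0)
          =
  if good (cox m) s && subseq (nc_pairs (permmul (tprod s) (cox m))) (inv_pairs
    u)
  then x else 0.
Proof.
have soI : sorted (@lexlt m) (inv_pairs u).
  by apply: sorted_filter; [exact: lexlt_trans | have [] := sorted_lexrows
    (leqnn m)].
have -> : \sum_(J <- sublists (inv_pairs u))
    (if ((size J + size s)%N == m) &&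
        (permmul (pairs_prod (rev J)) (tprod s) == (cox m)^-1%g) then x else 0)
          =
  \sum_(J <- sublists (inv_pairs u)) (good (cox m) s)%:R * x *
    (J == nc_pairs (permmul (tprod s) (cox m)))%:R.
  apply: eq_big_seq => J; rewrite mem_sublists => subJ.
  rewrite complement_nc //.
  - by case: good; case: eqP => _; rewrite ?mul1r ?mulr1 ?mulr0 ?mul0r.
  - exact: (subseq_sorted (@lexlt_trans m) subJ).
  - apply/allP => p /(mem_subseq subJ); rewrite mem_filter => /andP[_].
    by rewrite mem_lexrows.
rewrite -big_distrr /= sum_sublists_eq; last exact/filter_uniq/uniq_lexrows.
by case: good; case: subseq; rewrite ?mul1r ?mulr1 ?mulr0 ?mul0r.
Qed.

(** Both lists are sorted lexicographically, so being a subsequence is inclusion, and membership of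
    an increasing pair in [inv_pairs u] depends on its upper end alone. *)
Lemma subseq_inv_pairs (v : 'S_m.+1) k u : (k <= m)%N -> u \in Snk m k ->
  subseq (nc_pairs v) (inv_pairs u) =
  ([set v x | x : 'I_m.+1 in [set x : 'I_m.+1 | x < v x]%N] \subset before0 u).
Proof.
move=> km uk; have memI p : (p \in inv_pairs u) =
  (p.1 < p.2)%N && (p.2 \in before0 u).
  rewrite mem_filter mem_lexrows andbC; case: ltnP => //= lt_p.
  exact: Snk_inverted km uk _ _ lt_p.
apply/idP/subsetP => [/mem_subseq sub y /imsetP[x]|sub].
  rewrite inE => xv ->; have := sub (x, v x).
  by rewrite mem_nc_pairs memI /= xv eqxx => /(_ isT).
have -> : nc_pairs v = [seq p <- inv_pairs u | p \in nc_pairs v].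
  apply: (irr_sorted_eq (@lexlt_trans m) (@lexlt_irr m));
    first exact: sorted_nc_pairs.
    do 2 ![apply: sorted_filter; first exact: lexlt_trans].
    by have [] := sorted_lexrows (leqnn m).
  move=> p; rewrite mem_filter andb_idr // mem_nc_pairs memI =>
    /andP[lt_p /eqP vp].
  by rewrite lt_p -vp sub // imset_f // inE vp.
exact: filter_subseq.
Qed.

Lemma zip_nseq (T : Type) (a : seq T) : zip a (nseq (size a) true) =
  [seq (x, true) | x <- a].
Proof. by elim: a => //= x a ->. Qed.

(** A subword of the concatenation is a subword of each part. The first part has only signs 1, and
    for a fixed [s] in the second it offers at most one choice, by [sum_inv_pairs]. *)
Lemma sub_T_concat k u w (t : seq (transp m)) (eps : seq bool) : size t =
  size eps ->
  (k <= m)%N -> u \in Snk m k -> c_sorting_word m w ->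
  sub_T (nseq (ell u) true ++ eps) (rev (inv_c w u) ++ [seq tperm_of x | x <-
    t]) (cox m)^-1%g =
  \sum_(s <- sublists (zip t eps))
    (if good (cox m) s && (tops s \subset before0 u) then esgn s else 0).
Proof.
move=> sz km uk cw; have szI : size (rev (inv_c w u)) = ell u.
  by rewrite size_rev (inv_cE _ cw) size_map size_inv_pairs.
rewrite sub_T_sublists; last by rewrite !size_cat szI size_nseq size_map sz.
rewrite zip_cat ?szI ?size_nseq // -szI zip_nseq ellT_cox (inv_cE _ cw)
  -map_rev.
have -> : zip [seq tperm_of x | x <- t] eps =
  [seq (tperm_of x.1, x.2) | x <- zip t eps].
  by elim: t eps sz => [|x t IHt] [|e eps] //= [/IHt ->].
rewrite -map_comp big_sublists_cat !sublists_map big_map big_sublists_rev.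
rewrite exchange_big /= big_map; apply: eq_bigr => s _.
rewrite -(subseq_inv_pairs _ km uk) -sum_inv_pairs; apply: eq_bigr => J _.
rewrite size_cat !size_map size_rev /unzip1 map_cat -!map_comp permprod_cat.
rewrite [permprod [seq _ | x <- rev J]](_ : _ = pairs_prod (rev J)) //.
rewrite [permprod [seq _ | x <- s]](_ : _ = tprod s) //.
case: ifP => // _; rewrite big_cat !big_map /= [X in X * _]big1 ?mul1r //.
Qed.

End SubwordCounts.

(** * Binomial identities and the theorem *)

Lemma binomial_coef_sum m n (W y : int) : (n <= m)%N ->
  \sum_(k < m.+1) (-1) ^+ (m + k) * 'C(n, m - k)%:R *+
     (- W - m.+1%:Z + 1 + (2 * k)%N%:Z == y) =
  binomial_coef n (m - n)%N%:Z (y + W).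
Proof.
move=> nm; rewrite binomial_coefE.
rewrite [RHS](big_ord_widen m.+1 (fun l => (-1) ^+ l * 'C(n, l)%:R *
   (y + W == (m - n)%N%:Z + n%:Z - l%:Z *+ 2)%:R)) ?ltnS //.
(* With k = m - l the exponent condition becomes y + W = m - 2 l, and the sign (-1)^(m + k) becomes
   (-1)^l. *)
rewrite [RHS]big_mkcond (reindex_inj rev_ord_inj) /=; apply: eq_bigr => l _.
have lm : (l <= m)%N by rewrite -ltnS.
rewrite subSS subKn // ltnS.
case: leqP => [ln|nl]; last by rewrite bin_small // mulr0 mul0rn.
rewrite -mulr_natr; congr (_ * _ * (nat_of_bool _)%:R); last by lia.
rewrite -signr_odd -[RHS]signr_odd; congr (_ ^+ nat_of_bool _).
by rewrite oddD oddB // addKb.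
Qed.

(** The lowest exponent in a^(m - n) (a - a^-1)^n is m - 2 n, which reaches -m only for n = m. *)
Lemma binomial_coef_lowest m n : (n <= m)%N ->
  binomial_coef n (m - n)%N%:Z (- m%:Z) = if n == m then (-1) ^+ m else 0.
Proof.
move=> nm; rewrite binomial_coefE; have [->|ne] := eqVneq n m.
  rewrite big_ord_recr /= binn big1 ?add0r.
    rewrite mulr1 (_ : _ == _) ?mulr1 //; lia.
  move=> l _; rewrite (_ : (_ == _) = false) ?mulr0 //; have := ltn_ord l; lia.
rewrite big1 // => l _; rewrite (_ : (_ == _) = false) ?mulr0 //.
by have := ltn_ord l; lia.
Qed.

Lemma sum_Snk_sub_T m k w (t : seq (transp m)) (eps : seq bool) : size t =
  size eps ->
  (k <= m)%N -> c_sorting_word m w ->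
  \sum_(u in Snk m k)
    sub_T (nseq (ell u) true ++ eps) (rev (inv_c w u) ++ [seq tperm_of x | x <-
      t])
      (cox m)^-1%g =
  \sum_(s <- sublists (zip t eps))
    (if good (cox m) s then esgn s * 'C(size s, m - k)%:R else 0).
Proof.
move=> sz km cw; under eq_bigr => u uk do rewrite (sub_T_concat sz km uk cw).
rewrite exchange_big /=; apply: eq_bigr => s _.
case: ifP => gs /=; last by rewrite big1.
(* [tops s] has m - |s| elements, so the upper index is m - (m - |s|) = |s|. *)
have -> : 'C(size s, m - k) = #|[set u in Snk m k | tops s \subset before0 u]|.
  by rewrite (card_Snk_before km (tops0 s)) card_tops // subKn ?good_size.
by rewrite cardsE -big_mkcondr sumr_const mulr_natr.
Qed.

Theorem theorem9p3 (HOMFLYPT : seq slice -> laurent_az) (m : nat)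
    (beta : braid m) (g : 'S_m.+1) (gb : braid m)
    (M : nat) (t : M.-tuple (transp m)) (eps : M.-tuple bool) :
  is_HOMFLYPT HOMFLYPT ->
  is_knot (braid_closure beta) ->
  permprod [:: g; braid_perm beta; (g^-1)%g] = cox m ->
  braid_perm gb = g ->
  braid_eq (gb ++ beta ++ braid_inv gb ++ braid_inv (braid_cox m))
           (flatten [seq pure_PP x.1 x.2 | x <- zip t eps]) ->
  let P := HOMFLYPT (braid_closure beta) in
  [/\ regular_at_z0 P,
      (-1) ^+ m * sub_T eps [seq tperm_of x | x <- t] (cox m)^-1%g
        = (at_z0 P)@_(- writhe beta - m.+1%:Z + 1)
    & forall w : seq nat, c_sorting_word m w ->
      at_z0 P =
        \sum_(k < m.+1)
          << (-1) ^+ (m + k) *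
             (\sum_(u in Snk m k)
                sub_T (nseq (ell u) true ++ eps)
                      (rev (inv_c w u) ++ [seq tperm_of x | x <- t])
                      (cox m)^-1%g)
             *g - writhe beta - m.+1%:Z + 1 + (2 * k)%:Z >>].
Proof.
move=> homH _ gE _ factor P.
have sz : size t = size eps by rewrite !size_tuple.
(* Being conjugate to c, the permutation of [beta] has one cycle, so [zmin] is 0: regularity
   excludes negative powers of z, and [lead] reads the coefficients of z^0. *)
have cyc1 : cyc (nperm m (natw beta)) = 1%N.
  rewrite -braid_permE -[RHS](cyc_cox m) -gE /= permmul1 cyc_permmulC /permmul.
  by rewrite mulKVg.
have PE : P = homfly HOMFLYPT m (natw beta).
  by rewrite /P braid_closureE.
have coefE x : (at_z0 P)@_x = blead HOMFLYPT beta (x + writhe beta).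
  rewrite mcoeff_at_z0 PE /blead /lead -writheE addrK /zmin cyc1.
  by congr (mcoeff (_, _) _); lia.
split.
- move=> i j j0; rewrite PE; apply: (regular_all homH (m := m)) => //.
    exact: below_natw.
  by rewrite /zmin cyc1; lia.
- rewrite coefE (blead_formula homH _ factor) sub_T_sublists ?size_map //
    ellT_cox.
  have -> : zip [seq tperm_of x | x <- t] eps =
    [seq (tperm_of x.1, x.2) | x <- zip t eps].
    by elim: (tval t) (tval eps) sz => [|x t' IHt] [|e eps'] //= [/IHt ->].
  rewrite sublists_map big_map big_distrr /=; apply: eq_bigr => s _.
  (* Subwords of [t] alone are the case of an empty [J]. It must be the list of arcs, so |s| = m,
     and the coefficient at -m is then (-1)^m. *)
  have := @complement_nc m [::] s isT isT; rewrite /= add0n permmul1l size_map.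
  rewrite /unzip1 -!map_comp [permprod _](_ : _ = tprod s) // => ->.
  case gs: (good (cox m) s); last by rewrite mulr0.
  have [lv] := good_lifted (lifted_cox m) gs; rewrite exc_cox => eE.
  have -> : ([::] == nc_pairs (permmul (tprod s) (cox m))) = (size s == m).
    by rewrite eq_sym -size_eq0 size_nc_pairs; lia.
  rewrite (_ : - writhe beta - m.+1%:Z + 1 + writhe beta = - m%:Z); last by lia.
  rewrite /= binomial_coef_lowest ?good_size //; case: eqP => _;
    last by rewrite !mulr0.
  by rewrite big_map mulrC.
- move=> w cw; apply/malgP => y; rewrite coefE (blead_formula homH _ factor).
  rewrite raddf_sum /=.
  under [RHS]eq_bigr => k _ do rewrite mcoeffU (sum_Snk_sub_T sz (leq_ord k)
    cw).
  under [RHS]eq_bigr => k _ do rewrite big_distrr /= -sumrMnl.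
  (* For a fixed [s], the sum over k is the expansion of a^(m - |s|) (a - a^-1)^|s|. *)
  rewrite exchange_big; apply: eq_bigr => s _; case: ifP => gs; last first.
    by rewrite big1 // => k _; rewrite mulr0 mul0rn.
  rewrite -(binomial_coef_sum _ _ (good_size gs)) big_distrr;
    apply: eq_bigr => k _ /=.

  by rewrite [LHS]mulrnAr mulrCA.
Qed.
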